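(* The map $\phi$ is a size-preserving bijection from rooted (closed) combinatorial maps to rooted indecomposable chord diagrams, and its restriction to bridgeless maps is equal to $\theta$. Consequently $\phi$ sends bridgeless maps to connected chord diagrams.
   Context: Chord diagrams: a diagram of size $n$ is a perfect matching of $2n$ linearly ordered points into chords (up to isomorphism); the root chord contains the first point; intervals are the $2n-1$ gaps between consecutive points, numbered $1,\dots,2n-1$ from left to right. Connected: the graph on chords joining crossing chords ($(a,b),(c,d)$ with $a<c<b<d$) is connected. Indecomposable: not a side-by-side concatenation of two nonempty diagrams. $R_k(C)$ adds a new root chord with left endpoint before all points and right endpoint in interval $k$ of $C$; $\mathrm{Ins}_{D',k}(C)$ places the whole diagram $D'$ inside interval $k$ of $C$. Maps: a rooted map is $(H,\sigma,\alpha,r)$, $\sigma$ a permutation, $\alpha$ an involution of the finite set $H$, $\alpha(r)=r$, $\langle\sigma,\alpha\rangle$ transitive, closed ($r$ the only fixed point of $\alpha$); vertices are $\sigma$-orbits, edges $\alpha$-orbits; size = number of edges (root included); bridgeless = no bridge in the underlying graph. Drawn with $\sigma$ counterclockwise; a corner lies between $h$ and $\sigma(h)$; root corner between $r$ and $\sigma(r)$; root edge contains $\sigma(r)$. Corners ($2n-1$ of them for size $n$) are numbered by the Bridge First Labeling: root corner gets $1$; from the corner labeled $k$, let $e$ be the edge adjacent to it counterclockwise: if $e$ is a bridge of the current map, go along $e$ to the next corner at its other end and label it $k+1$; if $e$ is dangling, label the next corner counterclockwise $k+1$; otherwise cut $e$ into two dangling edges and label the next corner counterclockwise $k+1$; stop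 upon reaching the root. $R_k(N)$ adds an edge joining the root corner to the $k$-th corner (it becomes the root edge); $\mathrm{Ins}_{M',k}(N)$ attaches map $M'$ by its root at the $k$-th corner of $N$, the root of $M'$ becoming a bridge. Boxed products: for connected diagrams $C_1,C_2$ and $1\le i\le 2|C_2|-1$, $C_1\star_i C_2=R_i(C_2)$ if $C_1$ is the one-chord diagram, and $C_1\star_iC_2=R_{i+\ell}(\mathrm{Ins}_{C_2,\ell}(\widehat{C_1}))$ if $C_1=R_\ell(\widehat{C_1})$. For bridgeless maps, identically $M_1\star_iM_2=R_i(M_2)$ if $M_1$ is the one-half-edge map and $R_{i+\ell}(\mathrm{Ins}_{M_2,\ell}(\widehat{M_1}))$ if $M_1=R_\ell(\widehat{M_1})$. Every connected diagram (resp. bridgeless map) of size $>1$ is uniquely of the form $C_1\star_iC_2$ (resp. $M_1\star_iM_2$) with $C_1,C_2$ connected (resp. $M_1,M_2$ bridgeless). $\theta$: $\theta$(one-half-edge map) = one-chord diagram, and $\theta(M_1\star_iM_2)=\theta(M_1)\star_i\theta(M_2)$. $\phi$: $\phi$(one-half-edge map) = one-chord diagram; if the root edge of $M$ is a bridge, write $M=\mathrm{Ins}_{M_\downarrow,1}(M_\uparrow)$ and set $\phi(M)=\mathrm{Ins}_{\phi(M_\downarrow),1}(\phi(M_\uparrow))$; otherwise write $M=R_k(M')$ and set $\phi(M)=R_k(\phi(M'))$. *)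

(* Defs.v *)
From Stdlib Require Import ClassicalEpsilon.
From mathcomp Require Import all_boot.

Set Implicit Arguments.
Unset Strict Implicit.
Unset Printing Implicit Defensive.

(* A diagram of size n on the linearly ordered points 0 < 1 < ... < 2n-1 is *)
(* encoded canonically (isomorphism of linearly ordered matchings is the    *)
(* identity) by the sequence p of length 2n with p`_i = partner of point i. *)
(* Interval k (1 <= k <= 2n-1) is the gap between points k-1 and k.         *)

Definition diag := seq nat.

Definition dpt (p : diag) (i : nat) : nat := nth 0 p i.

Definition valid_diag (p : diag) : Prop :=
  forall i, i < size p -> [/\ dpt p i < size p, dpt p i != i & dpt p (dpt p i) = i].

Definition dsize (p : diag) : nat := size p %/ 2.

Definition one_chord : diag := [:: 1; 0].

(* R_k(C): new root chord from before all points to interval k of C. *)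
Definition dR (k : nat) (p : diag) : diag :=
  let g j := if j < k then j.+1 else j.+2 in
  mkseq (fun i => if i == 0 then k.+1
                  else if i == k.+1 then 0
                  else g (dpt p (if i <= k then i.-1 else i - 2)))
        (size p).+2.

(* Ins_{D',k}(C): the whole diagram D' placed inside interval k of C. *)
Definition dIns (D' : diag) (k : nat) (p : diag) : diag :=
  let n2 := size D' in
  let f j := if j < k then j else j + n2 in
  mkseq (fun i => if i < k then f (dpt p i)
                  else if i < k + n2 then dpt D' (i - k) + k
                  else f (dpt p (i - n2)))
        (size p + n2).

Definition dcross (p : diag) (i j : nat) : bool :=
  let a := minn i (dpt p i) in let b := maxn i (dpt p i) in
  let c := minn j (dpt p j) in let d := maxn j (dpt p j) in
  ((a < c) && (c < b) && (b < d)) || ((c < a) && (a < d) && (d < b)).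

Inductive creach (p : diag) (i : nat) : nat -> Prop :=
| cr_refl : creach p i i
| cr_mate j : creach p i j -> creach p i (dpt p j)
| cr_cross j l : creach p i j -> l < size p -> dcross p j l -> creach p i l.

Definition connected_diag (p : diag) : Prop :=
  0 < size p /\ forall i j, i < size p -> j < size p -> creach p i j.

Definition indecomposable (p : diag) : Prop :=
  0 < size p /\
  forall j, 0 < j -> j < size p -> ~ (forall i, i < j -> dpt p i < j).

Definition dstar (C1 : diag) (i : nat) (C2 : diag) (C : diag) : Prop :=
  (C1 = one_chord /\ C = dR i C2) \/
  (exists l Ch, [/\ valid_diag Ch, 0 < l, l < size Ch, C1 = dR l Ch
                 & C = dR (i + l) (dIns C2 l Ch)]).

(* Rooted maps (H, sigma, alpha, r) with H = {0, ..., mh-1}; sigma and      *)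
(* alpha are given by their value sequences.                                *)

Record rmap := RMap { mh : nat; msig : seq nat; malp : seq nat; mroot : nat }.

Definition sig (M : rmap) (h : nat) : nat := nth 0 (msig M) h.
Definition alp (M : rmap) (h : nat) : nat := nth 0 (malp M) h.

Inductive mreach (M : rmap) : nat -> Prop :=
| mr_root : mreach M (mroot M)
| mr_sig h : mreach M h -> mreach M (sig M h)
| mr_alp h : mreach M h -> mreach M (alp M h).

Definition valid_map (M : rmap) : Prop :=
  [/\ size (msig M) = mh M, size (malp M) = mh M, mroot M < mh M
    & forall h, h < mh M -> sig M h < mh M /\ alp M h < mh M] /\
  [/\
      forall h1 h2, h1 < mh M -> h2 < mh M -> sig M h1 = sig M h2 -> h1 = h2,
      forall h, h < mh M -> alp M (alp M h) = h /\ (alp M h = h <-> h = mroot M)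
    & forall h, h < mh M -> mreach M h].

(* size = number of edges (root half-edge included) *)
Definition msize (M : rmap) : nat := (mh M).+1 %/ 2.

Definition map_iso (M1 M2 : rmap) : Prop :=
  mh M1 = mh M2 /\
  exists f : nat -> nat,
    [/\ forall h, h < mh M1 -> f h < mh M2,
        forall h1 h2, h1 < mh M1 -> h2 < mh M1 -> f h1 = f h2 -> h1 = h2,
        forall h, h < mh M1 -> f (sig M1 h) = sig M2 (f h),
        forall h, h < mh M1 -> f (alp M1 h) = alp M2 (f h)
      & f (mroot M1) = mroot M2].

Definition one_half_edge_map : rmap := RMap 1 [:: 0] [:: 0] 0.

(* Connectivity of the underlying graph (vertices = sigma-orbits, edges =
   alpha-orbits of size 2) of the map with sigma-sequence s and
   alpha-sequence a, with the edge {e, a e} deleted: half-edge x reaches y. *)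
Inductive conn_wo (s a : seq nat) (e x : nat) : nat -> Prop :=
| cw_refl : conn_wo s a e x x
| cw_sig y : conn_wo s a e x y -> conn_wo s a e x (nth 0 s y)
| cw_alp y : conn_wo s a e x y -> y <> e -> y <> nth 0 a e ->
             conn_wo s a e x (nth 0 a y).

(* the edge containing half-edge h is a bridge (a genuine, non-dangling edge
   whose deletion disconnects its two endpoints) *)
Definition is_bridge (s a : seq nat) (h : nat) : Prop :=
  nth 0 a h <> h /\ ~ conn_wo s a h h (nth 0 a h).

Definition bridgeb (s a : seq nat) (h : nat) : bool :=
  if excluded_middle_informative (is_bridge s a h) then true else false.

Definition bridgeless (M : rmap) : Prop :=
  forall h, h < mh M -> ~ is_bridge (msig M) (malp M) h.

(* Bridge First Labeling.  A corner is represented by the half-edge h such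
   that the corner lies between h and sigma h.  The state is the current
   corner together with the current alpha (edges get cut along the way). *)
Definition bfl_step (s : seq nat) (st : nat * seq nat) : nat * seq nat :=
  let: (c, a) := st in
  let h' := nth 0 s c in
  if bridgeb s a h' then (nth 0 a h', a)
  else if nth 0 a h' == h' then (h', a)
  else (h', set_nth 0 (set_nth 0 a h' h') (nth 0 a h') (nth 0 a h')).

(* the corner labeled k (k >= 1) *)
Definition corner (N : rmap) (k : nat) : nat :=
  (iter k.-1 (bfl_step (msig N)) (mroot N, malp N)).1.

(* R_k(N): new edge {a, b} with a = mh N inserted in the root corner (so
   that sigma r = a and it becomes the root edge) and b = mh N + 1 inserted
   in the k-th corner. *)
Definition mapR (k : nat) (N : rmap) : rmap :=
  let m := mh N in let r := mroot N in let c := corner N k in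
  let sg h :=
    if h == r then m
    else if h == m then (if c == r then m.+1 else sig N r)
    else if h == m.+1 then (if c == r then sig N r else sig N c)
    else if h == c then m.+1
    else sig N h in
  let al h := if h == m then m.+1 else if h == m.+1 then m else alp N h in
  RMap m.+2 (mkseq sg m.+2) (mkseq al m.+2) r.

(* Ins_{M',k}(N): M' (half-edges shifted by mh N) attached by its root to
   a new half-edge x = mh N + mh M' inserted in the k-th corner of N; the
   root of M' and x form a new edge (a bridge). *)
Definition mapIns (M' : rmap) (k : nat) (N : rmap) : rmap :=
  let m := mh N in let m' := mh M' in let x := m + m' in
  let c := corner N k in
  let sg h :=
    if h < m then (if h == c then x else sig N h)
    else if h < x then sig M' (h - m) + m
    else sig N c in
  let al h :=
    if h < m then alp N h
    else if h < x then (if h - m == mroot M' then x else alp M' (h - m) + m)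
    else mroot M' + m in
  RMap x.+1 (mkseq sg x.+1) (mkseq al x.+1) (mroot N).

Definition mstar (M1 : rmap) (i : nat) (M2 : rmap) (M : rmap) : Prop :=
  (map_iso M1 one_half_edge_map /\ map_iso M (mapR i M2)) \/
  (exists l N, [/\ valid_map N, 0 < l, l <= mh N, map_iso M1 (mapR l N)
                 & map_iso M (mapR (i + l) (mapIns M2 l N))]).

Inductive theta_rel : rmap -> diag -> Prop :=
| th_single M : map_iso M one_half_edge_map -> theta_rel M one_chord
| th_star M M1 M2 i D1 D2 D :
    valid_map M1 -> valid_map M2 -> bridgeless M1 -> bridgeless M2 ->
    0 < i -> i <= mh M2 ->
    mstar M1 i M2 M ->
    theta_rel M1 D1 -> theta_rel M2 D2 -> dstar D1 i D2 D ->
    theta_rel M D.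

Inductive phi_rel : rmap -> diag -> Prop :=
| phi_single M : map_iso M one_half_edge_map -> phi_rel M one_chord
| phi_bridge M Md Mu Dd Du :
    valid_map Md -> valid_map Mu ->
    map_iso M (mapIns Md 1 Mu) ->
    phi_rel Md Dd -> phi_rel Mu Du ->
    phi_rel M (dIns Dd 1 Du)
| phi_root M M' k D' :
    valid_map M' -> 0 < k -> k <= mh M' ->
    map_iso M (mapR k M') ->
    phi_rel M' D' ->
    phi_rel M (dR k D').

(* Main.v *)
(* Both sides are decomposed at the root.  A rooted map either is trivial, or its
   root edge is a bridge (M = Ins_{M',1} N), or the root edge can be deleted
   (M = R_k N); an indecomposable diagram decomposes in the same way according to
   the shortest closed block of points following the first point.  The
   decompositions are unique, and the labels k match because the corners of R_k N
   and Ins_{M',k} N are labeled exactly like the intervals of the corresponding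
   diagrams; that the labeling reaches every corner follows from these formulas
   by induction along the decomposition.

   For the comparison with theta, phi commutes with Ins_{M',l} for every l: an
   insertion away from corner 1 slides past the outermost operation.  If M = R_k M'
   is bridgeless and M' is not, every bridge of M' separates the root from corner
   k; cutting M' at the last one writes it as Ins_{M2,l} N with M2 bridgeless and
   l < k <= l + mh M2, so that M = (R_l N) star_{k-l} M2. *)
From Stdlib Require Import ClassicalEpsilon FunctionalExtensionality Classical.
Require Import Defs.
From mathcomp Require Import all_boot zify.

Set Implicit Arguments.
Unset Strict Implicit.
Unset Printing Implicit Defensive.

(** * Chord diagrams *)

Local Arguments dpt : simpl never.
Local Arguments dR : simpl never.
Local Arguments dIns : simpl never.

(** The labels are the delicate point. They come from a process that cuts edges and asks for bridges
    of the partly cut map, so a corner of [mapR k N] can be compared with one of [N] only through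
    the whole state of the process: [extR] and [extI] extend states of the parts to a state of the
    composite, and each step commutes with this extension. The comparison presupposes that labels of
    [N] are distinct, since only the corner labeled [k] may be split there; distinctness follows by
    counting once every corner has a label, and that fact is in turn drawn from the root
    decomposition. To avoid the circle, the decomposition is carried out with unlabeled corners
    ([mapRc], [mapInsc]) and labels are attached afterwards. Maps matter only up to isomorphism,
    whereas diagrams are literal sequences. Hence the map half of each identity is an explicit
    renumbering of half-edges and the diagram half is an equality. A map with [mh M] half-edges
    corresponds to [(mh M).+1] points, so corners and intervals both carry the labels [1..mh M]. *)

Lemma size_dR k p : size (dR k p) = (size p).+2.
Proof. by rewrite size_mkseq. Qed.

Lemma size_dIns D k p : size (dIns D k p) = size p + size D.
Proof. by rewrite size_mkseq. Qed.

Lemma dpt_dR k p i : i < (size p).+2 ->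
  dpt (dR k p) i =
  if i == 0 then k.+1 else if i == k.+1 then 0 else
  let j := dpt p (if i <= k then i.-1 else i - 2) in
  if j < k then j.+1 else j.+2.
Proof. by move=> hi; rewrite /dpt /dR nth_mkseq. Qed.

Lemma dpt_dIns D k p i : i < size p + size D ->
  dpt (dIns D k p) i =
  if i < k then (let j := dpt p i in if j < k then j else j + size D)
  else if i < k + size D then dpt D (i - k) + k
  else (let j := dpt p (i - size D) in if j < k then j else j + size D).
Proof. by move=> hi; rewrite /dpt /dIns nth_mkseq. Qed.

Lemma diag_ext (p q : diag) : size p = size q ->
  (forall i, i < size p -> dpt p i = dpt q i) -> p = q.
Proof. by move=> hs h; apply: (eq_from_nth (x0 := 0)). Qed.

Lemma valid_one_chord : valid_diag one_chord.
Proof. by case=> [|[|i]]. Qed.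

Lemma indec_one_chord : indecomposable one_chord.
Proof. by split=> // [[|[|j]]] // _ _ /(_ 0 isT). Qed.

Ltac ifs := repeat match goal with
  | |- context [if ?b then _ else _] =>
     lazymatch b with context [if _ then _ else _] => fail | _ => let H := fresh "Hif" in case H : b end
  | H : context [if ?b then _ else _] |- _ =>
     lazymatch b with context [if _ then _ else _] => fail | _ => let H' := fresh "Hif" in case H' : b H => H end
  end.

Lemma valid_dR k p : valid_diag p -> k <= size p -> valid_diag (dR k p).
Proof.
move=> vp hk i; rewrite size_dR => hi.
have [i0|i0] := eqVneq i 0.
  subst i; rewrite dpt_dR //= !dpt_dR //= ?eqxx.
  by split => //; lia.
have [ik|ik] := eqVneq i k.+1.
  subst i; rewrite !dpt_dR //= ?eqxx //; split=> //; lia.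
rewrite [dpt _ i]dpt_dR // (negbTE i0) (negbTE ik) /=.
set i' := (if i <= k then _ else _).
have hi' : i' < size p by rewrite /i'; case: ifP; lia.
have [h1 h2 h3] := vp _ hi'.
set j := dpt p i' in h1 h2 h3 *.
have Hj : dpt p (if (if j < k then j.+1 else j.+2) <= k then (if j < k then j.+1 else j.+2).-1
   else (if j < k then j.+1 else j.+2) - 2) = i'.
  rewrite -h3; congr dpt; ifs; lia.
rewrite dpt_dR; last by case: ifP; lia.
rewrite Hj /=; split.
- case: ifP; lia.
- by rewrite /i' in h2; ifs; lia.
- by rewrite /i'; ifs; lia.
Qed.

Lemma valid_dIns D k p : valid_diag D -> valid_diag p -> k <= size p ->
  valid_diag (dIns D k p).
Proof.
move=> vD vp hk i; rewrite size_dIns => hi.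
rewrite [dpt _ i]dpt_dIns //.
have [c1|c1] := boolP (k <= i < k + size D).
  have hi' : i - k < size D by lia.
  have [h1 h2 h3] := vD _ hi'.
  have -> : (i < k) = false by lia.
  have -> : (i < k + size D) = true by lia.
  rewrite dpt_dIns; last lia.
  have -> : (dpt D (i - k) + k < k) = false by lia.
  have -> : (dpt D (i - k) + k < k + size D) = true by lia.
  by rewrite addnK h3; split; lia.
set i' := if i < k then i else i - size D.
have hi' : i' < size p by rewrite /i'; case: ifP; lia.
have [h1 h2 h3] := vp _ hi'.
have -> : (if i < k then let j := dpt p i in if j < k then j else j + size D
    else if i < k + size D then dpt D (i - k) + k
    else let j := dpt p (i - size D) in if j < k then j else j + size D) =
   if dpt p i' < k then dpt p i' else dpt p i' + size D.
  by rewrite /i' /=; case: ifP => // ?; have -> : (i < k + size D) = false by lia.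
set j := dpt p i' in h1 h2 h3 *.
rewrite dpt_dIns; last by case: ifP; lia.
have -> : (if (if j < k then j else j + size D) < k then
     let j0 := dpt p (if j < k then j else j + size D) in if j0 < k then j0 else j0 + size D
  else if (if j < k then j else j + size D) < k + size D then
     dpt D ((if j < k then j else j + size D) - k) + k
  else let j0 := dpt p ((if j < k then j else j + size D) - size D) in
    if j0 < k then j0 else j0 + size D) = if i' < k then i' else i' + size D.
  have [jk|jk] := ltnP j k; first by rewrite jk h3.
  have -> : (j + size D < k) = false by lia.
  have -> : (j + size D < k + size D) = false by lia.
  by rewrite addnK h3.
by rewrite /i' in h2 *; split; ifs; lia.
Qed.

(** A closed prefix contains the partner [k.+1] of point 0, so deleting the two root points leaves a
    closed prefix of [p] of length [j - 2]; [0 < k] keeps it nonempty. *)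
Lemma indec_dR k p : indecomposable p -> 0 < k < size p -> indecomposable (dR k p).
Proof.
move=> [p0 ip] hk; split=> [|j j0]; rewrite size_dR // => hj H.
have := H 0 j0; rewrite dpt_dR // eqxx => hkj.
apply: (ip (j - 2)); [lia|lia|] => i hi.
have [ik|ik] := ltnP i k.
  have := H i.+1; rewrite dpt_dR; last lia.
  have -> : (i.+1 == 0) = false by lia.
  have -> : (i.+1 == k.+1) = false by lia.
  rewrite ik /=; case: ifP; lia.
have := H i.+2; rewrite dpt_dR; last lia.
have -> : (i.+2 == 0) = false by lia.
have -> : (i.+2 == k.+1) = false by lia.
have -> : (i.+2 <= k) = false by lia.
rewrite subSS subn1 /=; case: ifP; lia.
Qed.

(** The partner of point 0 lies behind the inserted block, so a closed prefix contains the whole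
    block, and removing the block leaves a closed prefix of [p]. *)
Lemma indec_dIns1 D p : valid_diag p -> indecomposable p -> indecomposable (dIns D 1 p).
Proof.
move=> vp [p0 ip]; split=> [|j j0]; rewrite size_dIns; first lia.
move=> hj H.
have [h1 h2 h3] := vp _ p0.
have := H 0 j0; rewrite dpt_dIns ?ltnS /=; last lia.
have -> : (dpt p 0 < 1) = false by lia.
move=> hj2.
apply: (ip (j - size D)); [lia|lia|] => i hi.
have [->|i0] := eqVneq i 0; first lia.
have := H (i + size D); rewrite dpt_dIns; last lia.
have -> : (i + size D < 1) = false by lia.
have -> : (i + size D < 1 + size D) = false by lia.
rewrite addnK /=; case: ifP; lia.
Qed.

(** * Recovering the outermost operation from a diagram *)

Lemma dR_inj k p k' p' : dR k p = dR k' p' -> k <= size p -> k = k' /\ p = p'.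
Proof.
move=> e hk.
have es : size p = size p' by have := congr1 size e; rewrite !size_dR; lia.
have ek : k = k'.
  by have := congr1 (fun p => dpt p 0) e; rewrite !dpt_dR //=; lia.
subst k'; split=> //; apply: diag_ext => // i hi.
have [ik|ik] := ltnP i k.
  have := congr1 (fun p => dpt p i.+1) e; rewrite !dpt_dR ?es; try lia.
  have -> : (i.+1 == 0) = false by lia.
  have -> : (i.+1 == k.+1) = false by lia.
  rewrite ik /=; ifs; lia.
have := congr1 (fun p => dpt p i.+2) e; rewrite !dpt_dR ?es; try lia.
have -> : (i.+2 == 0) = false by lia.
have -> : (i.+2 == k.+1) = false by lia.
have -> : (i.+2 <= k) = false by lia.
rewrite subSS subn1 /=; ifs; lia.
Qed.

(** Points [1..j] are matched among themselves and some point follows them. Among indecomposable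
    diagrams this singles out the form [dIns Dd 1 Du], so it is the counterpart of a bridge at the
    root. *)
Definition closed_block (D : diag) (j : nat) : bool :=
  [&& 0 < j, j.+1 < size D & all (fun i => 0 < dpt D i <= j) (iota 1 j)].

Lemma closed_blockP D j :
  reflect [/\ 0 < j, j.+1 < size D & forall i, 0 < i <= j -> 0 < dpt D i <= j]
          (closed_block D j).
Proof.
apply: (iffP and3P) => -[h1 h2 h3]; split=> //.
  by move=> i hi; apply: (allP h3); rewrite mem_iota; lia.
by apply/allP => i; rewrite mem_iota => hi; apply: h3; lia.
Qed.

Lemma closed_block_dIns Dd Du : valid_diag Dd -> 0 < size Dd -> 1 < size Du ->
  closed_block (dIns Dd 1 Du) (size Dd).
Proof.
move=> vd d0 u1; apply/closed_blockP; rewrite size_dIns; split=> // [|i hi]; first lia.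
rewrite dpt_dIns; last lia.
have -> : (i < 1) = false by lia.
have -> : (i < 1 + size Dd) = true by lia.
have hi' : i - 1 < size Dd by lia.
by have [] := vd _ hi'; lia.
Qed.

(** A shorter closed block would be a closed proper prefix of [Dd]. *)
Lemma closed_block_dIns_ge Dd Du j : indecomposable Dd -> 0 < size Du ->
  closed_block (dIns Dd 1 Du) j -> size Dd <= j.
Proof.
move=> [d0 id] u0 /closed_blockP[j0 _ H]; rewrite leqNgt; apply/negP => hj.
apply: (id j) => // i hi; have := H i.+1.
rewrite dpt_dIns; last lia.
have -> : (i.+1 < 1) = false by lia.
have -> : (i.+1 < 1 + size Dd) = true by lia.
rewrite subn1 /=; lia.
Qed.

(** The block cannot contain [k.+1], whose partner is 0; lying before it, the block would be a
    closed proper prefix of [p]. *)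
Lemma no_closed_block_dR k p j : indecomposable p -> k < size p -> closed_block (dR k p) j = false.
Proof.
move=> [p0 ip] hk; apply/negP => /closed_blockP[j0]; rewrite size_dR => jp H.
have kj : ~~ (k.+1 <= j).
  apply/negP => kj; have := H k.+1; rewrite dpt_dR //= ?eqxx; lia.
apply: (ip j) => //; first lia.
move=> i hi; have := H i.+1; rewrite dpt_dR; last lia.
have -> : (i.+1 == 0) = false by lia.
have -> : (i.+1 == k.+1) = false by lia.
have -> : (i < k) = true by lia.
rewrite /=; ifs; lia.
Qed.

Lemma valid_size_gt1 D : valid_diag D -> 0 < size D -> 1 < size D.
Proof. by move=> v h; have [] := v _ h; lia. Qed.

(** [size Dd] and [size Dd'] are both the least closed block of the same diagram; with equal sizes
    the entries can be compared point by point. *)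
Lemma dIns1_inj Dd Du Dd' Du' :
  valid_diag Dd -> valid_diag Du -> valid_diag Dd' -> valid_diag Du' ->
  indecomposable Dd -> indecomposable Du -> indecomposable Dd' -> indecomposable Du' ->
  dIns Dd 1 Du = dIns Dd' 1 Du' -> Dd = Dd' /\ Du = Du'.
Proof.
move=> vd vu vd' vu' id iu id' iu' e.
have u1 := valid_size_gt1 vu (proj1 iu).
have u1' := valid_size_gt1 vu' (proj1 iu').
have sd : size Dd = size Dd'.
  apply/eqP; rewrite eqn_leq; apply/andP; split.
    apply: (@closed_block_dIns_ge Dd Du); rewrite // ?e; try lia.
    by apply: closed_block_dIns => //; case: id'.
  apply: (@closed_block_dIns_ge Dd' Du'); rewrite // -?e; try lia.
  by apply: closed_block_dIns => //; case: id.
have su : size Du = size Du'.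
  by have := congr1 size e; rewrite !size_dIns; lia.
split; apply: diag_ext => // i hi.
  have := congr1 (fun p => dpt p i.+1) e; rewrite !dpt_dIns -?sd -?su; try lia.
  have -> : (i.+1 < 1) = false by lia.
  have -> : (i.+1 < 1 + size Dd) = true by lia.
  by rewrite subn1 /=; lia.
have [->|i0] := eqVneq i 0.
  have := congr1 (fun p => dpt p 0) e; rewrite !dpt_dIns -?sd -?su /=; try lia.
  ifs; lia.
have := congr1 (fun p => dpt p (i + size Dd)) e; rewrite !dpt_dIns -?sd -?su; try lia.
have -> : (i + size Dd < 1) = false by lia.
have -> : (i + size Dd < 1 + size Dd) = false by lia.
rewrite addnK /=; ifs; lia.
Qed.

(* The block placed in interval 1 is the shortest closed block that follows the
   first point, so it can be read off the diagram. *)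
Lemma indec_split D j : valid_diag D -> indecomposable D -> closed_block D j ->
  (forall j', closed_block D j' -> j <= j') ->
  exists Dd Du, [/\ valid_diag Dd, indecomposable Dd, valid_diag Du, indecomposable Du &
    [/\ D = dIns Dd 1 Du, size Dd < size D & size Du < size D]].
Proof.
move=> vD [D0 iD] cb jmin; have /closed_blockP[j0 jD H] := cb.
pose Dd := mkseq (fun i => dpt D i.+1 - 1) j.
(* [gg] embeds the points of [Du] into [D] by skipping the block [1..j], and [hh] is its inverse
   outside the block. *)
pose hh t := if t == 0 then 0 else t - j.
pose gg t := if t == 0 then 0 else t + j.
pose Du := mkseq (fun i => hh (dpt D (gg i))) (size D - j).
have sd : size Dd = j by rewrite size_mkseq.
have su : size Du = size D - j by rewrite size_mkseq.
have ed i : i < j -> dpt Dd i = dpt D i.+1 - 1 by move=> hi; rewrite /dpt nth_mkseq.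
have eu i : i < size D - j -> dpt Du i = hh (dpt D (gg i)) by move=> hi; rewrite /dpt nth_mkseq.
(* The partner map is an involution, so the complement of a closed block is closed as well. *)
have out i : i < size D -> (i == 0) || (j < i) -> (dpt D i == 0) || (j < dpt D i).
  move=> hi hij; have [h1 h2 h3] := vD _ hi.
  apply: contraT => hn; have := H (dpt D i); rewrite h3; lia.
exists Dd, Du; split.
- move=> i; rewrite sd => hi; rewrite !ed //; last by have := H i.+1; lia.
  have := H i.+1; have hiD : i.+1 < size D by lia.
  have [h1 h2 h3] := vD _ hiD => /(_ _)h4.
  have -> : (dpt D i.+1 - 1).+1 = dpt D i.+1 by lia.
  by rewrite h3; split; lia.
- split=> [|j' j'0]; rewrite sd // => j'j Hj'.
  (* A closed proper prefix of [Dd] is a closed block of [D] shorter than the minimal one. *)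
  suff /jmin : closed_block D j' by lia.
  apply/closed_blockP; split=> // [|i hi]; first lia.
  have := Hj' i.-1; rewrite ed; last lia.
  have -> : i.-1.+1 = i by lia.
  by have := H i; lia.
- move=> i; rewrite su => hi.
  have hg : gg i < size D by rewrite /gg; case: ifP; lia.
  have [h1 h2 h3] := vD _ hg.
  have ho : (dpt D (gg i) == 0) || (j < dpt D (gg i)).
    by apply: out => //; rewrite /gg; case: ifP; lia.
  rewrite eu //; have -> : dpt Du (hh (dpt D (gg i))) = i.
    rewrite eu; last by rewrite /hh; case: ifP; lia.
    have -> : gg (hh (dpt D (gg i))) = dpt D (gg i) by rewrite {1}/gg /hh; ifs; lia.
    by rewrite h3 /gg /hh; ifs; lia.
  move: (dpt D (gg i)) h1 h2 ho => t; rewrite /gg /hh => h1 h2 ho.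
  by split=> //; ifs; lia.
- split=> [|j' j'0]; rewrite su; first lia.
  move=> hj' Hj'.
  (* A closed prefix of [Du], with the block put back, is a closed prefix of [D]. *)
  apply: (iD (j' + j)); [lia|lia|] => i hi.
  have [hij|hij] := boolP (0 < i <= j); first by have := H i; lia.
  have := Hj' (hh i); rewrite eu; last by rewrite /hh; case: ifP; lia.
  have -> : gg (hh i) = i by rewrite /gg /hh; ifs; lia.
  have hiD : i < size D by lia.
  by have := out i hiD; rewrite /hh; ifs; lia.
- split; [|lia|lia].
  apply: diag_ext; first by rewrite size_dIns; lia.
  move=> i hi; rewrite dpt_dIns; last lia.
  have [i0|i0] := eqVneq i 0.
    subst i; rewrite /= eu; last lia.
    have := out 0 D0; rewrite /gg /= /hh sd; have [? ? ?] := vD _ D0; ifs; lia.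
  have -> : (i < 1) = false by lia.
  rewrite sd; case: ifP => hij.
    rewrite ed; last lia.
    have -> : (i - 1).+1 = i by lia.
    by have := H i; lia.
  rewrite eu /=; last lia.
  have -> : gg (i - j) = i by rewrite /gg; case: ifP; lia.
  have hiD : i < size D by lia.
  by have := out i hiD; rewrite /hh; ifs; lia.
Qed.

(** Deleting the root chord cannot make the diagram decomposable: a closed prefix of the rest that
    ends before the right root point [k.+1] is a closed block of [D], and a longer one together with
    the root chord is a closed prefix of [D]. *)
Lemma indec_unroot D : valid_diag D -> indecomposable D -> 2 < size D ->
  (forall j, ~~ closed_block D j) ->
  exists k D', [/\ valid_diag D', indecomposable D', 0 < k < size D', D = dR k D' &
    size D' < size D].
Proof.
move=> vD [D0 iD] D2 ncb.
have [r1 r2 r3] := vD _ D0.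
have : dpt D 0 = (dpt D 0).-1.+1 by lia.
move: (dpt D 0).-1 => k kE.
pose g i := if i < k then i.+1 else i.+2.
pose h i := if i <= k then i.-1 else i - 2.
pose D' := mkseq (fun i => h (dpt D (g i))) (size D - 2).
have sD' : size D' = size D - 2 by rewrite size_mkseq.
have eD' i : i < size D - 2 -> dpt D' i = h (dpt D (g i)) by move=> hi; rewrite /dpt nth_mkseq.
have gK i : h (g i) = i by rewrite /h /g; ifs; lia.
have hK i : i != 0 -> i != k.+1 -> g (h i) = i by rewrite /h /g => ? ?; ifs; lia.
have nr i : i < size D -> i != 0 -> i != k.+1 -> (dpt D i != 0) && (dpt D i != k.+1).
  move=> hi i0 ik; have [h1 h2 h3] := vD _ hi.
  apply/andP; split; apply/eqP => e.
    by rewrite e in h3; lia.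
  by rewrite e -kE r3 in h3; lia.
have gb i : i < size D - 2 -> g i < size D by rewrite /g; case: ifP; lia.
have gn i : (g i != 0) && (g i != k.+1) by rewrite /g; case: ifP; lia.
(* For [k = 0] the root chord alone would be a closed prefix of length 2. *)
have k0 : 0 < k.
  rewrite lt0n; apply/eqP => k0; apply: (iD 2) => // i hi.
  have [->|i1] := eqVneq i 0; first lia.
  have -> : i = dpt D 0 by lia.
  by rewrite r3.
(* Otherwise the root chord ends at the last point and everything inside it is a closed block. *)
have kD : k < size D - 2.
  rewrite ltnNge; apply/negP => hk; have /negP := ncb k; apply.
  apply/closed_blockP; split=> // [|i hi]; first lia.
  have hiD : i < size D by lia.
  by have := nr i hiD; have [? ? ?] := vD _ hiD; lia.
exists k, D'; split.
- move=> i; rewrite sD' => hi.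
  have hg := gb _ hi; have /andP[gn1 gn2] := gn i.
  have [h1 h2 h3] := vD _ hg; have /andP[n1 n2] := nr _ hg gn1 gn2.
  have hb : h (dpt D (g i)) < size D - 2 by rewrite /h; case: ifP; lia.
  rewrite !eD' // hK // h3 gK; split=> //.
  by apply: contra h2 => /eqP e; rewrite -{2}e hK.
- split=> [|j j0]; rewrite sD'; first lia.
  move=> hj Hj; have [jk|jk] := leqP j k.
    have /negP := ncb j; apply; apply/closed_blockP; split=> // [|i hi]; first lia.
    have hiD : i < size D by lia.
    have := nr i hiD; have := Hj (h i); rewrite eD'; last by rewrite /h; case: ifP; lia.
    rewrite hK; try lia.
    by rewrite {1}/h {1}/h; ifs; lia.
  apply: (iD (j + 2)); [lia|lia|] => i hi.
  have [->|i0] := eqVneq i 0; first lia.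
  have [->|ik] := eqVneq i k.+1; first by rewrite -kE r3; lia.
  have hiD : i < size D by lia.
  have := nr i hiD; have := Hj (h i); rewrite eD'; last by rewrite /h; case: ifP; lia.
  rewrite hK; try lia.
  by rewrite {1}/h {1}/h; ifs; lia.
- by lia.
- apply: diag_ext; first by rewrite size_dR; lia.
  move=> i hi; rewrite dpt_dR; last lia.
  case: eqP => [->//|i0]; case: eqP => [->|ik]; first by rewrite -kE r3.
  rewrite -/(h i) eD'; last by rewrite /h; case: ifP; lia.
  rewrite hK; try lia.
  have := nr i hi; rewrite /h /=; ifs; lia.
- by lia.
Qed.

(** * Commutation of insertions into diagrams *)

Ltac decide_ifs := repeat match goal with
  | |- context [if ?b then _ else _] =>
     first [ have -> : b = true by lia | have -> : b = false by lia ]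
  end.

(** The right root point splits interval [k] of [p] into the intervals [k.+1] and [k.+2] of
    [dR k p]. Up to [k.+1] an interval [l > 1] is interval [l.-1] of [p], and the inserted points
    push the right root point by [size D2]; from [k.+2] on it is interval [l - 2] and the right root
    point stays ([dIns_dR_right]). *)
Lemma dIns_dR_left D2 k l p : valid_diag D2 -> 1 < l <= k.+1 -> k < size p ->
  dIns D2 l (dR k p) = dR (k + size D2) (dIns D2 l.-1 p).
Proof.
move=> v2 hl hk; apply: diag_ext; rewrite ?size_dIns !size_dR ?size_dIns ?addSn // => i hi.
rewrite [RHS]dpt_dR ?size_dIns // [LHS]dpt_dIns ?size_dR ?addSn //.
have [i0|i0] := eqVneq i 0.
  by subst i; rewrite dpt_dR //=; decide_ifs.
have [ik|ik] := eqVneq i (k + size D2).+1.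
  by subst i; decide_ifs; rewrite dpt_dR /=; [decide_ifs|lia].
have [il|il] := ltnP i l.
  decide_ifs; rewrite dpt_dR; last lia.
  rewrite dpt_dIns; last lia.
  decide_ifs => /=; ifs; lia.
have [ib|ib] := ltnP i (l + size D2).
  decide_ifs; rewrite dpt_dIns; last lia.
  decide_ifs => /=.
  have -> : i.-1 - l.-1 = i - l by lia.
  have hb : i - l < size D2 by lia.
  have [h1 _ _] := v2 _ hb.
  by ifs; lia.
decide_ifs; rewrite dpt_dR; last lia.
have [ik'|ik'] := leqP i (k + size D2).
  rewrite dpt_dIns; last lia.
  decide_ifs => /=.
  have -> : i.-1 - size D2 = (i - size D2).-1 by lia.
  by ifs; lia.
rewrite dpt_dIns; last lia.
decide_ifs => /=.
have -> : i - 2 - size D2 = i - size D2 - 2 by lia.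
by ifs; lia.
Qed.

Lemma dIns_dR_right D2 k l p : valid_diag D2 -> k.+1 < l <= (size p).+1 -> k < size p ->
  dIns D2 l (dR k p) = dR k (dIns D2 (l - 2) p).
Proof.
move=> v2 hl hk; apply: diag_ext; rewrite ?size_dIns !size_dR ?size_dIns ?addSn // => i hi.
rewrite [RHS]dpt_dR ?size_dIns // [LHS]dpt_dIns ?size_dR ?addSn //.
have [i0|i0] := eqVneq i 0.
  by subst i; rewrite dpt_dR //=; decide_ifs.
have [ik|ik] := eqVneq i k.+1.
  by subst i; decide_ifs; rewrite dpt_dR /=; [decide_ifs|lia].
have [il|il] := ltnP i l.
  decide_ifs; rewrite dpt_dR; last lia.
  rewrite dpt_dIns; last by case: ifP; lia.
  decide_ifs => /=.
  have [ik2|ik2] := leqP i k; decide_ifs => /=; ifs; lia.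
have [ib|ib] := ltnP i (l + size D2).
  decide_ifs; rewrite dpt_dIns; last lia.
  decide_ifs => /=.
  have -> : i - 2 - (l - 2) = i - l by lia.
  have hb : i - l < size D2 by lia.
  have [h1 _ _] := v2 _ hb.
  by ifs; lia.
decide_ifs; rewrite dpt_dR; last lia.
rewrite dpt_dIns; last lia.
decide_ifs => /=.
have -> : i - 2 - size D2 = i - size D2 - 2 by lia.
by ifs; lia.
Qed.

Lemma dIns_assoc D3 D2 l p : valid_diag D2 -> 0 < l <= size D2 -> 0 < size p ->
  dIns D3 l.+1 (dIns D2 1 p) = dIns (dIns D3 l D2) 1 p.
Proof.
move=> v2 hl hp; apply: diag_ext; rewrite ?size_dIns; first lia.
move=> i hi.
rewrite [RHS]dpt_dIns ?size_dIns; last lia.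
rewrite [LHS]dpt_dIns ?size_dIns //.
have [i0|i0] := eqVneq i 0.
  by subst i; rewrite dpt_dIns /=; [ifs; lia|lia].
have [il|il] := ltnP i l.+1.
  decide_ifs; rewrite dpt_dIns; last lia.
  decide_ifs; rewrite dpt_dIns; last lia.
  by decide_ifs => /=; ifs; lia.
have [ib|ib] := ltnP i (l.+1 + size D3).
  decide_ifs; rewrite dpt_dIns; last lia.
  decide_ifs.
  have -> : i - 1 - l = i - l.+1 by lia.
  lia.
decide_ifs; rewrite dpt_dIns; last lia.
have [iu|iu] := ltnP i (1 + (size D2 + size D3)).
  rewrite dpt_dIns; last lia.
  decide_ifs => /=.
  have -> : i - 1 - size D3 = i - size D3 - 1 by lia.
  have hb : i - size D3 - 1 < size D2 by lia.
  by have [h1 _ _] := v2 _ hb; ifs; lia.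
decide_ifs => /=.
have -> : i - (size D2 + size D3) = i - size D3 - size D2 by lia.
by ifs; lia.
Qed.

(** For [l = 1] both diagrams land in the same gap, with [D2] to the right of [Dd]. *)
Lemma dIns_comm D2 Dd l p : valid_diag Dd -> 0 < l <= size p ->
  dIns D2 (l + size Dd) (dIns Dd 1 p) = dIns Dd 1 (dIns D2 l p).
Proof.
move=> vd hl; apply: diag_ext; rewrite ?size_dIns; first lia.
move=> i hi.
rewrite [RHS]dpt_dIns ?size_dIns; last lia.
rewrite [LHS]dpt_dIns ?size_dIns //.
have [i0|i0] := eqVneq i 0.
  subst i; rewrite dpt_dIns /=; last lia.
  rewrite dpt_dIns; last lia.
  by decide_ifs => /=; ifs; lia.
have [id|id] := ltnP i (1 + size Dd).
  decide_ifs; rewrite dpt_dIns; last lia.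
  have hb : i - 1 < size Dd by lia.
  have [h1 _ _] := vd _ hb.
  by decide_ifs => /=; ifs; lia.
have [il|il] := ltnP i (l + size Dd).
  decide_ifs; rewrite dpt_dIns; last lia.
  rewrite dpt_dIns; last lia.
  by decide_ifs => /=; ifs; lia.
have [ib|ib] := ltnP i (l + size Dd + size D2).
  decide_ifs; rewrite dpt_dIns; last lia.
  decide_ifs.
  have -> : i - size Dd - l = i - (l + size Dd) by lia.
  by move=> /=; ifs; lia.
decide_ifs; rewrite dpt_dIns; last lia.
rewrite dpt_dIns; last lia.
decide_ifs => /=.
have -> : i - size Dd - size D2 = i - size D2 - size Dd by lia.
by ifs; lia.
Qed.

(** * Connectivity of diagrams *)

Lemma creach_trans p i j l : creach p i j -> creach p j l -> creach p i l.
Proof.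
move=> hij; elim=> // [m _ h|m n _ h hn hc]; first exact: cr_mate.
exact: cr_cross h hn hc.
Qed.

Lemma dcrossC p i j : dcross p i j = dcross p j i.
Proof. by rewrite /dcross orbC. Qed.

Lemma creach_bound p i j : valid_diag p -> i < size p -> creach p i j -> j < size p.
Proof. by move=> v hi; elim=> // m _ /v[]. Qed.

Lemma creach_sym p i j : valid_diag p -> i < size p -> creach p i j -> creach p j i.
Proof.
move=> v hi h; elim: h; first exact: cr_refl.
  move=> m hm IH; have hmb := creach_bound v hi hm; have [_ _ e] := v _ hmb.
  by apply: creach_trans IH; rewrite -{2}e; apply/cr_mate/cr_refl.
move=> m n hm IH hn hc; apply: creach_trans IH.
apply: cr_cross (cr_refl _ _) (creach_bound v hi hm) _.
by rewrite dcrossC.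
Qed.

Lemma connected_diagP p i0 : valid_diag p -> i0 < size p ->
  (forall j, j < size p -> creach p i0 j) -> connected_diag p.
Proof.
move=> v h0 h; split=> [|i j hi hj]; first lia.
by apply: creach_trans (h _ hj); apply: creach_sym => //; apply: h.
Qed.

(** Crossing depends only on the order of the four endpoints, so any monotone embedding that
    respects partners preserves it. *)
Lemma creach_embed (p q : diag) (g : nat -> nat) i j :
  valid_diag p -> i < size p ->
  (forall x, x < size p -> g x < size q) ->
  (forall x y, x < size p -> y < size p -> (g x < g y) = (x < y)) ->
  (forall x, x < size p -> dpt q (g x) = g (dpt p x)) ->
  creach p i j -> creach q (g i) (g j).
Proof.
move=> v hi gb gm gp h; elim: h; first exact: cr_refl.
  move=> m hm IH; rewrite -gp; first exact: cr_mate.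
  exact: creach_bound hm.
move=> m n hm IH hn; have hmb := creach_bound v hi hm => hc.
apply: cr_cross IH (gb _ hn) _.
have gmin x y : x < size p -> y < size p -> minn (g x) (g y) = g (minn x y).
  by move=> hx hy; rewrite /minn gm //; case: ifP.
have gmax x y : x < size p -> y < size p -> maxn (g x) (g y) = g (maxn x y).
  by move=> hx hy; rewrite /maxn gm //; case: ifP.
have [h1 _ _] := v _ hmb; have [h2 _ _] := v _ hn.
rewrite /dcross !gp // !gmin // !gmax // !gm //; rewrite ?gtn_max ?gtn_min; lia.
Qed.

(** Otherwise the points before [k] would be closed under partners; no chord on the other side could
    then cross one of theirs, and [k] would be unreachable from 0. The chord found here will cross a
    root chord that ends in interval [k]. *)
Lemma connected_crossing p k : valid_diag p -> connected_diag p -> 0 < k < size p ->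
  exists x, [/\ x < size p, x < k & k <= dpt p x].
Proof.
move=> v [p0 cp] hk.
have [/hasP[x]|/hasPn h] := boolP (has (fun x => k <= dpt p x) (iota 0 k)).
  by rewrite mem_iota => h1 h2; exists x; split=> //; lia.
have {}h x : x < k -> dpt p x < k.
  by move=> hx; have := h x; rewrite mem_iota; lia.
suff H j : creach p 0 j -> j < k by have := H _ (cp 0 k _ _); lia.
elim=> [|m _|m n _ hm hn]; [lia|exact: h|].
rewrite ltnNge => hc; apply/negP => hkn.
have hm' := h _ hm; have [_ _ e] := v _ hn.
have hn' : k <= dpt p n by rewrite leqNgt; apply/negP => /h; rewrite e; lia.
by move: hc; rewrite /dcross; lia.
Qed.

Lemma connected_dR k p : valid_diag p -> connected_diag p -> 0 < k < size p ->
  connected_diag (dR k p).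
Proof.
move=> v c hk.
have vR : valid_diag (dR k p) by apply: valid_dR => //; lia.
pose g x := if x < k then x.+1 else x.+2.
have gb x : x < size p -> g x < size (dR k p) by rewrite size_dR /g; case: ifP; lia.
have gm x y : (g x < g y) = (x < y) by rewrite /g; ifs; lia.
have gp x : x < size p -> dpt (dR k p) (g x) = g (dpt p x).
  move=> hx; rewrite dpt_dR; last by rewrite -(size_dR k) gb.
  have -> : (if g x <= k then (g x).-1 else g x - 2) = x by rewrite /g; ifs; lia.
  have -> : (g x == 0) = false by rewrite /g; ifs; lia.
  by have -> : (g x == k.+1) = false by rewrite /g; ifs; lia.
have [x [x1 x2 x3]] := connected_crossing v c hk.
have [y1 _ _] := v _ x1.
have r0 : creach (dR k p) 0 (g x).
  apply: cr_cross (cr_refl _ _) (gb _ x1) _.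
  rewrite /dcross gp // dpt_dR //= /g; ifs; lia.
apply: (@connected_diagP _ 0); rewrite ?size_dR // => j hj.
have [->|j0] := eqVneq j 0; first exact: cr_refl.
have [->|jk] := eqVneq j k.+1.
  have -> : k.+1 = dpt (dR k p) 0 by rewrite dpt_dR.
  exact/cr_mate/cr_refl.
have -> : j = g (if j <= k then j.-1 else j - 2) by rewrite /g; ifs; lia.
apply: creach_trans r0 _; apply: (@creach_embed p) => //.
by case: c => _; apply=> //; case: ifP; lia.
Qed.

(** The result is the union of an order-preserving copy of [dR l Ch], whose root chord is stretched
    to end inside [C2], and a copy of [C2]. Both are connected, and a chord of [C2] over interval
    [i] crosses the stretched root chord. *)
Lemma connected_dstar_step i l C2 Ch :
  valid_diag Ch -> 0 < l < size Ch -> connected_diag (dR l Ch) ->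
  valid_diag C2 -> connected_diag C2 -> 0 < i < size C2 ->
  connected_diag (dR (i + l) (dIns C2 l Ch)).
Proof.
move=> vh hl c1 v2 c2 hi.
set D := dR _ _.
have vI : valid_diag (dIns C2 l Ch) by apply: valid_dIns => //; lia.
have vD : valid_diag D by apply: valid_dR => //; rewrite size_dIns; lia.
have v1 : valid_diag (dR l Ch) by apply: valid_dR => //; lia.
have sD : size D = (size Ch + size C2).+2 by rewrite size_dR size_dIns.
have hI : size (dIns C2 l Ch) = size Ch + size C2 by rewrite size_dIns.
(* [g] places [dR l Ch]: its right root point [l.+1] moves to [i + l.+1], later points jump over
   [C2]. [e] places [C2], leaving that position free. *)
pose g x := if x < l.+1 then x else if x == l.+1 then x + i else x + size C2.
pose e x := if x < i then x + l.+1 else x + l.+2.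
have gb x : x < size (dR l Ch) -> g x < size D.
  by rewrite sD size_dR /g => ?; ifs; lia.
have eb x : x < size C2 -> e x < size D by rewrite sD /e => ?; ifs; lia.
have gm x y : (g x < g y) = (x < y) by rewrite /g; ifs; lia.
have em x y : (e x < e y) = (x < y) by rewrite /e; ifs; lia.
have ep x : x < size C2 -> dpt D (e x) = e (dpt C2 x).
  move=> hx; rewrite dpt_dR; last by rewrite hI -sD eb.
  have -> : (if e x <= i + l then (e x).-1 else e x - 2) = x + l by rewrite /e; ifs; lia.
  rewrite dpt_dIns; last lia.
  have -> : (x + l < l) = false by lia.
  have -> : (x + l < l + size C2) = true by lia.
  by rewrite addnK /e /=; ifs; lia.
have gp x : x < size (dR l Ch) -> dpt D (g x) = g (dpt (dR l Ch) x).
  rewrite size_dR => hx; rewrite [in RHS]dpt_dR //.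
  rewrite dpt_dR; last by rewrite hI -sD gb // size_dR.
  have [x0|x0] := eqVneq x 0; first by subst x; rewrite /g /=; ifs; lia.
  have [xl|xl] := eqVneq x l.+1; first by subst x; rewrite /g /=; ifs; lia.
  have -> : (g x == 0) = false by rewrite /g; ifs; lia.
  have -> : (g x == (i + l).+1) = false by rewrite /g; ifs; lia.
  have [xs|xs] := leqP x l.
    have -> : g x = x by rewrite /g; ifs; lia.
    decide_ifs; rewrite dpt_dIns; last lia.
    by decide_ifs; rewrite /g /=; ifs; lia.
  have -> : g x = x + size C2 by rewrite /g; ifs; lia.
  decide_ifs; rewrite dpt_dIns; last lia.
  decide_ifs.
  have -> : x + size C2 - 2 - size C2 = x - 2 by lia.
  by rewrite /g /=; ifs; lia.
have [x [x1 x2 x3]] := connected_crossing v2 c2 hi.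
have [y1 _ _] := v2 _ x1.
have D0 : dpt D 0 = (i + l).+1 by rewrite dpt_dR.
have r0 : creach D 0 (e x).
  apply: cr_cross (cr_refl _ _) (eb _ x1) _.
  by rewrite /dcross ep // D0 /e; ifs; lia.
apply: (@connected_diagP _ 0); rewrite ?sD // => j hj.
have [hjb|hjb] := boolP ((l.+1 <= j < l.+2 + size C2) && (j != (i + l).+1)).
  have -> : j = e (if j <= i + l then j - l.+1 else j - l.+2) by rewrite /e; ifs; lia.
  apply: creach_trans r0 _; apply: (@creach_embed C2) => //.
  by case: c2 => _; apply=> //; case: ifP; lia.
have g0 : 0 = g 0 by [].
have -> : j = g (if j <= l then j else if j == (i + l).+1 then l.+1 else j - size C2).
  by rewrite /g; ifs; lia.
rewrite {1}g0; apply: (@creach_embed (dR l Ch)) => //.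
by case: c1 => _; apply; rewrite size_dR //; ifs; lia.
Qed.

(** * Reachability, bridges and isomorphisms of maps *)

(** [conn_wo] on functions instead of sequences: involutions can then be cut, or extended to a
    larger map, without handling lists. *)
Inductive freach (s a : nat -> nat) (e x : nat) : nat -> Prop :=
| fr_refl : freach s a e x x
| fr_sig y : freach s a e x y -> freach s a e x (s y)
| fr_alp y : freach s a e x y -> y <> e -> y <> a e -> freach s a e x (a y).

Definition fbridge (s a : nat -> nat) (h : nat) : Prop :=
  a h <> h /\ ~ freach s a h h (a h).

Definition fbridgeb (s a : nat -> nat) (h : nat) : bool :=
  if excluded_middle_informative (fbridge s a h) then true else false.

Lemma fbridgeP s a h : reflect (fbridge s a h) (fbridgeb s a h).
Proof. by rewrite /fbridgeb; case: excluded_middle_informative => ?; constructor. Qed.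

Lemma fbridgeb_eq s a h s' a' h' :
  (fbridge s a h <-> fbridge s' a' h') -> fbridgeb s a h = fbridgeb s' a' h'.
Proof. by move=> e; apply/fbridgeP/fbridgeP => /e. Qed.

Lemma conn_woE s a e x y : conn_wo s a e x y <-> freach (nth 0 s) (nth 0 a) e x y.
Proof.
split; elim=> *; [exact: fr_refl|exact: fr_sig|exact: fr_alp|
  exact: cw_refl|exact: cw_sig|exact: cw_alp].
Qed.

Lemma is_bridgeE s a h : is_bridge s a h <-> fbridge (nth 0 s) (nth 0 a) h.
Proof. by rewrite /is_bridge /fbridge conn_woE. Qed.

Lemma bridgebE s a h : bridgeb s a h = fbridgeb (nth 0 s) (nth 0 a) h.
Proof.
rewrite /bridgeb; case: excluded_middle_informative => b; symmetry.
  by apply/fbridgeP/is_bridgeE.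
by apply/fbridgeP => /is_bridgeE.
Qed.

(** * The labeling as an iteration on functions *)

Definition cut (a : nat -> nat) (h : nat) : nat -> nat :=
  fun x => if (x == h) || (x == a h) then x else a x.

(* A step of the labeling moves from c to a' (s c), where a' is the involution
   once the edge of s c is cut (unless it is a bridge): cutting a dangling
   half-edge changes nothing. *)
Definition lstep (s : nat -> nat) (st : nat * (nat -> nat)) : nat * (nat -> nat) :=
  let h := s st.1 in
  let a' := if fbridgeb s st.2 h then st.2 else cut st.2 h in
  (a' h, a').

Definition lstate (N : rmap) (k : nat) := iter k (lstep (sig N)) (mroot N, alp N).

Lemma lstep_bfl s c a :
  lstep (nth 0 s) (c, nth 0 a) = ((bfl_step s (c, a)).1, nth 0 (bfl_step s (c, a)).2).
Proof.
rewrite /lstep /bfl_step /= bridgebE; case: ifP => // _.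
case: eqP => [e|ne] /=; rewrite {1}/cut eqxx /=; congr pair; apply: functional_extensionality => x.
  by rewrite /cut e orbb; case: eqP => [->|].
by rewrite /cut !nth_set_nth /= !nth_set_nth /=; case: eqP => [->|]; case: eqP.
Qed.

Lemma cornerE N k : corner N k = (lstate N k.-1).1.
Proof.
rewrite /corner /lstate; move: k.-1 => {}k.
suff [-> _] : (iter k (lstep (sig N)) (mroot N, alp N)).1 = (iter k (bfl_step (msig N)) (mroot N, malp N)).1
  /\ (iter k (lstep (sig N)) (mroot N, alp N)).2 = nth 0 (iter k (bfl_step (msig N)) (mroot N, malp N)).2 by [].
elim: k => [|k [IH1 IH2]] //.
rewrite !iterS [X in lstep _ X]surjective_pairing IH1 IH2.
rewrite [in X in _ = X /\ _](surjective_pairing (iter k (bfl_step _) _)).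
rewrite [in X in _ /\ _ = X](surjective_pairing (iter k (bfl_step _) _)).
by rewrite (lstep_bfl (msig N)).
Qed.

Lemma corner1 N : corner N 1 = mroot N.
Proof. by rewrite cornerE. Qed.

Lemma lstateS N k : lstate N k.+1 = lstep (sig N) (lstate N k).
Proof. by rewrite /lstate iterS. Qed.

Lemma freach_trans s a e x y z : freach s a e x y -> freach s a e y z -> freach s a e x z.
Proof. by move=> hxy; elim=> // *; [exact: fr_sig|exact: fr_alp]. Qed.

Lemma freach_map (P : nat -> Prop) g s a e s' a' e' x y :
  (forall y, P y -> P (s y) /\ freach s' a' e' (g y) (g (s y))) ->
  (forall y, P y -> y <> e -> y <> a e -> P (a y) /\ freach s' a' e' (g y) (g (a y))) ->
  P x -> freach s a e x y -> P y /\ freach s' a' e' (g x) (g y).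
Proof.
move=> Hs Ha px; elim=> [|z _ [pz IH]|z _ [pz IH] h1 h2].
- by split=> //; apply: fr_refl.
- by have [? ?] := Hs _ pz; split=> //; apply: freach_trans IH _.
- by have [? ?] := Ha _ pz h1 h2; split=> //; apply: freach_trans IH _.
Qed.

Lemma freach_inv (P : nat -> Prop) s a e x y :
  (forall y, P y -> P (s y)) ->
  (forall y, P y -> y <> e -> y <> a e -> P (a y)) ->
  P x -> freach s a e x y -> P y.
Proof. by move=> Hs Ha px; elim=> // z _; [apply: Hs|apply: Ha]. Qed.

Lemma fr_sig' s a e x y : y = s x -> freach s a e x y.
Proof. by move=> ->; apply/fr_sig/fr_refl. Qed.

Lemma fr_alp' s a e x y : y = a x -> x <> e -> x <> a e -> freach s a e x y.
Proof. by move=> -> ? ?; apply: fr_alp => //; apply: fr_refl. Qed.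

Lemma fr_eq s a e x y : x = y -> freach s a e x y.
Proof. by move=> ->; apply: fr_refl. Qed.

Lemma bounded_inj_inv m (f : nat -> nat) :
  (forall h, h < m -> f h < m) ->
  (forall h1 h2, h1 < m -> h2 < m -> f h1 = f h2 -> h1 = h2) ->
  exists g, forall h, h < m -> [/\ g h < m, f (g h) = h & g (f h) = h].
Proof.
move=> fb fi; pose l := map f (iota 0 m).
have ul : uniq l.
  by rewrite map_inj_in_uniq ?iota_uniq // => x y; rewrite !mem_iota => hx hy; apply: fi; lia.
have sl : {subset l <= iota 0 m}.
  by move=> x /mapP[y]; rewrite !mem_iota => hy ->; have := fb y; lia.
have [_ el] := uniq_min_size ul sl (eq_leq (esym (size_map f (iota 0 m)))).
exists (fun h => index h l) => h hm.
have hl : h \in l by rewrite el mem_iota; lia.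
have il : index h l < m by rewrite -[m in _ < m](size_iota 0) -(size_map f) index_mem.
have fh : f (index h l) = h.
  rewrite -[RHS](nth_index 0 hl) (nth_map 0) ?size_iota //.
  by rewrite nth_iota.
split=> //.
have fl : f h \in l by apply: map_f; rewrite mem_iota; lia.
have il' : index (f h) l < m by rewrite -[m in _ < m](size_iota 0) -(size_map f) index_mem.
apply: fi => //; rewrite -[RHS](nth_index 0 fl) (nth_map 0) ?size_iota //.
by rewrite nth_iota.
Qed.

(** Every point of a finite set lies on a cycle of the injection. This makes reachability symmetric
    although [sig] is only followed forwards. *)
Lemma bounded_inj_iter_back m (f : nat -> nat) h :
  (forall h, h < m -> f h < m) ->
  (forall h1 h2, h1 < m -> h2 < m -> f h1 = f h2 -> h1 = h2) ->
  h < m -> exists n, iter n f (f h) = h.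
Proof.
move=> fb fi hm.
pose F (i : 'I_m) := Ordinal (fb i (ltn_ord i)).
have Fi : injective F.
  by move=> i j /(congr1 val) /= e; apply: val_inj; apply: fi e; apply: ltn_ord.
have itF n (i : 'I_m) : val (iter n F i) = iter n f i by elim: n => //= n ->.
exists (order F (Ordinal hm)).-1; rewrite -iterSr prednK ?order_gt0 //.
by rewrite -(itF _ (Ordinal hm)) iter_order.
Qed.

Section ValidMap.
Variable M : rmap.
Hypothesis vM : valid_map M.

Lemma mroot_lt : mroot M < mh M.
Proof. by case: vM => -[]. Qed.
Lemma sig_lt h : h < mh M -> sig M h < mh M.
Proof. by move=> hh; case: vM => -[_ _ _ /(_ h hh)[]]. Qed.
Lemma alp_lt h : h < mh M -> alp M h < mh M.
Proof. by move=> hh; case: vM => -[_ _ _ /(_ h hh)[]]. Qed.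
Lemma sig_inj h1 h2 : h1 < mh M -> h2 < mh M -> sig M h1 = sig M h2 -> h1 = h2.
Proof. by case: vM => _ [h _ _]; apply: h. Qed.
Lemma alpK h : h < mh M -> alp M (alp M h) = h.
Proof. by move=> hh; case: vM => _ [_ /(_ h hh)[]]. Qed.
Lemma alp_root : alp M (mroot M) = mroot M.
Proof. by case: vM => _ [_ /(_ _ mroot_lt)[_ H] _]; apply/H. Qed.
Lemma alp_fix h : h < mh M -> alp M h = h -> h = mroot M.
Proof. by move=> hh; case: vM => _ [_ /(_ h hh)[_ H] _] /H. Qed.
Lemma valid_mreach h : h < mh M -> mreach M h.
Proof. by case: vM => _ [_ _]; apply. Qed.

Lemma sig_pred h : h < mh M -> exists2 p, p < mh M & sig M p = h.
Proof.
move=> hh; have [g Hg] := bounded_inj_inv sig_lt sig_inj.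
by have [? ? _] := Hg _ hh; exists (g h).
Qed.

Lemma freach_lt e x y : x < mh M -> freach (sig M) (alp M) e x y -> y < mh M.
Proof. by apply: (freach_inv (P := fun z => z < mh M)) => [z|z + _ _]; [apply: sig_lt|apply: alp_lt]. Qed.

Lemma freach_sym e x y : e < mh M -> x < mh M ->
  freach (sig M) (alp M) e x y -> freach (sig M) (alp M) e y x.
Proof.
move=> he hx; elim=> [|z hz IH|z hz IH h1 h2]; first exact: fr_refl.
  have zl := freach_lt hx hz.
  apply: freach_trans IH.
  have [n en] := bounded_inj_iter_back sig_lt sig_inj zl.
  rewrite -[X in freach _ _ _ _ X]en; elim: n {en} => [|n IHn]; first exact: fr_refl.
  by rewrite iterS; apply: fr_sig.
have zl := freach_lt hx hz.
apply: freach_trans IH; apply: fr_alp'; first by rewrite alpK.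
  by move=> ea; apply: h2; rewrite -ea alpK.
by move=> ea; apply: h1; rewrite -(alpK zl) ea alpK.
Qed.

Lemma freach_swap e x y : e < mh M ->
  freach (sig M) (alp M) e x y -> freach (sig M) (alp M) (alp M e) x y.
Proof.
move=> he; elim=> [|z _ IH|z _ IH h1 h2]; [exact: fr_refl|exact: fr_sig|].
by apply: fr_alp => //; rewrite alpK.
Qed.

End ValidMap.

(** * Isomorphisms and the labeling *)

Definition map_iso_by (M1 M2 : rmap) (f : nat -> nat) : Prop :=
    [/\ forall h, h < mh M1 -> f h < mh M2,
        forall h1 h2, h1 < mh M1 -> h2 < mh M1 -> f h1 = f h2 -> h1 = h2,
        forall h, h < mh M1 -> f (sig M1 h) = sig M2 (f h),
        forall h, h < mh M1 -> f (alp M1 h) = alp M2 (f h)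
      & f (mroot M1) = mroot M2].

Lemma map_iso_refl M : map_iso M M.
Proof. by split=> //; exists id; split. Qed.

Lemma map_iso_trans M1 M2 M3 : map_iso M1 M2 -> map_iso M2 M3 -> map_iso M1 M3.
Proof.
move=> [e12 [f [f1 f2 f3 f4 f5]]] [e23 [g [g1 g2 g3 g4 g5]]].
split; first by rewrite e12.
exists (g \o f); split=> /= [h hh|h1 h2 hh1 hh2 e|h hh|h hh|].
- by apply/g1/f1.
- by apply: f2 => //; apply: g2 => //; apply: f1.
- by rewrite f3 // g3 //; apply: f1.
- by rewrite f4 // g4 //; apply: f1.
- by rewrite f5.
Qed.

Lemma map_iso_inv M1 M2 f : valid_map M1 -> mh M1 = mh M2 -> map_iso_by M1 M2 f ->
  exists g, map_iso_by M2 M1 g /\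
    forall h, h < mh M2 -> f (g h) = h /\ g (f h) = h.
Proof.
move=> v e [f1 f2 f3 f4 f5]; rewrite -e in f1 *.
have [g Hg] := bounded_inj_inv f1 f2.
have gb h : h < mh M1 -> g h < mh M1 by move=> /Hg[].
have fg h : h < mh M1 -> f (g h) = h by move=> /Hg[].
have gf h : h < mh M1 -> g (f h) = h by move=> /Hg[].
exists g; split; last by move=> h hh; rewrite fg ?gf.
split; rewrite -?e.
- exact: gb.
- by move=> h1 h2 hh1 hh2 eg; rewrite -(fg h1) // eg fg.
- by move=> h hh; rewrite -{1}(fg h) // -f3 ?gf //; [apply: sig_lt|]; rewrite // gb.
- by move=> h hh; rewrite -{1}(fg h) // -f4 ?gf //; [apply: alp_lt|]; rewrite // gb.
- by rewrite -f5 gf //; apply: mroot_lt.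
Qed.

Lemma map_iso_sym M1 M2 : valid_map M1 -> map_iso M1 M2 -> map_iso M2 M1.
Proof. by move=> v [e [f hf]]; have [g [hg _]] := map_iso_inv v e hf; split=> //; exists g. Qed.

(** [a1] and [a2] need not be the involutions of the two maps, because the labeling asks for bridges
    after some edges have been cut. *)
Lemma map_iso_freach M1 M2 f a1 a2 e x y :
  valid_map M1 -> map_iso_by M1 M2 f -> e < mh M1 ->
  (forall h, h < mh M1 -> a1 h < mh M1) ->
  (forall h, h < mh M1 -> f (a1 h) = a2 (f h)) ->
  x < mh M1 -> freach (sig M1) a1 e x y -> freach (sig M2) a2 (f e) (f x) (f y).
Proof.
move=> v [f1 f2 f3 f4 f5] he ab fa hx hr.
suff [] : y < mh M1 /\ freach (sig M2) a2 (f e) (f x) (f y) by [].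
apply: (freach_map (P := fun h => h < mh M1)) hx hr => z hz.
  by split; [apply: sig_lt|apply: fr_sig'; rewrite f3].
move=> z1 z2; split; first exact: ab.
apply: fr_alp'; first exact: fa.
  by move=> ez; apply: z1; apply: f2.
by rewrite -fa // => ez; apply: z2; apply: f2 => //; apply: ab.
Qed.

Lemma map_iso_fbridge M1 M2 f a1 a2 e :
  valid_map M1 -> valid_map M2 -> mh M1 = mh M2 -> map_iso_by M1 M2 f -> e < mh M1 ->
  (forall h, h < mh M1 -> a1 h < mh M1) ->
  (forall h, h < mh M1 -> f (a1 h) = a2 (f h)) ->
  fbridgeb (sig M1) a1 e = fbridgeb (sig M2) a2 (f e).
Proof.
move=> v v2 e12 hf he ab fa; apply: fbridgeb_eq; rewrite /fbridge.
have [g [hg fg]] := map_iso_inv v e12 hf.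
have [f1 f2 _ _ _] := hf; have [g1 _ _ _ _] := hg.
have fa' h : h < mh M2 -> g (a2 h) = a1 (g h).
  move=> hh; rewrite -{1}(proj1 (fg _ hh)) -fa ?g1 //.
  by apply fg; rewrite -e12; apply/ab/g1.
split=> -[h1 h2]; rewrite -?fa //; split.
- by move=> eh; apply: h1; apply: f2 => //; apply: ab.
- move=> hr; apply: h2.
  have -> : e = g (f e) by apply: esym; apply fg; rewrite -e12.
  have -> : a1 (g (f e)) = g (f (a1 e)) by rewrite -fa' ?f1 // -fa.
  apply: (map_iso_freach (M1 := M2) (M2 := M1) (a1 := a2) v2 hg) => //; try exact: f1.
  by move=> h hh; rewrite -(proj1 (fg _ hh)) -fa ?f1 ?ab ?g1.
- by move=> eh; apply: h1; rewrite -fa // eh.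
- by move=> hr; apply: h2; rewrite -fa //; apply: (map_iso_freach v hf he ab fa he hr).
Qed.

Lemma cut_lt m (a : nat -> nat) h x :
  (forall y, y < m -> a y < m) -> x < m -> cut a h x < m.
Proof. by move=> ab hx; rewrite /cut; case: ifP => // _; apply: ab. Qed.

(** The part of validity that survives cutting: dangling half-edges are fixed points too, so [r] is
    fixed without being the only such point. *)
Definition invol (m r : nat) (a : nat -> nat) : Prop :=
  [/\ forall h, h < m -> a h < m, forall h, h < m -> a (a h) = h & a r = r].

Lemma invol_cut m r a h : invol m r a -> h < m -> invol m r (cut a h).
Proof.
move=> [ab aK ar] hm; split=> [x hx|x hx|].
- exact: cut_lt.
- rewrite /cut; case: (boolP ((x == h) || (x == a h))) => [->//|].
  rewrite negb_or => /andP[/eqP xh /eqP xah].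
  case: eqP => [e|_] /=; first by case: xah; rewrite -e aK.
  case: eqP => [e|_] /=; first by case: xh; rewrite -(aK _ hx) e aK.
  exact: aK.
- by rewrite /cut; case: ifP.
Qed.

Lemma lstep_invol M c a : valid_map M -> c < mh M -> invol (mh M) (mroot M) a ->
  (lstep (sig M) (c, a)).1 < mh M /\ invol (mh M) (mroot M) (lstep (sig M) (c, a)).2.
Proof.
move=> v hc ha; have hs := sig_lt v hc; rewrite /lstep /=.
have hi : invol (mh M) (mroot M) (if fbridgeb (sig M) a (sig M c) then a else cut a (sig M c)).
  by case: ifP => // _; apply: invol_cut.
by split=> //; case: hi => + _ _; apply.
Qed.

Lemma lstate_invol M k : valid_map M ->
  (lstate M k).1 < mh M /\ invol (mh M) (mroot M) (lstate M k).2.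
Proof.
move=> v; elim: k => [|k [IH1 IH2]].
  by split; [apply: mroot_lt|split; [apply: alp_lt|apply: alpK|apply: alp_root]].
by rewrite lstateS [lstate M k]surjective_pairing; apply: lstep_invol.
Qed.

Lemma corner_lt M k : valid_map M -> corner M k < mh M.
Proof. by move=> v; rewrite cornerE; apply: (lstate_invol _ v).1. Qed.

Lemma lstate_iso M1 M2 f k : valid_map M1 -> valid_map M2 -> mh M1 = mh M2 ->
  map_iso_by M1 M2 f ->
  (lstate M2 k).1 = f (lstate M1 k).1 /\
  (forall h, h < mh M1 -> f ((lstate M1 k).2 h) = (lstate M2 k).2 (f h)).
Proof.
move=> v1 v2 e hf; have [f1 f2 f3 f4 f5] := hf.
elim: k => [|k [IH1 IH2]]; first by rewrite f5; split.
have [cl [ab aK _]] := lstate_invol k v1.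
rewrite !lstateS /lstep IH1 -f3 //=.
have hs := sig_lt v1 cl.
rewrite -(map_iso_fbridge (M1 := M1) (a1 := (lstate M1 k).2) v1) //.
case: ifP => _; first by rewrite IH2.
have H h : h < mh M1 -> f (cut (lstate M1 k).2 (sig M1 (lstate M1 k).1) h) =
   cut (lstate M2 k).2 (f (sig M1 (lstate M1 k).1)) (f h).
  move=> hh; rewrite /cut -IH2 //.
  have -> : (f h == f (sig M1 (lstate M1 k).1)) = (h == sig M1 (lstate M1 k).1).
    by apply/eqP/eqP => [|->//]; apply: f2.
  have -> : (f h == f ((lstate M1 k).2 (sig M1 (lstate M1 k).1))) =
     (h == (lstate M1 k).2 (sig M1 (lstate M1 k).1)).
    by apply/eqP/eqP => [|->//]; apply: f2 => //; apply: ab.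
  by case: ifP => // _; apply: IH2.
by rewrite H.
Qed.

Lemma corner_iso M1 M2 f k : valid_map M1 -> valid_map M2 -> mh M1 = mh M2 ->
  map_iso_by M1 M2 f -> f (corner M1 k) = corner M2 k.
Proof. by move=> v1 v2 e hf; rewrite !cornerE; have [-> _] := lstate_iso k.-1 v1 v2 e hf. Qed.

Lemma bridgeless_iso M1 M2 : valid_map M1 -> valid_map M2 -> map_iso M1 M2 ->
  bridgeless M1 -> bridgeless M2.
Proof.
move=> v1 v2 [e [f hf]] b h hh /is_bridgeE/fbridgeP hb.
have [g [hg _]] := map_iso_inv v1 e hf; have [g1 _ _ g4 _] := hg.
apply: (b (g h)); first exact: g1.
apply/is_bridgeE/fbridgeP; move: hb.
by rewrite (map_iso_fbridge (M2 := M1) (a2 := alp M1) v2 v1 _ hg) // => ?; apply: alp_lt.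
Qed.

Lemma valid_iso M1 M2 : valid_map M2 ->
  [/\ size (msig M1) = mh M1, size (malp M1) = mh M1, mroot M1 < mh M1
    & forall h, h < mh M1 -> sig M1 h < mh M1 /\ alp M1 h < mh M1] ->
  map_iso M1 M2 -> valid_map M1.
Proof.
move=> v2 [s1 s2 rl b] [e [f [f1 f2 f3 f4 f5]]].
split; first by split.
split=> [h1 h2 hh1 hh2 es|h hh|h hh].
- by apply: f2 => //; apply: (sig_inj v2); rewrite ?f1 // -!f3 // es.
- have [sb ab] := b _ hh; split.
    by apply: f2 => //; [apply: (proj2 (b _ ab))|rewrite !f4 // alpK // f1].
  split=> [ea|->].
    by apply: f2 => //; rewrite f5; apply: (alp_fix v2); rewrite ?f1 // -f4 // ea.
  by apply: f2 => //; [apply: (proj2 (b _ rl))|rewrite f4 // f5 alp_root].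
- have /(valid_mreach v2) := f1 _ hh.
  suff H y : mreach M2 y -> exists2 x, x < mh M1 & f x = y /\ mreach M1 x.
    by move=> /H[x hx [/f2 <-]].
  elim=> [|z _ [x hx [<- IH]]|z _ [x hx [<- IH]]].
  + by exists (mroot M1) => //; split=> //; apply: mr_root.
  + exists (sig M1 x); first exact: (proj1 (b _ hx)).
    by rewrite f3 //; split=> //; apply: mr_sig.
  + exists (alp M1 x); first exact: (proj2 (b _ hx)).
    by rewrite f4 //; split=> //; apply: mr_alp.
Qed.

(** [L] lists the half-edges in the order of their new names. It serves to bring an edge, or one
    side of a bridge, to the positions where [mapRc] and [mapInsc] place what they add. *)
Lemma relabel M (L : seq nat) : valid_map M -> perm_eq L (iota 0 (mh M)) ->
  exists M2, [/\ valid_map M2, map_iso M M2, mh M2 = mh M & map_iso_by M2 M (nth 0 L)].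
Proof.
move=> v pL.
have sL : size L = mh M by rewrite (perm_size pL) size_iota.
have uL : uniq L by rewrite (perm_uniq pL) iota_uniq.
have mL h : (h \in L) = (h < mh M) by rewrite (perm_mem pL) mem_iota.
have nL h : h < mh M -> nth 0 L h < mh M by move=> hh; rewrite -mL mem_nth ?sL.
pose M2 := RMap (mh M) (mkseq (fun i => index (sig M (nth 0 L i)) L) (mh M))
  (mkseq (fun i => index (alp M (nth 0 L i)) L) (mh M)) (index (mroot M) L).
have es h : h < mh M -> sig M2 h = index (sig M (nth 0 L h)) L.
  by move=> hh; rewrite /sig /= nth_mkseq.
have ea h : h < mh M -> alp M2 h = index (alp M (nth 0 L h)) L.
  by move=> hh; rewrite /alp /= nth_mkseq.
have iL h : h < mh M -> index h L < mh M by rewrite -sL index_mem mL sL.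
have hby : map_iso_by M2 M (nth 0 L).
  split=> /= [h hh|h1 h2 hh1 hh2|h hh|h hh|].
  - exact: nL.
  - by move/eqP; rewrite nth_uniq ?sL // => /eqP.
  - by rewrite es // nth_index // mL; apply: sig_lt => //; apply: nL.
  - by rewrite ea // nth_index // mL; apply: alp_lt => //; apply: nL.
  - by rewrite nth_index // mL mroot_lt.
have iso : map_iso M2 M by split=> //; exists (nth 0 L).
have v2 : valid_map M2.
  apply: valid_iso iso => //; split; rewrite ?size_mkseq //=.
    by apply/iL/mroot_lt.
  move=> h hh; rewrite es // ea //; split; apply: iL; [apply: sig_lt|apply: alp_lt] => //; exact: nL.
by exists M2; split=> //; apply: map_iso_sym.
Qed.

(** * Corners of R_k N and Ins_{M',k} N *)

(* [mapRc c] and [mapInsc M' c] are R_k and Ins_{M',k} with the k-th corner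
   given by the half-edge c instead of its label. *)
Definition mapRc (c : nat) (N : rmap) : rmap :=
  let m := mh N in let r := mroot N in
  let sg h :=
    if h == r then m
    else if h == m then (if c == r then m.+1 else sig N r)
    else if h == m.+1 then (if c == r then sig N r else sig N c)
    else if h == c then m.+1
    else sig N h in
  let al h := if h == m then m.+1 else if h == m.+1 then m else alp N h in
  RMap m.+2 (mkseq sg m.+2) (mkseq al m.+2) r.

Definition mapInsc (M' : rmap) (c : nat) (N : rmap) : rmap :=
  let m := mh N in let m' := mh M' in let x := m + m' in
  let sg h :=
    if h < m then (if h == c then x else sig N h)
    else if h < x then sig M' (h - m) + m
    else sig N c in
  let al h :=
    if h < m then alp N h
    else if h < x then (if h - m == mroot M' then x else alp M' (h - m) + m)
    else mroot M' + m in
  RMap x.+1 (mkseq sg x.+1) (mkseq al x.+1) (mroot N).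

Lemma mapRE k N : mapR k N = mapRc (corner N k) N.
Proof. by []. Qed.

Lemma mapInsE M' k N : mapIns M' k N = mapInsc M' (corner N k) N.
Proof. by []. Qed.

Arguments lstate : simpl never.
Arguments mapR : simpl never.
Arguments mapIns : simpl never.
Arguments mapRc : simpl never.
Arguments mapInsc : simpl never.

Lemma mr_sig' M x y : mreach M x -> y = sig M x -> mreach M y.
Proof. by move=> h ->; apply: mr_sig. Qed.

Lemma mr_alp' M x y : mreach M x -> y = alp M x -> mreach M y.
Proof. by move=> h ->; apply: mr_alp. Qed.

(** Covering [mh N] corners with [mh N] labels makes the labels distinct. The last clause says that
    the half-edge after the last corner is the root: when [N] is itself inserted somewhere, this is
    where the labeling leaves it. *)
Definition good_corners N :=
  (forall h, h < mh N -> exists2 k, 0 < k <= mh N & corner N k = h) /\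
  sig N (corner N (mh N)) = mroot N.

Lemma corner_inj N j k : good_corners N ->
  0 < j <= mh N -> 0 < k <= mh N -> corner N j = corner N k -> j = k.
Proof.
move=> [gN _] hj hk e; pose l := map (corner N) (iota 1 (mh N)).
have sl : size l = mh N by rewrite size_map size_iota.
have ul : uniq l.
  apply: (leq_size_uniq (iota_uniq 0 (mh N))); last by rewrite sl size_iota.
  move=> h; rewrite mem_iota => /gN[i hi <-]; apply: map_f; rewrite mem_iota; lia.
have nl i : 0 < i <= mh N -> nth 0 l i.-1 = corner N i.
  move=> hi; rewrite (nth_map 0) ?size_iota; last lia.
  by rewrite nth_iota; [congr corner; lia|lia].
have /eqP := nl _ hj; rewrite e -(nl _ hk) nth_uniq ?sl //; lia.
Qed.

(** * Labels after adding a root edge *)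

Section RootEdge.
Variables (c : nat) (N : rmap).
Hypotheses (vN : valid_map N) (hc : c < mh N).
Let m := mh N.
Let r := mroot N.
Let M := mapRc c N.
Let hr : r < m := mroot_lt vN.

Lemma sig_Rc_root : sig M r = m.
Proof. by rewrite /sig nth_mkseq ?eqxx // ltnW // ltnW // ltnS. Qed.
Lemma sig_Rc_a : sig M m = if c == r then m.+1 else sig N r.
Proof. by rewrite /sig nth_mkseq ?eqxx // gtn_eqF. Qed.
Lemma sig_Rc_b : sig M m.+1 = sig N c.
Proof.
rewrite /sig nth_mkseq // !eqxx.
have -> : (m.+1 == mroot N) = false by rewrite -/r; lia.
have -> : (m.+1 == mh N) = false by rewrite -/m; lia.
by case: eqP => [->|].
Qed.
Lemma sig_Rc_c : c <> r -> sig M c = m.+1.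
Proof.
move=> cr; have hc' := hc; rewrite -/m in hc'; rewrite /sig nth_mkseq -/m -/r; last lia.
by rewrite eqxx; decide_ifs.
Qed.
Lemma sig_Rc_old h : h < m -> h <> r -> h <> c -> sig M h = sig N h.
Proof.
by move=> h1 h2 h3; rewrite /sig nth_mkseq -/m -/r; [decide_ifs|lia].
Qed.
Lemma alp_Rc_a : alp M m = m.+1.
Proof. by rewrite /alp nth_mkseq ?eqxx. Qed.
Lemma alp_Rc_b : alp M m.+1 = m.
Proof. by rewrite /alp nth_mkseq -/m ?eqxx //; decide_ifs. Qed.
Lemma alp_Rc_old h : h < m -> alp M h = alp N h.
Proof. by move=> hm; rewrite /alp nth_mkseq -/m; [decide_ifs|lia]. Qed.

Lemma Rc_cases h : h < m.+2 ->
  [\/ h = r, h = m, h = m.+1 | (h = c /\ c <> r) \/ [/\ h < m, h <> r & h <> c]].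
Proof.
move=> hm.
have [->|h1] := eqVneq h r; first by constructor 1.
have [->|h2] := eqVneq h m; first by constructor 2.
have [->|h3] := eqVneq h m.+1; first by constructor 3.
have [e|h4] := eqVneq h c; first by constructor 4; left; rewrite -e; split=> //; apply/eqP.
by constructor 4; right; split; lia.
Qed.

Let slt h : h < m -> sig N h < m. Proof. exact: sig_lt. Qed.
Let alt h : h < m -> alp N h < m. Proof. exact: alp_lt. Qed.

(** New half-edges only lengthen a [sig] step of [N] inside a vertex, whatever edge is deleted and
    whatever the involution. *)
Lemma freach_Rc_sig a e h : h < m -> freach (sig M) a e h (sig N h).
Proof.
move=> hm; have [->|hr'] := eqVneq h r.
  have [cr|/eqP cr] := eqVneq c r.
    apply: (freach_trans (y := m)); first by apply: fr_sig'; rewrite sig_Rc_root.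
    apply: (freach_trans (y := m.+1)); first by apply: fr_sig'; rewrite sig_Rc_a cr eqxx.
    by apply: fr_sig'; rewrite sig_Rc_b cr.
  apply: (freach_trans (y := m)); first by apply: fr_sig'; rewrite sig_Rc_root.
  by apply: fr_sig'; rewrite sig_Rc_a; case: eqP.
have [hc'|hc'] := eqVneq h c.
  apply: (freach_trans (y := m.+1)); last by apply: fr_sig'; rewrite sig_Rc_b hc'.
  by apply: fr_sig'; rewrite hc' sig_Rc_c // -hc'; apply/eqP.
by apply: fr_sig'; rewrite sig_Rc_old //; apply/eqP.
Qed.

(** Retraction to [N] that sends each new half-edge to the corner holding it; a [sig] step of [M]
    then becomes a [sig] step of [N] or no step at all. *)
Definition Rc_proj h := if h < m then h else if h == m then r else c.

Lemma Rc_proj_old h : h < m -> Rc_proj h = h.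
Proof. by rewrite /Rc_proj => ->. Qed.

Lemma Rc_proj_sig h : h < m.+2 ->
  sig M h < m.+2 /\ (Rc_proj (sig M h) = Rc_proj h \/ Rc_proj (sig M h) = sig N (Rc_proj h)).
Proof.
have pm : Rc_proj m = r by rewrite /Rc_proj ltnn eqxx.
have pm1 : Rc_proj m.+1 = c by rewrite /Rc_proj; decide_ifs.
case/Rc_cases => [->|->|->|[[-> cr]|[h1 h2 h3]]].
- by rewrite sig_Rc_root pm Rc_proj_old //; split; [lia|left].
- rewrite sig_Rc_a pm; case: eqP => [cr|_].
    by rewrite pm1 cr; split=> //; left.
  by have := slt hr; split; [lia|right; rewrite Rc_proj_old].
- by rewrite sig_Rc_b pm1; have := slt hc; split; [lia|right; rewrite Rc_proj_old].
- by rewrite sig_Rc_c // pm1 (Rc_proj_old hc); split=> //; left.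
- by rewrite sig_Rc_old //; have := slt h1; split; [lia|right; rewrite !Rc_proj_old].
Qed.

Lemma valid_mapRc : valid_map M.
Proof.
have lM h : h < m.+2 -> sig M h < m.+2 by move=> /Rc_proj_sig[].
have lA h : h < m.+2 -> alp M h < m.+2.
  case/Rc_cases => [->|->|->|[[-> _]|[h1 _ _]]];
  rewrite ?alp_Rc_a ?alp_Rc_b ?alp_Rc_old //.
  - by have := alt hr; lia.
  - by have := alt hc; lia.
  - by have := alt h1; lia.
split; split; rewrite ?size_mkseq //=.
- by rewrite -/m -/r; lia.
- by move=> h hh; split; [apply: lM|apply: lA].
- { have sr := slt hr; have sc := slt hc.
  have si h1 h2 : h1 < m -> h2 < m -> sig N h1 = sig N h2 -> h1 = h2 by exact: sig_inj.
  move=> h1 h2.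
  have [cr|/eqP cr] := eqVneq c r;
  case/Rc_cases => [->|->|->|[[-> c1]|[x1 x2 x3]]];
  case/Rc_cases => [->|->|->|[[-> c2]|[y1 y2 y3]]] //;
  rewrite ?sig_Rc_root ?sig_Rc_a ?sig_Rc_b ?sig_Rc_c ?sig_Rc_old //;
  rewrite ?cr ?eqxx; try (case: eqP => // _); rewrite ?cr;
  try (have := slt x1); try (have := slt y1); try lia.
  all: intros; try (by exfalso; lia).
  all: try match goal with H : sig N ?x = sig N ?y |- _ => have ? := @si x y ltac:(assumption) ltac:(assumption) H end; congruence. }
- move=> h hh; have [hm|hm] := ltnP h m.
    rewrite alp_Rc_old // alp_Rc_old ?alt // alpK //; split=> //; split; first exact: alp_fix.
    by move=> ->; apply: alp_root.
  have [->|h1] := eqVneq h m; first by rewrite alp_Rc_a alp_Rc_b; split=> //; split; lia.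
  have -> : h = m.+1 by rewrite -/m in hh; lia.
  by rewrite alp_Rc_b alp_Rc_a; split=> //; split; lia.
- have H h : mreach N h -> h < m /\ mreach M h.
    elim=> [|y _ [ym IH]|y _ [ym IH]]; first by split=> //; apply: mr_root.
      split; first exact: slt.
      (* With the identity as involution only [sig] steps move, so the path can be replayed in
         [mreach]. *)
      have : freach (sig M) (fun h => h) 0 y (sig N y) by exact: freach_Rc_sig.
      by elim=> // *; apply: mr_sig.
    by split; [exact: alt|apply: (mr_alp' IH); rewrite alp_Rc_old].
  have Ha : mreach M m by apply: (mr_sig' (mr_root M)); rewrite sig_Rc_root.
  move=> h hh; have [hm|hm] := ltnP h m; first by case: (H h (valid_mreach vN hm)).
  have [->|h1] := eqVneq h m; first exact: Ha.
  have -> : h = m.+1 by rewrite -/m in hh; lia.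
  by apply: (mr_alp' Ha); rewrite alp_Rc_a.
Qed.

(** The state of [M] once its root edge is cut and [N] is in state [a]: the two new half-edges
    dangle. The value 0 beyond them is the default of [nth], so that states agree as functions. *)
Definition extR (a : nat -> nat) h :=
  if h < m then a h else if h < m.+2 then h else 0.

Lemma fbridge_Rc a h : invol m r a -> h < m ->
  fbridgeb (sig M) (extR a) h = fbridgeb (sig N) a h.
Proof.
move=> [ab aK ar] hm; apply: fbridgeb_eq; rewrite /fbridge.
have -> : extR a h = a h by rewrite /extR hm.
suff E : freach (sig M) (extR a) h h (a h) <-> freach (sig N) a h h (a h) by rewrite E.
split=> hh.
- have [_] : a h < m.+2 /\ freach (sig N) a h (Rc_proj h) (Rc_proj (a h)).
    apply: (freach_map (P := fun h => h < m.+2)) hh; last by lia.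
    + move=> y hy; have [h1 h2] := Rc_proj_sig hy; split=> //.
      by case: h2 => ->; [apply: fr_refl|apply: fr_sig'].
    + move=> y hy; rewrite /extR hm; case: ifP => ym y1 y2.
        have := ab _ ym; split; [lia|]; rewrite !Rc_proj_old //; exact: fr_alp'.
      by rewrite hy; split=> //; apply: fr_refl.
  by rewrite !Rc_proj_old //; apply: ab.
- suff [] : a h < m /\ freach (sig M) (extR a) h h (a h) by [].
  apply: (freach_map (P := fun h => h < m) (g := id)) hh => // y hy.
    by split; [apply: slt|apply: freach_Rc_sig].
  by move=> y1 y2; split; [apply: ab|apply: fr_alp' => //; rewrite /extR ?hy ?hm].
Qed.

Lemma cut_extR a h : invol m r a -> h < m -> cut (extR a) h = extR (cut a h).
Proof.
move=> [ab aK ar] hm; apply: functional_extensionality => x; rewrite /cut /extR hm.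
have := ab _ hm; case: (ltnP x m) => // xm hah.
by decide_ifs.
Qed.

(** A step depends on the current corner only through its successor, so [c1] may be a new half-edge
    that has inherited the successor of [c0]. *)
Lemma lstep_Rc c0 c1 a : c0 < m -> invol m r a -> sig M c1 = sig N c0 ->
  lstep (sig M) (c1, extR a) =
  ((lstep (sig N) (c0, a)).1, extR (lstep (sig N) (c0, a)).2).
Proof.
move=> h0 ha e; have hs := slt h0; have [ab _ _] := ha.
rewrite /lstep /= e fbridge_Rc // cut_extR //.
by case: ifP => _; rewrite /extR hs.
Qed.

Lemma lstep_dangling s c1 a : a (s c1) = s c1 -> lstep s (c1, a) = (s c1, a).
Proof.
move=> e; rewrite /lstep /=; have -> : fbridgeb s a (s c1) = false.
  by apply/fbridgeP => -[].
congr pair; first by rewrite /cut eqxx.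
by apply: functional_extensionality => x; rewrite /cut e orbb; case: eqP => [->|].
Qed.

(** [N] is connected without the new edge, so the two corners that this edge joins stay connected
    after its deletion. *)
Lemma not_fbridge_Rc_root : ~ fbridge (sig M) (alp M) m.
Proof.
case=> _; apply; rewrite alp_Rc_a.
have v := valid_mapRc.
have H x : mreach N x -> x < m /\ freach (sig M) (alp M) m r x.
  elim=> [|y _ [ym IH]|y _ [ym IH]]; first by split=> //; apply: fr_refl.
    by split; [apply: slt|apply: freach_trans IH _; apply: freach_Rc_sig].
  split; first exact: alt.
  by apply: freach_trans IH _; apply: fr_alp'; rewrite ?alp_Rc_a ?alp_Rc_old //; lia.
apply: (freach_trans (y := r)).
  have mM : mh M = m.+2 by [].
  apply: (freach_sym v); rewrite ?mM; try lia.
  by apply: fr_sig'; rewrite sig_Rc_root.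
have [_ hrc] := H _ (valid_mreach vN hc).
have [cr|/eqP cr] := eqVneq c r.
  apply: (freach_trans (y := m)); first by apply: fr_sig'; rewrite sig_Rc_root.
  by apply: fr_sig'; rewrite sig_Rc_a cr eqxx.
by apply: freach_trans hrc _; apply: fr_sig'; rewrite sig_Rc_c.
Qed.

(** The root edge is no bridge, so the first step cuts it; from then on the process runs on [N] with
    two dangling half-edges added. *)
Lemma lstate_Rc1 : lstate M 1 = (m, extR (alp N)).
Proof.
rewrite lstateS /lstate /= /lstep /= sig_Rc_root.
have -> : fbridgeb (sig M) (alp M) m = false by apply/fbridgeP/not_fbridge_Rc_root.
congr pair; first by rewrite /cut eqxx.
apply: functional_extensionality => x; rewrite /cut /extR alp_Rc_a.
have [xm|xm] := ltnP x m; first by decide_ifs; rewrite alp_Rc_old.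
case: (boolP ((x == m) || (x == m.+1))) => hx; first by decide_ifs.
by decide_ifs; rewrite /alp nth_default // size_mkseq -/m; lia.
Qed.

End RootEdge.

Section RootEdgeCorners.
Variables (k : nat) (N : rmap).
Hypotheses (vN : valid_map N) (gN : good_corners N) (hk : 0 < k <= mh N).
Let m := mh N.
Let r := mroot N.
Let M := mapR k N.
Let c := corner N k.
Let hc : c < m := corner_lt k vN.

Let cor_r j : 1 < j <= m -> corner N j <> r.
Proof. by move=> hj e; have := @corner_inj N j 1 gN; rewrite corner1 -/m; lia. Qed.
Let cor_c j : 0 < j <= m -> j <> k -> corner N j <> c.
Proof. by move=> hj jk e; have := @corner_inj N j k gN; rewrite -/m -/c; lia. Qed.

(** The root corner is split by [m] and corner [k] by [m.+1]. Old labels are thus shifted by one up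
    to [k] (the second piece of the root corner gets 2) and by two after [k], as a new root chord
    shifts the intervals. *)
Lemma lstate_R_low j : 0 < j <= k ->
  lstate M j = (if j == 1 then m else corner N j, extR N (lstate N j.-1).2).
Proof.
elim: j => // j IH hj; have [j0|j0] := posnP j.
  by rewrite j0; apply: (lstate_Rc1 vN hc).
rewrite lstateS IH; last lia.
have [cl al] := lstate_invol j.-1 vN.
rewrite (lstep_Rc vN hc (c0 := (lstate N j.-1).1) cl al) -?surjective_pairing.
  rewrite -lstateS.
  have -> : (j.+1 == 1) = false by lia.
  by rewrite prednK // cornerE.
(* Label 2 sits at [m], which has inherited the successor of the root; [c = r] would force
   [k = 1]. *)
case: eqP => [->|j1].
  rewrite (sig_Rc_a _ vN); case: eqP => // e; exfalso.
  by apply: (@cor_r k) => //; lia.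
rewrite (sig_Rc_old vN hc); first by rewrite cornerE.
- by rewrite cornerE; apply: cl.
- by apply: cor_r; lia.
- by apply: cor_c; lia.
Qed.

Lemma lstate_R_b : lstate M k.+1 = (m.+1, extR N (lstate N k.-1).2).
Proof.
rewrite lstateS lstate_R_low; last lia.
have e : sig M (if k == 1 then m else corner N k) = m.+1.
  case: eqP => [k1|k1].
    by rewrite (sig_Rc_a _ vN) k1 corner1 eqxx.
  by rewrite (sig_Rc_c vN hc) //; apply: cor_r; lia.
rewrite lstep_dangling e // /extR.
by rewrite -/m; decide_ifs.
Qed.

Lemma lstate_R_high j : k <= j <= m ->
  lstate M j.+2 = ((lstate N j).1, extR N (lstate N j).2).
Proof.
elim: j => [|j IH] hj; first by lia.
have [jk|jk] := eqVneq j.+1 k.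
  rewrite jk lstateS lstate_R_b.
  have [cl al] := lstate_invol k.-1 vN.
  rewrite (lstep_Rc vN hc cl al) -?surjective_pairing -?lstateS ?prednK //; try lia.
  by rewrite (sig_Rc_b vN hc) /c cornerE.
rewrite lstateS IH; last lia.
have [cl al] := lstate_invol j vN.
rewrite (lstep_Rc vN hc cl al) -?surjective_pairing -?lstateS //.
rewrite (sig_Rc_old vN hc) //.
- by have := @cor_r j.+1; rewrite cornerE; apply; lia.
- by have := @cor_c j.+1; rewrite cornerE; apply; lia.
Qed.

Lemma corner_R_low j : 0 < j <= k -> corner M j.+1 = if j == 1 then m else corner N j.
Proof. by move=> hj; rewrite cornerE succnK lstate_R_low. Qed.

Lemma corner_R_b : corner M k.+2 = m.+1.
Proof. by rewrite cornerE succnK lstate_R_b. Qed.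

Lemma corner_R_high j : k < j <= m -> corner M j.+2 = corner N j.
Proof.
move=> hj; rewrite cornerE [RHS]cornerE succnK.
have -> : j.+1 = j.-1.+2 by lia.
by rewrite lstate_R_high //; lia.
Qed.

Lemma good_corners_R : good_corners M.
Proof.
have mM : mh M = m.+2 by [].
have [g1 g2] := gN.
split; rewrite mM.
  move=> h hh; have [hm|hm] := ltnP h m.
    have [j hj <-] := g1 _ hm; have [jk|jk] := leqP j k.
      have [->|j1] := eqVneq j 1; first by exists 1; rewrite // !corner1.
      exists j.+1; first lia.
      by rewrite corner_R_low ?(negbTE j1) //; lia.
    by exists j.+2; [lia|rewrite corner_R_high //; lia].
  have [->|h1] := eqVneq h m; first by exists 2; rewrite // corner_R_low //; lia.
  by exists k.+2; [lia|rewrite corner_R_b; lia].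
have [km|km] := eqVneq k m.
  by rewrite -[in corner M _]km corner_R_b (sig_Rc_b vN hc) -/c /c km.
rewrite corner_R_high; last by rewrite /m; lia.
rewrite (sig_Rc_old vN hc) //; first exact: corner_lt.
  by apply: cor_r; rewrite /m; lia.
by apply: cor_c; rewrite /m; lia.
Qed.

End RootEdgeCorners.

(** * Labels after inserting a map *)

Section Insertion.
Variables (M' : rmap) (c : nat) (N : rmap).
Hypotheses (vN : valid_map N) (vM' : valid_map M') (hc : c < mh N).
Let m := mh N.
Let m' := mh M'.
Let r := mroot N.
Let r' := mroot M'.
Let x := m + m'.
Let M := mapInsc M' c N.
Let hr : r < m := mroot_lt vN.
Let hr' : r' < m' := mroot_lt vM'.
Let slt h : h < m -> sig N h < m. Proof. exact: sig_lt. Qed.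
Let alt h : h < m -> alp N h < m. Proof. exact: alp_lt. Qed.
Let slt' h : h < m' -> sig M' h < m'. Proof. exact: sig_lt. Qed.
Let alt' h : h < m' -> alp M' h < m'. Proof. exact: alp_lt. Qed.

Lemma sig_Ic_c : sig M c = x.
Proof.
by have hc' := hc; rewrite -/m in hc'; rewrite /sig nth_mkseq -/m -/m' -/x ?eqxx; [decide_ifs|rewrite /x; lia].
Qed.
Lemma sig_Ic_x : sig M x = sig N c.
Proof. by rewrite /sig nth_mkseq -/m -/m' -/x //; have -> : (x < m) = false by [rewrite /x; lia]; rewrite ltnn. Qed.
Lemma sig_Ic_old h : h < m -> h <> c -> sig M h = sig N h.
Proof. by move=> h1 h2; rewrite /sig nth_mkseq -/m -/m'; [decide_ifs|lia]. Qed.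
Lemma sig_Ic_new h : h < m' -> sig M (h + m) = sig M' h + m.
Proof. by move=> h1; rewrite /sig nth_mkseq -/m -/m'; [decide_ifs; rewrite addnK|lia]. Qed.
Lemma alp_Ic_old h : h < m -> alp M h = alp N h.
Proof. by move=> h1; rewrite /alp nth_mkseq -/m -/m'; [decide_ifs|lia]. Qed.
Lemma alp_Ic_x : alp M x = r' + m.
Proof. by rewrite /alp nth_mkseq -/m -/m' -/x //; have -> : (x < m) = false by [rewrite /x; lia]; rewrite ltnn. Qed.
Lemma alp_Ic_root : alp M (r' + m) = x.
Proof. by have h' := hr'; rewrite /alp nth_mkseq -/m -/m'; [decide_ifs|lia]. Qed.
Lemma alp_Ic_new h : h < m' -> h <> r' -> alp M (h + m) = alp M' h + m.
Proof.
by move=> h1 /eqP h2; rewrite /alp nth_mkseq -/m -/m'; [decide_ifs; rewrite addnK|lia].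
Qed.

Lemma Ic_cases h : h < x.+1 ->
  [\/ h = c, h < m /\ h <> c, h = x | exists2 h', h' < m' & h = h' + m].
Proof.
move=> hx; have [->|/eqP h1] := eqVneq h c; first by constructor 1.
have [h2|h2] := ltnP h m; first by constructor 2.
have [->|/eqP h3] := eqVneq h x; first by constructor 3.
by constructor 4; exists (h - m); rewrite /x in hx h3; lia.
Qed.

Lemma freach_Ic_sig a e h : h < m -> freach (sig M) a e h (sig N h).
Proof.
move=> hm; have [->|/eqP h1] := eqVneq h c; last by apply: fr_sig'; rewrite sig_Ic_old.
apply: (freach_trans (y := x)); first by apply: fr_sig'; rewrite sig_Ic_c.
by apply: fr_sig'; rewrite sig_Ic_x.
Qed.

(** [Ic_proj] and [Ic_proj'] retract [M] to the two sides of the connecting bridge: the other side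
    collapses to the corner [c], respectively to the root of [M']. *)
Definition Ic_proj h := if h < m then h else c.
Definition Ic_proj' h := if m <= h < x then h - m else r'.

Lemma Ic_proj'_new h : h < m' -> Ic_proj' (h + m) = h.
Proof. by move=> hh; rewrite /Ic_proj' /x; case: ifP; lia. Qed.

Lemma Ic_sig_lt h : h < x.+1 -> sig M h < x.+1.
Proof.
have xm : m <= x by rewrite /x; lia.
case/Ic_cases => [->|[h1 h2]|->|[h' h1 ->]].
- by rewrite sig_Ic_c.
- by rewrite sig_Ic_old //; have := slt h1; lia.
- by rewrite sig_Ic_x; have := slt hc; lia.
- by rewrite sig_Ic_new //; have := slt' h1; rewrite /x; lia.
Qed.

Lemma Ic_proj_sig h : h < x.+1 ->
  Ic_proj (sig M h) = Ic_proj h \/ Ic_proj (sig M h) = sig N (Ic_proj h).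
Proof.
have xm : m <= x by rewrite /x; lia.
have hc' : c < m by [].
case/Ic_cases => [->|[h1 h2]|->|[h' h1 ->]]; rewrite /Ic_proj.
- by rewrite sig_Ic_c; left; ifs; lia.
- by rewrite sig_Ic_old // h1 slt //; right.
- rewrite sig_Ic_x slt //; have -> : (x < m) = false by lia.
  by right.
- rewrite sig_Ic_new //; left; by ifs; lia.
Qed.

Lemma Ic_proj'_sig h : h < x.+1 ->
  Ic_proj' (sig M h) = Ic_proj' h \/ Ic_proj' (sig M h) = sig M' (Ic_proj' h).
Proof.
have xm : m <= x by rewrite /x; lia.
have hc' : c < m by [].
case/Ic_cases => [->|[h1 h2]|->|[h' h1 ->]].
- by rewrite sig_Ic_c /Ic_proj'; left; ifs; lia.
- by rewrite sig_Ic_old //; have := slt h1; rewrite /Ic_proj'; left; ifs; lia.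
- by rewrite sig_Ic_x; have := slt hc; rewrite /Ic_proj'; left; ifs; lia.
- by rewrite sig_Ic_new // !Ic_proj'_new ?slt' //; right.
Qed.

(** In contrast to [extR] the connecting edge stays whole, since a bridge is never cut; [a] and [a']
    are the states of the two sides. *)
Definition extI (a a' : nat -> nat) h :=
  if h < m then a h
  else if h < x then (if h - m == r' then x else a' (h - m) + m)
  else if h == x then r' + m else 0.

Lemma extI_alp : extI (alp N) (alp M') = alp M.
Proof.
apply: functional_extensionality => h; rewrite /extI /alp.
have [hx|hx] := ltnP h x.+1; last first.
  rewrite [RHS]nth_default; last by rewrite size_mkseq.
  by rewrite /x in hx *; decide_ifs.
rewrite nth_mkseq // -/m -/m' -/x -/r'; case: ifP => //; case: ifP => // *.
by have -> : h == x by lia.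
Qed.

Lemma extI_new a a' h : h < m' -> extI a a' (h + m) = if h == r' then x else a' h + m.
Proof. by move=> hh; rewrite /extI /x addnK; decide_ifs. Qed.

Lemma extI_x a a' : extI a a' x = r' + m.
Proof. by rewrite /extI ltnn eqxx; have -> : (x < m) = false by [rewrite /x; lia]. Qed.

Lemma extI_old a a' h : h < m -> extI a a' h = a h.
Proof. by rewrite /extI => ->. Qed.

Lemma extI_lt a a' h : invol m r a -> invol m' r' a' -> h < x.+1 -> extI a a' h < x.+1.
Proof.
move=> [ab _ _] [ab' _ _]; have xm : m <= x by rewrite /x; lia.
case/Ic_cases => [->|[h1 h2]|->|[h' h1 ->]].
- by rewrite extI_old //; have := ab _ hc; lia.
- by rewrite extI_old //; have := ab _ h1; lia.
- by rewrite extI_x /x; have := hr'; lia.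
- by rewrite extI_new //; have := ab' _ h1; rewrite /x; case: ifP; lia.
Qed.

(** The retraction turns a passage through the connecting bridge, and any stay in [M'], into no
    step, so it maps paths avoiding the edge of [h] to such paths. *)
Lemma fbridge_Ic_old a a' h : invol m r a -> invol m' r' a' -> h < m ->
  fbridgeb (sig M) (extI a a') h = fbridgeb (sig N) a h.
Proof.
move=> ia ia' hm; have [ab aK ar] := ia; apply: fbridgeb_eq; rewrite /fbridge extI_old //.
have xm : m <= x by rewrite /x; lia.
suff E : freach (sig M) (extI a a') h h (a h) <-> freach (sig N) a h h (a h) by rewrite E.
split=> hh.
- have [_] : a h < x.+1 /\ freach (sig N) a h (Ic_proj h) (Ic_proj (a h)).
    apply: (freach_map (P := fun h => h < x.+1)) hh; last by lia.
    + move=> y hy; split; first exact: Ic_sig_lt.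
      by have [->|->] := Ic_proj_sig hy; [apply: fr_refl|apply: fr_sig'].
    + move=> y hy; rewrite (extI_old _ _ hm) => y1 y2.
      split; first exact: extI_lt.
      have [ym|ym] := ltnP y m.
        by rewrite extI_old // /Ic_proj ym ab //; apply: fr_alp'.
      apply: fr_eq; rewrite /Ic_proj /extI; have := hr'; rewrite /x in hy *; ifs; lia.
  by rewrite /Ic_proj hm ab.
- suff [] : a h < m /\ freach (sig M) (extI a a') h h (a h) by [].
  apply: (freach_map (P := fun h => h < m) (g := id)) hh => // y hy.
    by split; [apply: slt|apply: freach_Ic_sig].
  by move=> y1 y2; split; [apply: ab|apply: fr_alp' => //; rewrite extI_old].
Qed.

Lemma fbridge_Ic_new a a' h : invol m r a -> invol m' r' a' -> h < m' -> h <> r' ->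
  fbridgeb (sig M) (extI a a') (h + m) = fbridgeb (sig M') a' h.
Proof.
move=> ia ia' hm /eqP hnr; have [ab aK ar] := ia'.
apply: fbridgeb_eq; rewrite /fbridge.
have ea : extI a a' (h + m) = a' h + m by rewrite extI_new // (negbTE hnr).
rewrite ea.
have -> : (a' h + m <> h + m) <-> (a' h <> h) by split; lia.
suff E : freach (sig M) (extI a a') (h + m) (h + m) (a' h + m) <-> freach (sig M') a' h h (a' h) by rewrite E.
have hx : h + m < x.+1 by rewrite /x; lia.
split=> hh.
- have [_] : a' h + m < x.+1 /\ freach (sig M') a' h (Ic_proj' (h + m)) (Ic_proj' (a' h + m)).
    apply: (freach_map (P := fun h => h < x.+1)) hh => // y hy.
      split; first exact: Ic_sig_lt.
      by have [->|->] := Ic_proj'_sig hy; [apply: fr_refl|apply: fr_sig'].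
    rewrite ea => y1 y2; split; first exact: extI_lt.
    case: (Ic_cases hy) => [->|[h1 h2]|->|[h' h1 e]].
    + apply: fr_eq; rewrite extI_old // /Ic_proj'.
      by have := ia; case=> /(_ c hc) h1 _ _; have := hc; rewrite -/m; ifs; lia.
    + apply: fr_eq; rewrite extI_old // /Ic_proj'.
      by have := ia; case=> /(_ y h1) ? _ _; ifs; lia.
    + apply: fr_eq; rewrite extI_x Ic_proj'_new // /Ic_proj'; ifs; lia.
    + subst y; rewrite extI_new // (Ic_proj'_new h1); case: eqP => [->|hr1].
        by apply: fr_eq; rewrite /Ic_proj'; ifs; lia.
      rewrite Ic_proj'_new ?ab //; apply: fr_alp' => //; lia.
  by rewrite !Ic_proj'_new ?ab.
- suff [] : a' h < m' /\ freach (sig M) (extI a a') (h + m) (h + m) (a' h + m) by [].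
  apply: (freach_map (P := fun h => h < m') (g := addn^~ m)) hh => // y hy.
    by split; [apply: slt'|apply: fr_sig'; rewrite sig_Ic_new].
  move=> y1 y2; split; first exact: ab.
  have [->|/eqP yr] := eqVneq y r'; first by rewrite ar; apply: fr_refl.
  apply: fr_alp'; last by rewrite ea; lia.
    by rewrite extI_new //; case: eqP.
  by lia.
Qed.

(** The half-edges of [N] together with [x] form a set that only the connecting edge leaves. *)
Lemma fbridge_Ic_x a a' : invol m r a -> fbridgeb (sig M) (extI a a') x.
Proof.
move=> [ab _ _]; have xm : m <= x by rewrite /x; lia.
apply/fbridgeP; split; first by rewrite extI_x; have := hr'; rewrite /x; lia.
rewrite extI_x => /(freach_inv (P := fun y => (y < m) || (y == x))) H.
suff : (r' + m < m) || (r' + m == x) by have := hr'; rewrite /x; lia.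
apply: H; last by lia.
- move=> y /orP[ym|/eqP->]; last by rewrite sig_Ic_x slt.
  have [->|/eqP h1] := eqVneq y c; first by rewrite sig_Ic_c eqxx orbT.
  by rewrite sig_Ic_old // slt.
- by move=> y /orP[ym|/eqP->] // *; rewrite extI_old // ab.
Qed.

Lemma fbridge_Ic_root a a' : invol m' r' a' -> fbridgeb (sig M) (extI a a') (r' + m).
Proof.
move=> [ab aK ar]; have xm : m <= x by rewrite /x; lia.
have er : extI a a' (r' + m) = x by rewrite extI_new // eqxx.
apply/fbridgeP; split; first by rewrite er; have := hr'; rewrite /x; lia.
rewrite er => /(freach_inv (P := fun y => exists2 h, h < m' & y = h + m)) H.
suff [h] : exists2 h, h < m' & x = h + m by rewrite /x; lia.
apply: H; last by exists r'.
- by move=> y [h h1 ->]; exists (sig M' h); [apply: slt'|rewrite sig_Ic_new].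
- move=> y [h h1 ->] h2 h3; exists (a' h); first exact: ab.
  by rewrite extI_new //; case: eqP => // e; case: h2; rewrite e.
Qed.

Lemma cut_extI_old a a' h : invol m r a -> h < m -> cut (extI a a') h = extI (cut a h) a'.
Proof.
move=> [ab _ _] hm; apply: functional_extensionality => y; rewrite /cut extI_old //.
have := ab _ hm; have [ym|ym] := ltnP y m => ha; first by rewrite !extI_old.
have -> : (y == h) || (y == a h) = false by lia.
by rewrite /extI; decide_ifs.
Qed.

Lemma cut_extI_new a a' h : invol m r a -> invol m' r' a' -> h < m' -> h <> r' ->
  cut (extI a a') (h + m) = extI a (cut a' h).
Proof.
move=> [ab _ _] [ab' aK' ar'] hm hnr; apply: functional_extensionality => y.
have hnr' : (h == r') = false by apply/eqP.
rewrite /cut extI_new // hnr'.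
have ahr : a' h <> r' by move=> e; apply: hnr; rewrite -(aK' _ hm) e.
have hah := ab' _ hm.
have [ym|ym] := ltnP y m.
  by rewrite !extI_old //; decide_ifs.
have [yx|yx] := ltnP y x; last first.
  rewrite /extI; have -> : (y == h + m) || (y == a' h + m) = false by rewrite /x in yx; lia.
  by decide_ifs.
have -> : y = (y - m) + m by lia.
rewrite !extI_new; try (rewrite /x in yx; lia).
rewrite !eqn_add2r; case: (boolP ((y - m == h) || (y - m == a' h))) => //.
by case/orP => /eqP->; decide_ifs.
Qed.

Lemma lstep_Ic_old c0 c1 a a' : c0 < m -> invol m r a -> invol m' r' a' -> sig M c1 = sig N c0 ->
  lstep (sig M) (c1, extI a a') =
  ((lstep (sig N) (c0, a)).1, extI (lstep (sig N) (c0, a)).2 a').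
Proof.
move=> h0 ha ha' e; have hs := slt h0.
rewrite /lstep /= e fbridge_Ic_old // cut_extI_old //.
by case: ifP => _; rewrite extI_old.
Qed.

(** The successor must differ from the root of [M']: that half-edge dangles in [M'] but in [M] it is
    the bridge back to [x], treated in [lstep_Ic_root]. *)
Lemma lstep_Ic_new c0 a a' : c0 < m' -> invol m r a -> invol m' r' a' -> sig M' c0 <> r' ->
  lstep (sig M) (c0 + m, extI a a') =
  ((lstep (sig M') (c0, a')).1 + m, extI a (lstep (sig M') (c0, a')).2).
Proof.
move=> h0 ha ha' e; have hs := slt' h0; have [ab' aK' ar'] := ha'.
rewrite /lstep /= sig_Ic_new // fbridge_Ic_new // cut_extI_new //.
case: ifP => _; rewrite extI_new //; case: eqP => //.
Qed.

Lemma lstep_Ic_x c1 a a' : invol m r a -> sig M c1 = x ->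
  lstep (sig M) (c1, extI a a') = (r' + m, extI a a').
Proof. by move=> ha e; rewrite /lstep /= e fbridge_Ic_x // extI_x. Qed.

Lemma lstep_Ic_root c0 a a' : c0 < m' -> invol m' r' a' -> sig M' c0 = r' ->
  lstep (sig M) (c0 + m, extI a a') = (x, extI a a').
Proof.
move=> h0 ha' e; rewrite /lstep /= sig_Ic_new // e fbridge_Ic_root //.
by rewrite extI_new // eqxx.
Qed.

Lemma valid_mapInsc : valid_map M.
Proof.
have iN : invol m r (alp N) by split; [exact: alt|exact: alpK|exact: alp_root].
have iM : invol m' r' (alp M') by split; [exact: alt'|exact: alpK|exact: alp_root].
have xm : m <= x by rewrite /x; lia.
have xr : r' + m < x by rewrite /x; have := hr'; lia.
split; split; rewrite ?size_mkseq //=.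
- by rewrite -/m -/m' -/x; have := hr; rewrite /r; lia.
- move=> h hh; split; first exact: Ic_sig_lt.
  by rewrite -extI_alp; apply: extI_lt.
- move=> h1 h2; have sc := slt hc.
  case/Ic_cases => [->|[x1 x2]|->|[u x1 ->]];
  case/Ic_cases => [->|[y1 y2]|->|[w y1 ->]] //;
  rewrite ?sig_Ic_c ?sig_Ic_x ?sig_Ic_new ?sig_Ic_old //.
  + by have := slt y1; lia.
  + by lia.
  + by have := slt' y1; rewrite /x; lia.
  + by have := slt x1; lia.
  + by apply: (sig_inj vN).
  + by move/(sig_inj vN) => /(_ x1 hc) e; case: x2.
  + by have := slt x1; lia.
  + by lia.
  + by move/(sig_inj vN) => /(_ hc y1) e; case: y2.
  + by lia.
  + by have := slt' x1; rewrite /x; lia.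
  + by have := slt y1; lia.
  + by lia.
  + by move/addIn => /(sig_inj vM') -> .
- move=> h hh; have [hm|hm] := ltnP h m.
    rewrite alp_Ic_old // alp_Ic_old ?alt // alpK //; split=> //; split; first exact: alp_fix.
    by move=> ->; apply: alp_root.
  have hx : h < x.+1 by [].
  have hn : h <> mroot N by have := hr; rewrite -/r; lia.
  case: (Ic_cases hx) => [e|[h1 _]|->|[h' h1 ->]].
  + by have := hc; rewrite -/m; lia.
  + by lia.
  + rewrite alp_Ic_x alp_Ic_root; split=> //; split; first by lia.
    by have := hr; rewrite -/r; lia.
  + have [->|/eqP h2] := eqVneq h' r'.
      rewrite alp_Ic_root alp_Ic_x; split=> //; split; first by lia.
      by have := hr; rewrite -/r; lia.
    have h3 : alp M' h' <> r'.
      by move=> e; apply: h2; rewrite -(alpK vM' h1) e alp_root.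
    rewrite alp_Ic_new // alp_Ic_new ?alt' // alpK //; split=> //; split.
      by move/addIn => /(alp_fix vM' h1).
    by have := hr; rewrite -/r; lia.
- have HN h : mreach N h -> h < m /\ mreach M h.
    elim=> [|y _ [ym IH]|y _ [ym IH]]; first by split=> //; apply: mr_root.
      split; first exact: slt.
      have : freach (sig M) (fun h => h) 0 y (sig N y) by exact: freach_Ic_sig.
      by elim=> // *; apply: mr_sig.
    by split; [exact: alt|apply: (mr_alp' IH); rewrite alp_Ic_old].
  have [_ Hc] := HN _ (valid_mreach vN hc).
  have Hx : mreach M x by apply: (mr_sig' Hc); rewrite sig_Ic_c.
  have HM h : mreach M' h -> h < m' /\ mreach M (h + m).
    elim=> [|y _ [ym IH]|y _ [ym IH]].
    + by split; [exact: hr'|apply: (mr_alp' Hx); rewrite alp_Ic_x].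
    + by split; [exact: slt'|apply: (mr_sig' IH); rewrite sig_Ic_new].
    + split; first exact: alt'.
      have [e|/eqP yr] := eqVneq y r'; first by rewrite e alp_root // -/r' -e.
      by apply: (mr_alp' IH); rewrite alp_Ic_new.
  move=> h hh; have hx : h < x.+1 by [].
  case: (Ic_cases hx) => [->//|[h1 _]|->//|[h' h1 ->]].
    by case: (HN _ (valid_mreach vN h1)).
  by case: (HM _ (valid_mreach vM' h1)).
Qed.

End Insertion.

Section InsertionCorners.
Variables (M' : rmap) (k : nat) (N : rmap).
Hypotheses (vN : valid_map N) (vM' : valid_map M') (hk : 0 < k <= mh N).
Hypotheses (gN : good_corners N) (gM' : good_corners M').
Let m := mh N.
Let m' := mh M'.
Let r' := mroot M'.
Let x := m + m'.
Let M := mapIns M' k N.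
Let c := corner N k.
Let hc : c < m := corner_lt k vN.

Let cor_c j : 0 < j <= m -> j <> k -> corner N j <> c.
Proof. by move=> hj jk e; have := @corner_inj N j k gN; rewrite -/m -/c; lia. Qed.

Let invN j : invol m (mroot N) (lstate N j).2.
Proof. exact: (lstate_invol j vN).2. Qed.
Let invM' j : invol m' r' (lstate M' j).2.
Proof. exact: (lstate_invol j vM').2. Qed.

(** After corner [k] comes the bridge [x]: the process crosses it at once, labels all [m'] corners
    of [M'], returns to [x] and resumes in [N]. So [m'.+1] labels are interposed, one for each point
    of the diagram that corresponds to [M']. *)
Lemma lstate_I_low j : j < k ->
  lstate M j = ((lstate N j).1, extI M' N (lstate N j).2 (alp M')).
Proof.
elim: j => [|j IH] hj; first by rewrite /lstate /= (extI_alp vN vM' hc).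
rewrite lstateS IH; last lia.
rewrite (lstep_Ic_old vN vM' hc (c0 := (lstate N j).1) _ (invN j) (invM' 0)).
- by rewrite -surjective_pairing -lstateS.
- exact: (lstate_invol j vN).1.
- rewrite (sig_Ic_old vN vM' hc) //; first exact: (lstate_invol j vN).1.
  by have := @cor_c j.+1; rewrite cornerE; apply; rewrite /m; lia.
Qed.

Lemma lstate_I_mid i : i < m' ->
  lstate M (k + i) = ((lstate M' i).1 + m, extI M' N (lstate N k.-1).2 (lstate M' i).2).
Proof.
elim: i => [|i IH] hi.
  rewrite addn0 -[in LHS](@prednK k); last lia.
  rewrite lstateS lstate_I_low; last lia.
  rewrite (lstep_Ic_x vN vM' hc) // -[(lstate N _).1](@cornerE N k).
  by rewrite (sig_Ic_c vN vM' hc).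
rewrite addnS lstateS IH; last lia.
have cl := (lstate_invol i vM').1.
rewrite (lstep_Ic_new vN vM' hc cl) // -?surjective_pairing -?lstateS //.
(* Only the last corner of [M'] is followed by the root, and its label [m'] is not reached yet. *)
move=> e; have [_ g2] := gM'.
have := @corner_inj M' i.+1 m' gM'; rewrite (cornerE _ i.+1) /= -/m'.
have -> : (lstate M' i).1 = corner M' m' by apply: (sig_inj vM') => //; [apply: corner_lt|rewrite e g2].
by lia.
Qed.

Lemma lstate_I_x : lstate M (k + m') = (x, extI M' N (lstate N k.-1).2 (lstate M' m'.-1).2).
Proof.
have m'0 : 0 < m' by have := mroot_lt vM'; rewrite /m'; lia.
have -> : k + m' = (k + m'.-1).+1 by lia.
rewrite lstateS lstate_I_mid; last lia.
rewrite (lstep_Ic_root vN vM' hc) //; first exact: (lstate_invol _ vM').1.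
by have [_] := gM'; rewrite cornerE.
Qed.

Lemma lstate_I_high j : k <= j <= m ->
  lstate M (j + m').+1 = ((lstate N j).1, extI M' N (lstate N j).2 (lstate M' m'.-1).2).
Proof.
elim: j => [|j IH] hj; first by lia.
have [jk|jk] := eqVneq j.+1 k.
  rewrite jk lstateS lstate_I_x.
  rewrite (lstep_Ic_old vN vM' hc (c0 := (lstate N k.-1).1)) //.
  - by rewrite -surjective_pairing -lstateS prednK //; lia.
  - exact: (lstate_invol _ vN).1.
  - by rewrite (sig_Ic_x vN vM' hc) /c cornerE.
rewrite addSn lstateS IH; last lia.
rewrite (lstep_Ic_old vN vM' hc (c0 := (lstate N j).1)) //.
- exact: (lstate_invol _ vN).1.
- rewrite (sig_Ic_old vN vM' hc) //; first exact: (lstate_invol j vN).1.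
  by have := @cor_c j.+1; rewrite cornerE; apply; rewrite /m; lia.
Qed.

Lemma corner_I_low j : 0 < j <= k -> corner M j = corner N j.
Proof. by move=> hj; rewrite !cornerE lstate_I_low //; lia. Qed.

Lemma corner_I_mid i : 0 < i <= m' -> corner M (k + i) = corner M' i + m.
Proof.
move=> hi; rewrite !cornerE.
have -> : (k + i).-1 = k + i.-1 by lia.
by rewrite lstate_I_mid //; lia.
Qed.

Lemma corner_I_x : corner M (k + m').+1 = x.
Proof. by rewrite cornerE succnK lstate_I_x. Qed.

Lemma corner_I_high j : k < j <= m -> corner M (j + m').+1 = corner N j.
Proof.
move=> hj; rewrite cornerE [RHS]cornerE succnK.
have -> : j + m' = (j.-1 + m').+1 by lia.
by rewrite lstate_I_high //; lia.
Qed.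

Lemma good_corners_I : good_corners M.
Proof.
have mM : mh M = x.+1 by [].
have [g1 g2] := gN; have [g1' g2'] := gM'.
split; rewrite mM.
  move=> h hh; case: (Ic_cases vN vM' hc hh) => [e|[hm _]|->|[h' h1 ->]].
  - by exists k; [rewrite /x /m; lia|rewrite corner_I_low // /m; lia].
  - have [j hj <-] := g1 _ hm; have [jk|jk] := leqP j k.
      by exists j; [rewrite /x /m; lia|rewrite corner_I_low // /m; lia].
    by exists (j + m').+1; [rewrite /x /m; lia|rewrite corner_I_high // /m; lia].
  - by exists (k + m').+1; [rewrite /x /m; lia|rewrite corner_I_x].
  - have [i hi <-] := g1' _ h1.
    by exists (k + i); [rewrite /x /m /m'; lia|rewrite corner_I_mid].
have [km|km] := eqVneq k m.
  by rewrite /x -{1}km corner_I_x (sig_Ic_x vN vM' hc) /c km.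
rewrite /x corner_I_high; last by rewrite /m; lia.
rewrite (sig_Ic_old vN vM' hc) //; first exact: corner_lt.
by apply: cor_c; rewrite /m; lia.
Qed.

End InsertionCorners.

(** * Root decomposition of maps *)

Section UnrootLast.
Variables (M : rmap) (m : nat).
Hypotheses (vM : valid_map M) (mM : mh M = m.+2).
Hypotheses (sr : sig M (mroot M) = m) (am : alp M m = m.+1).
Hypothesis nb : ~ fbridge (sig M) (alp M) m.
Let r := mroot M.

(** The root edge is already numbered [m], [m.+1], as in the image of [mapRc], so the isomorphism is
    the identity and only [N] and the corner [c] must be found. *)
Lemma unroot_last : exists N c, [/\ valid_map N, c < mh N & map_iso M (mapRc c N)].
Proof.
have rl : r < m.+2 by rewrite -mM; apply: mroot_lt.
have ml : m < mh M by rewrite mM.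
have am1 : alp M m.+1 = m by rewrite -am alpK.
have rm : r < m.
  have ar : alp M r = r by apply: alp_root.
  have : r <> m by move=> e; rewrite e am in ar; lia.
  have : r <> m.+1 by move=> e; rewrite e am1 in ar; lia.
  by lia.
have sl h : h < m.+2 -> sig M h < m.+2 by rewrite -mM; apply: sig_lt.
have al h : h < m.+2 -> alp M h < m.+2 by rewrite -mM; apply: alp_lt.
have si h1 h2 : h1 < m.+2 -> h2 < m.+2 -> sig M h1 = sig M h2 -> h1 = h2 by rewrite -mM; apply: sig_inj.
have aK h : h < m.+2 -> alp M (alp M h) = h by rewrite -mM; apply: alpK.
(* This detour around the root edge, available because it is no bridge, is what keeps [N]
   connected. *)
have fr : freach (sig M) (alp M) m m m.+1.
  by apply: NNPP => h; apply: nb; split; rewrite am //; lia.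
have [p pl sp] : exists2 p, p < m.+2 & sig M p = m.+1.
  by rewrite -mM; apply: sig_pred => //; rewrite mM.
(* A half-edge that is alone at its vertex can be entered only through its own edge, against
   [fr]. *)
have pm1 : p <> m.+1.
  move=> e; suff : m.+1 < m.+2 /\ m.+1 <> m.+1 by lia.
  apply: (freach_inv (P := fun y => y < m.+2 /\ y <> m.+1) _ _ _ fr); last by lia.
  - move=> y [yl ym]; split; first exact: sl.
    by move=> ey; apply: ym; rewrite -e; apply: si => //; rewrite ey.
  - move=> y [yl ym] y1 _; split; first exact: al.
    by move=> ey; apply: y1; rewrite -am1 -ey aK.
have pr : p <> r by move=> e; rewrite e sr in sp; lia.
have sm h : h < m.+2 -> sig M h = m -> h = r by move=> hl e; apply: si; rewrite // e sr.
have sm1 h : h < m.+2 -> sig M h = m.+1 -> h = p by move=> hl e; apply: si; rewrite // e sp.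
have alm h : h < m -> alp M h < m.
  move=> hl; have hl2 : h < m.+2 by lia.
  have := al _ hl2; have : alp M h <> m by move=> e; have := aK _ hl2; rewrite e am; lia.
  by have : alp M h <> m.+1 by [move=> e; have := aK _ hl2; rewrite e am1; lia]; lia.
(* The far end sits in the corner of its predecessor; if that is [m], both ends lie in the root
   corner. *)
pose c := if p == m then r else p.
have cl : c < m by rewrite /c; case: ifP; lia.
pose sN h := if h == r then (if p == m then sig M m.+1 else sig M m)
             else if h == p then sig M m.+1 else sig M h.
have slb h : h < m.+2 -> h <> r -> h <> p -> sig M h < m.
  by move=> hl h1 h2; have := sl _ hl; have := sm _ hl; have := sm1 _ hl; lia.
have sNl h : h < m -> sN h < m.
  by move=> hl; rewrite /sN; ifs; apply: slb; lia.
pose N := RMap m (mkseq sN m) (mkseq (alp M) m) r.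
have es h : h < m -> sig N h = sN h by move=> hl; rewrite /sig nth_mkseq.
have ea h : h < m -> alp N h = alp M h by move=> hl; rewrite /alp nth_mkseq.
have vN : valid_map N.
  split; split; rewrite ?size_mkseq //=.
  - by move=> h hl; rewrite es // ea //; split; [apply: sNl|apply: alm].
  - move=> h1 h2 hl1 hl2; rewrite !es // /sN.
    ifs => // /si; lia.
  - move=> h hl; rewrite ea // ea ?alm // aK; last lia.
    split=> //; split; first by apply: alp_fix; rewrite // mM; lia.
    by move=> ->; apply: alp_root.
  (* Connectivity of [N]: the root edge is first replaced by the detour [fr], then the path is
     retracted to [N] by [rho]. *)
  - have H y : mreach M y -> freach (sig M) (alp M) m r y.
      have h1 : freach (sig M) (alp M) m r m by apply: fr_sig'; rewrite sr.
      have h2 := freach_trans h1 fr.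
      elim=> [|z _ IH|z _ IH]; [exact: fr_refl|exact: fr_sig|].
      have [->|/eqP z1] := eqVneq z m; first by rewrite am.
      have [->|/eqP z2] := eqVneq z m.+1; first by rewrite am1.
      by apply: fr_alp; rewrite ?am.
    pose rho y := if y < m then y else if y == m then r else c.
    have rhos y : y < m.+2 -> rho (sig M y) = rho y \/ rho (sig M y) = sig N (rho y).
      move=> yl; have rho_m : rho m = r by rewrite /rho ltnn eqxx.
      have rho_m1 : rho m.+1 = c by rewrite /rho; decide_ifs.
      have rho_l z : z < m -> rho z = z by rewrite /rho => ->.
      have [->|/eqP y1] := eqVneq y r; first by rewrite sr rho_m rho_l //; left.
      have [->|/eqP y2] := eqVneq y m.
        rewrite rho_m; have [e|/eqP e] := eqVneq p m.
          by rewrite -{1}e sp rho_m1 /c e eqxx; left.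
        rewrite rho_l; last by apply: slb; lia.
        by rewrite es // /sN eqxx; right; case: eqP.
      have [->|/eqP y3] := eqVneq y m.+1.
        rewrite rho_m1 rho_l; last by apply: slb; lia.
        right; rewrite es // /sN /c; case: (p =P m) => [e|e]; first by rewrite eqxx.
        by rewrite eqxx; case: eqP.
      have [y4|/eqP y4] := eqVneq y p.
        rewrite y4 sp rho_m1 rho_l; last by lia.
        by left; rewrite /c; case: eqP; lia.
      rewrite !rho_l; try lia; last by apply: slb.
      by right; rewrite es; [rewrite /sN; do 2 case: eqP => //|lia].
    move=> h hl.
    have /H : mreach M h by apply: valid_mreach; rewrite // mM; lia.
    suff G y : freach (sig M) (alp M) m r y -> y < m.+2 /\ mreach N (rho y).
      by move=> /G[_]; rewrite /rho hl.
    elim=> [|z _ [zl IH]|z _ [zl IH] z1 z2].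
    + by split=> //; rewrite /rho rm; apply: mr_root.
    + split; first exact: sl.
      by case: (rhos _ zl) => ->; [|apply: mr_sig].
    + have zm : z < m by rewrite am in z2; lia.
      have az := alm _ zm; split; first by lia.
      by apply: (mr_alp' IH); rewrite /rho zm az ea.
exists N, c; split=> //; split=> //; exists id; split=> //= h.
- by rewrite mM.
- rewrite mM => hl; case: (Rc_cases vN cl hl) => [->|->|->|[[-> cr]|[h1 h2 h3]]].
  + by rewrite (sig_Rc_root _ vN).
  + rewrite (sig_Rc_a _ vN) /c -[mh N]/m -[mroot N]/r; have [e|/eqP e] := eqVneq p m.
      by rewrite eqxx -{1}e sp.
    by case: eqP => // _; rewrite es // /sN eqxx; case: eqP.
  + rewrite (sig_Rc_b vN cl) es // /sN /c; case: (p =P m) => e; first by rewrite eqxx.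
    by rewrite eqxx; case: eqP.
  + rewrite (sig_Rc_c vN cl cr) /c; move: cr; rewrite /c; case: ifP => [_ /(_ erefl)//|_ _].
    by rewrite sp.
  + rewrite (sig_Rc_old vN cl h1 h2 h3) es // /sN; case: eqP => // _; case: eqP => // hp.
    have h1' : h < m by [].
    by case: h3; rewrite /c hp; case: eqP => //; lia.
- rewrite mM => hl; have [h1|h1] := ltnP h m; first by rewrite (alp_Rc_old vN cl) // ea.
  have [->|h2] := eqVneq h m; first by rewrite (alp_Rc_a c N) am.
  have -> : h = m.+1 by lia.
  by rewrite (alp_Rc_b vN cl) am1.
Qed.

End UnrootLast.

Lemma unroot M : valid_map M -> sig M (mroot M) <> mroot M ->
  ~ fbridge (sig M) (alp M) (sig M (mroot M)) ->
  exists N c, [/\ valid_map N, c < mh N & map_iso M (mapRc c N)].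
Proof.
move=> v sr nb; set a := sig M (mroot M) in sr nb.
have al : a < mh M by apply/sig_lt/mroot_lt.
pose b := alp M a; have bl : b < mh M by apply: alp_lt.
have ab : a <> b by move=> e; apply: sr; apply: alp_fix.
pose L1 := [seq h <- iota 0 (mh M) | (h != a) && (h != b)].
pose L := L1 ++ [:: a; b].
have pL : perm_eq L (iota 0 (mh M)).
  apply: uniq_perm; rewrite ?iota_uniq //.
    rewrite cat_uniq filter_uniq ?iota_uniq //= !mem_filter !eqxx !inE ?andbF /= andbT.
    by case: eqP.
  move=> h; rewrite mem_cat mem_filter mem_iota !inE.
  by lia.
have [M2 [v2 iso e2 hby]] := relabel v pL; have [f1 f2 f3 f4 f5] := hby.
pose m := size L1.
have em : mh M = m.+2 by rewrite -(size_iota 0 (mh M)) -(perm_size pL) size_cat /= addn2.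
have fm : nth 0 L m = a by rewrite nth_cat ltnn subnn.
have fm1 : nth 0 L m.+1 = b by rewrite nth_cat ltnNge leqnSn /= subSnn.
have rl := mroot_lt v2.
have s2 : sig M2 (mroot M2) = m.
  by apply: f2; [apply: sig_lt|rewrite e2 em|rewrite f3 // f5 fm].
have a2 : alp M2 m = m.+1.
  by apply: f2; [apply: alp_lt|rewrite e2 em|rewrite f4 ?fm ?fm1 // e2 em]; rewrite // e2 em.
have nb2 : ~ fbridge (sig M2) (alp M2) m.
  move/fbridgeP; rewrite (map_iso_fbridge (a2 := alp M) v2 v e2 hby) //.
  - by rewrite fm => /fbridgeP.
  - by rewrite e2 em.
  - exact: alp_lt.
have [N [c [vN cl isoN]]] := unroot_last v2 (etrans e2 em) s2 a2 nb2.
by exists N, c; split=> //; apply: map_iso_trans isoN.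
Qed.

Section UninsertLast.
Variables (M : rmap) (m m' y : nat).
Let x := m + m'.
Let B h := (h < m) || (h == x).
Hypotheses (vM : valid_map M) (mM : mh M = x.+1) (Br : B (mroot M)).
Hypotheses (ax : alp M x = y) (By : ~~ B y).
Hypothesis Bs : forall h, h < mh M -> B (sig M h) = B h.
Hypothesis Ba : forall h, h < mh M -> h <> x -> h <> y -> B (alp M h) = B h.
Hypothesis cr : forall h, h < mh M -> B h -> freach (sig M) (alp M) x (mroot M) h.
Hypothesis cy : forall h, h < mh M -> ~~ B h -> freach (sig M) (alp M) x y h.
Let r := mroot M.

(** [B] is the root side of the bridge: the half-edges below [m] form [N], and [x] is the half-edge
    that insertion adds to it. The others, lowered by [m], form [M']. The last clause keeps track of
    a bridge at the root, which must come from the root corner. *)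
Lemma uninsert_last : exists N M' c, [/\ valid_map N, valid_map M', c < mh N,
  map_iso M (mapInsc M' c N) & sig M (mroot M) = x -> c = mroot N].
Proof.
have xl : x < mh M by rewrite mM.
have rl : r < x.+1 by rewrite -mM; apply: mroot_lt.
have yl : y < x.+1 by rewrite -mM -ax; apply: alp_lt.
have ay : alp M y = x by rewrite -ax alpK.
have xm : m <= x by rewrite /x; lia.
have rx : r <> x.
  move=> e; have ar : alp M r = r by apply: alp_root.
  by move: By; rewrite -ax -e ar; rewrite /r in e *; rewrite Br.
have rm : r < m by move: Br; rewrite /B -/r; lia.
have yb : m <= y < x by move: By; rewrite /B; lia.
have sl h : h < x.+1 -> sig M h < x.+1 by rewrite -mM; apply: sig_lt.
have al h : h < x.+1 -> alp M h < x.+1 by rewrite -mM; apply: alp_lt.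
have si h1 h2 : h1 < x.+1 -> h2 < x.+1 -> sig M h1 = sig M h2 -> h1 = h2 by rewrite -mM; apply: sig_inj.
have aK h : h < x.+1 -> alp M (alp M h) = h by rewrite -mM; apply: alpK.
have [p pl sp] : exists2 p, p < x.+1 & sig M p = x by rewrite -mM; apply: sig_pred.
have Bx : B x by rewrite /B eqxx orbT.
have Bp : B p by rewrite -Bs ?mM // sp.
(* [x] is reached from the root without its edge, so it is not alone at its vertex and deleting it
   leaves a corner. *)
have px : p <> x.
  move=> e; suff : x < x.+1 /\ x <> x by lia.
  apply: (freach_inv (P := fun y => y < x.+1 /\ y <> x) _ _ _ (cr xl Bx)); last by [].
  - move=> z [zl zx]; split; first exact: sl.
    by move=> ez; apply: zx; rewrite -e; apply: si => //; rewrite ez.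
  - move=> z [zl zx] z1 z2; split; first exact: al.
    by move=> ez; apply: z2; rewrite -ez aK.
have pm : p < m by move: Bp; rewrite /B; lia.
have sx h : h < x.+1 -> sig M h = x -> h = p by move=> hl e; apply: si; rewrite // e sp.
have sb h : h < x.+1 -> h <> p -> B h -> sig M h < m.
  by move=> hl h1; rewrite -Bs ?mM // /B; have := sx _ hl; lia.
have sb' h : m <= h < x -> m <= sig M h < x.
  move=> hl; have hl' : h < x.+1 by lia.
  by have := Bs; rewrite mM => /(_ _ hl'); have := sl _ hl'; rewrite /B; lia.
have ab h : h < m -> alp M h < m.
  move=> hl; have hl' : h < x.+1 by lia.
  have := Ba; rewrite mM => /(_ _ hl'); rewrite /B hl /=.
  have : alp M h <> x by move=> e; have := aK _ hl'; rewrite e ax; lia.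
  by lia.
have ab' h : m <= h < x -> h <> y -> m <= alp M h < x.
  move=> hl hy; have hl' : h < x.+1 by lia.
  by have := Ba; rewrite mM => /(_ _ hl'); have := al _ hl'; rewrite /B; lia.
pose sN h := if h == p then sig M x else sig M h.
pose N := RMap m (mkseq sN m) (mkseq (alp M) m) r.
have sNE h : h < m -> sig N h = sN h by move=> hl; rewrite /sig nth_mkseq.
have aNE h : h < m -> alp N h = alp M h by move=> hl; rewrite /alp nth_mkseq.
have Bl h : h < m -> B h by rewrite /B => ->.
have sNl h : h < m -> sN h < m.
  move=> hl; rewrite /sN; case: eqP => e; apply: sb => //; try lia; exact: Bl.
have vN : valid_map N.
  split; split; rewrite ?size_mkseq //=.
  - by move=> h hl; rewrite sNE // aNE //; split; [apply: sNl|apply: ab].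
  - move=> h1 h2 hl1 hl2; rewrite !sNE // /sN.
    by ifs => // /si; lia.
  - move=> h hl; rewrite aNE // aNE ?ab // aK; last lia.
    split=> //; split; first by apply: alp_fix; rewrite // mM; lia.
    by move=> ->; apply: alp_root.
  - pose rho z := if z < m then z else p.
    have G u : freach (sig M) (alp M) x r u -> [/\ u < x.+1, B u & mreach N (rho u)].
      elim=> [|z _ [zl Bz IH]|z _ [zl Bz IH] z1 z2].
      + by split=> //; rewrite /rho rm; apply: mr_root.
      + split; [exact: sl|by rewrite Bs ?mM|].
        have [zp|/eqP zp] := eqVneq z p.
          rewrite zp sp; have -> : rho x = p by rewrite /rho; decide_ifs.
          by move: IH; rewrite zp /rho pm.
        have sz := sb _ zl zp Bz; rewrite /rho sz.
        apply: (mr_sig' IH); rewrite /rho; case: ifP => zm.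
          by rewrite sNE // /sN; case: eqP.
        have -> : z = x by move: Bz; rewrite /B; lia.
        by rewrite sNE // /sN eqxx.
      + have zm : z < m by move: Bz; rewrite /B; lia.
        split; [exact: al|by rewrite Ba ?mM // -ax|].
        by apply: (mr_alp' IH); rewrite /rho zm ab // aNE.
    move=> h hl; have /G[_ _] := cr (h := h) ltac:(rewrite mM; lia) (Bl _ hl).
    by rewrite /rho hl.
pose sM' h := sig M (h + m) - m.
(* The end [y] of the bridge becomes the root of [M'], hence a fixed point. *)
pose aM' h := if h + m == y then h else alp M (h + m) - m.
pose M' := RMap m' (mkseq sM' m') (mkseq aM' m') (y - m).
have sME h : h < m' -> sig M' h = sM' h by move=> hl; rewrite /sig nth_mkseq.
have aME h : h < m' -> alp M' h = aM' h by move=> hl; rewrite /alp nth_mkseq.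
have ny h : m <= h < x -> alp M h <> y.
  by move=> hl e; have hl' : h < x.+1 by [lia]; have := aK _ hl'; rewrite e ay; lia.
have vM' : valid_map M'.
  split; split; rewrite ?size_mkseq //=.
  - by rewrite /x in yb; lia.
  - move=> h hl; have hm : m <= h + m < x by rewrite /x; lia.
    rewrite sME // aME // /sM' /aM'; have := sb' _ hm; have := ab' _ hm; rewrite /x in hm *.
    by split; [lia|case: eqP; lia].
  - move=> h1 h2 hl1 hl2; rewrite !sME // /sM' => e.
    have hm1 : m <= h1 + m < x by rewrite /x; lia.
    have hm2 : m <= h2 + m < x by rewrite /x; lia.
    have := si (h1 + m) (h2 + m); have := sb' _ hm1; have := sb' _ hm2; lia.
  - move=> h hl; have hm : m <= h + m < x by rewrite /x; lia.
    have hx : h + m < x.+1 by lia.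
    rewrite (aME h) //; have [hy|/eqP hy] := eqVneq (h + m) y.
      have e : aM' h = h by rewrite /aM' hy eqxx.
      by rewrite e aME // e; split=> //; split=> // _; lia.
    have e : aM' h = alp M (h + m) - m by rewrite /aM'; case: eqP.
    have h1 := ab' _ hm hy; rewrite e aME; last by rewrite /x in h1; lia.
    rewrite /aM'; have -> : alp M (h + m) - m + m = alp M (h + m) by lia.
    have /eqP/negbTE -> := ny _ hm; rewrite aK // addnK; split=> //; split; last by lia.
    move=> e'; exfalso; have e2 : alp M (h + m) = h + m by lia.
    have hlM : h + m < mh M by rewrite mM.
    by have := alp_fix vM hlM e2; rewrite -/r; lia.
  - have G u : freach (sig M) (alp M) x y u -> m <= u < x /\ mreach M' (u - m).
      elim=> [|z _ [zl IH]|z _ [zl IH] z1 z2].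
      + by split=> //; apply: mr_root.
      + split; first exact: sb'.
        apply: (mr_sig' IH); rewrite sME; last by rewrite /x in zl; lia.
        by rewrite /sM'; have -> : z - m + m = z by lia.
      + rewrite ax in z2; split; first exact: ab'.
        apply: (mr_alp' IH); rewrite aME; last by rewrite /x in zl; lia.
        rewrite /aM'; have -> : z - m + m = z by lia.
        by case: eqP.
    move=> h hl; have hm : m <= h + m < x by rewrite /x; lia.
    have nB : ~~ B (h + m) by rewrite /B; lia.
    by have /G[_] := cy (h := h + m) ltac:(rewrite mM; lia) nB; rewrite addnK.
exists N, M', p; split=> //; last by move=> e; rewrite /= -/r; apply: esym; apply: sx.
split; first by rewrite mM.
exists id; split=> //= h; first by rewrite mM.
- rewrite mM => hl; case: (Ic_cases vN vM' pm hl) => [->|[h1 h2]|->|[h' h1 ->]].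
  + by rewrite (sig_Ic_c vN vM' pm) sp.
  + by rewrite (sig_Ic_old vN vM' pm) // sNE // /sN; case: eqP.
  + by rewrite (sig_Ic_x vN vM' pm) sNE // /sN eqxx.
  + rewrite (sig_Ic_new vN vM' pm) // sME // /sM'.
    have h1' : h' < m' by [].
    have hm : m <= h' + m < x by rewrite /x; lia.
    by have /andP[h2 _] := sb' _ hm; rewrite -[mh N]/m subnK.
- rewrite mM => hl; case: (Ic_cases vN vM' pm hl) => [->|[h1 h2]|->|[h' h1 ->]].
  + by rewrite (alp_Ic_old vN vM' pm) // aNE.
  + by rewrite (alp_Ic_old vN vM' pm) // aNE.
  + by rewrite (alp_Ic_x vN vM' pm) -[mh N]/m -[mh M']/m' -/x ax /=; lia.
  + have h1' : h' < m' by [].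
    have hm : m <= h' + m < x by rewrite /x; lia.
    have [e|/eqP h2] := eqVneq h' (y - m).
      rewrite e (alp_Ic_root vN vM' pm) -[mh N]/m -[mh M']/m' -/x /=.
      by have -> : y - m + m = y by lia.
    have hy : h' + m <> y by lia.
    rewrite (alp_Ic_new vN vM' pm) // aME // /aM'; rewrite -[mh N]/m.
    by move/eqP/negbTE: (hy) => ->; have /andP[h3 _] := ab' _ hm hy; rewrite subnK.
Qed.

End UninsertLast.

(** If neither end of the bridge were reached from the root without it, deleting it would not affect
    the component of the root, which is the whole map. Both ends cannot be reached either, since
    this would join them. *)
Lemma bridge_root_side M h : valid_map M -> h < mh M -> fbridge (sig M) (alp M) h ->
  exists x, [/\ x = h \/ x = alp M h, freach (sig M) (alp M) x (mroot M) x
    & ~ freach (sig M) (alp M) x (mroot M) (alp M x)].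
Proof.
move=> v hl [ah nr]; have al := alp_lt v hl; have rl := mroot_lt v.
set r := mroot M in rl *; pose A := freach (sig M) (alp M) h r.
have [Ah|nAh] := classic (A h).
  exists h; split=> //; first by left.
  move=> Aa; apply: nr; apply: freach_trans Aa.
  exact: freach_sym.
have Aa : A (alp M h).
  apply: NNPP => nAa; apply: (nAh).
  have : mreach M h by apply: valid_mreach.
  elim=> [|z _ IH|z _ IH]; [exact: fr_refl|exact: fr_sig|].
  by apply: fr_alp => // e; [apply: nAh|apply: nAa]; rewrite -e.
exists (alp M h); split; first by right.
- exact: freach_swap.
- rewrite alpK // => H; apply: nAh; rewrite /A -{1}(alpK v hl).
  exact: freach_swap.
Qed.

Lemma uninsert M h : valid_map M -> h < mh M -> fbridge (sig M) (alp M) h ->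
  exists N M' c, [/\ valid_map N, valid_map M', c < mh N,
    map_iso M (mapInsc M' c N) & h = sig M (mroot M) -> c = mroot N].
Proof.
move=> v hl hb; have [x [hx Ax nAy]] := bridge_root_side v hl hb.
have rl := mroot_lt v; set r := mroot M in rl Ax nAy *.
have xl : x < mh M by case: hx => ->; rewrite ?alp_lt.
pose y := alp M x; have yl : y < mh M by apply: alp_lt.
pose A z := freach (sig M) (alp M) x r z.
pose Ab z : bool := if excluded_middle_informative (A z) then true else false.
have AP z : reflect (A z) (Ab z) by rewrite /Ab; case: excluded_middle_informative; constructor.
have Abx : Ab x by apply/AP.
have Aby : ~~ Ab y by apply/AP.
have Abs z : z < mh M -> Ab (sig M z) = Ab z.
  move=> zl; apply/AP/AP => Az; last exact: fr_sig.
  by apply: freach_trans Az _; apply: freach_sym => //; apply: fr_sig'.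
have Aba z : z < mh M -> z <> x -> z <> y -> Ab (alp M z) = Ab z.
  move=> zl z1 z2; apply/AP/AP => Az; last exact: fr_alp.
  by apply: freach_trans Az _; apply: freach_sym => //; apply: fr_alp'.
have cy z : z < mh M -> ~~ Ab z -> freach (sig M) (alp M) x y z.
  move=> zl; suff : Ab z \/ freach (sig M) (alp M) x y z by case=> [->|].
  have : mreach M z by apply: valid_mreach.
  elim=> [|u _ IH|u _ IH].
  - by left; apply/AP; apply: fr_refl.
  - by case: IH => IH; [left; apply/AP; apply: fr_sig; apply/AP|right; apply: fr_sig].
  - have [->|/eqP u1] := eqVneq u x; first by right; apply: fr_refl.
    have [->|/eqP u2] := eqVneq u y; first by left; rewrite /y alpK.
    by case: IH => IH; [left; apply/AP; apply: fr_alp => //; apply/AP|right; apply: fr_alp].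
pose L1 := [seq z <- iota 0 (mh M) | Ab z && (z != x)].
pose L2 := [seq z <- iota 0 (mh M) | ~~ Ab z].
(* The numbering of [mapInsc]: root side without [x], then the far side, then [x]. *)
pose L := L1 ++ L2 ++ [:: x].
have mL z : (z \in L) = (z < mh M).
  rewrite !mem_cat !mem_filter mem_iota inE.
  by have [->|h1] := eqVneq z x; case: (Ab z) => //=; rewrite ?Abx ?xl ?orbT ?orbF ?andbT //; lia.
have pL : perm_eq L (iota 0 (mh M)).
  apply: uniq_perm; rewrite ?iota_uniq //; last by move=> z; rewrite mL mem_iota.
  rewrite cat_uniq filter_uniq ?iota_uniq // cat_uniq filter_uniq ?iota_uniq //= has_cat /= !mem_filter.
  rewrite eqxx andbF Abx /= !orbF !andbT; apply/hasPn => z; rewrite !mem_filter.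
  by case: (Ab z).
have [M2 [v2 iso e2 hby]] := relabel v pL; have [f1 f2 f3 f4 f5] := hby.
pose m := size L1; pose m' := size L2.
have em : mh M = (m + m').+1.
  by rewrite -(size_iota 0 (mh M)) -(perm_size pL) !size_cat /= addn1 addnS.
have fx : nth 0 L (m + m') = x.
  by rewrite !nth_cat; rewrite -/m -/m'; decide_ifs; rewrite -[X in nth _ _ X]/(_ - _) addKn subnn.
have BP z : z < mh M2 -> ((z < m) || (z == m + m')) = Ab (nth 0 L z).
  rewrite e2 em => zl; have [->|z1] := eqVneq z (m + m'); first by rewrite fx Abx orbT.
  rewrite orbF !nth_cat -/m -/m'; case: ltnP => zm.
    have : nth 0 L1 z \in L1 by apply: mem_nth.
    by rewrite mem_filter => /andP[/andP[-> _] _].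
  have -> : (z - m < m') by lia.
  have : nth 0 L2 (z - m) \in L2 by apply: mem_nth; rewrite -/m'; lia.
  by rewrite mem_filter => /andP[/negbTE ->].
have x2l : m + m' < mh M2 by rewrite e2 em.
pose y2 := alp M2 (m + m'); have y2l : y2 < mh M2 by apply: alp_lt.
have fy : nth 0 L y2 = y by rewrite f4 // fx.
have [g [hg fg]] := map_iso_inv v2 e2 hby.
have [g1 g2 g3 g4 g5] := hg.
have gx : g x = m + m' by rewrite -fx; apply fg; rewrite -e2.
have gy : g y = y2 by rewrite -fy; apply fg; rewrite -e2.
have tr z u : z < mh M -> u < mh M2 -> freach (sig M) (alp M) x z (nth 0 L u) ->
    freach (sig M2) (alp M2) (m + m') (g z) u.
  move=> zl ul hf; rewrite -gx.
  have -> : u = g (nth 0 L u) by apply: esym; apply fg; rewrite -e2.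
  by apply: (map_iso_freach v hg xl _ _ zl hf) => // ?; apply: alp_lt.
have rl2 := mroot_lt v2.
have [N [M' [c [vN vM' cl isoN hcr]]]] : exists N M' c, [/\ valid_map N, valid_map M', c < mh N,
  map_iso M2 (mapInsc M' c N) & sig M2 (mroot M2) = m + m' -> c = mroot N].
  apply: (@uninsert_last M2 m m' y2) => //.
  - by rewrite e2 em.
  - by rewrite BP // f5; apply/AP; apply: fr_refl.
  - by rewrite BP // fy.
  - by move=> z zl; rewrite !BP ?sig_lt // f3 // Abs //; apply: f1.
  - move=> z zl z1 z2; rewrite !BP ?alp_lt // f4 // Aba // ?f1 //.
      by rewrite -fx => /f2 e; apply: z1; apply: e.
    by rewrite -fy => /f2 e; apply: z2; apply: e.
  - by move=> z zl; rewrite BP // => /AP Az; rewrite -g5; apply: tr.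
  - by move=> z zl; rewrite BP // => nAz; rewrite -gy; apply: (tr _ _ yl zl); apply: cy (f1 _ zl) nAz.
exists N, M', c; split=> //; first exact: map_iso_trans isoN.
(* The successor of the root lies on the root side, so [h] is the end named [x] and not its
   partner. *)
move=> eh; apply: hcr; apply: f2 => //; first exact: sig_lt.
rewrite f3 // f5 fx -/r -eh; case: hx => // ex; exfalso.
move: Aby; rewrite /y ex alpK // eh Abs //.
by move/AP; case; apply: fr_refl.
Qed.

Lemma trivial_root M : valid_map M -> sig M (mroot M) = mroot M -> mh M = 1.
Proof.
move=> v sr; have H y : mreach M y -> y = mroot M.
  by elim=> // [z _ ->|z _ ->]; rewrite ?sr // alp_root.
have rl := mroot_lt v.
have e0 := H _ (valid_mreach v (h := 0) ltac:(lia)).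
have e1 := H _ (valid_mreach v (h := (mh M).-1) ltac:(lia)).
by lia.
Qed.

Lemma good_corners_iso M1 M2 : valid_map M1 -> valid_map M2 -> map_iso M1 M2 ->
  good_corners M1 -> good_corners M2.
Proof.
move=> v1 v2 [e [f hf]] [g1 g2]; have [f1 f2 f3 f4 f5] := hf.
have [g [hg fg]] := map_iso_inv v1 e hf; have [gl _ _ _ _] := hg.
split=> [h hl|].
  have [k hk ek] := g1 _ (gl _ hl); exists k; first by rewrite -e.
  by rewrite -(corner_iso k v1 v2 e hf) ek; apply fg.
by rewrite -(corner_iso _ v1 v2 e hf) -f3 ?corner_lt // -e g2.
Qed.

Lemma valid_good_corners M : valid_map M -> good_corners M.
Proof.
have [n] := ubnP (mh M); elim: n M => // n IH M hn v.
have [sr|/eqP sr] := eqVneq (sig M (mroot M)) (mroot M).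
  have e1 := trivial_root v sr; have := mroot_lt v; rewrite e1 => rl.
  split=> [h|]; rewrite e1; last by rewrite corner1.
  by move=> hl; exists 1 => //; rewrite corner1; lia.
have sl : sig M (mroot M) < mh M by apply/sig_lt/mroot_lt.
have [hb|hb] := classic (fbridge (sig M) (alp M) (sig M (mroot M))).
  have [N [M' [c [vN vM' cl iso /(_ erefl) ec]]]] := uninsert v sl hb.
  have e := proj1 iso; rewrite /= in e.
  have [ml mnl] : mh N < n /\ mh M' < n by lia.
  have gN := IH _ ml vN; have gM' := IH _ mnl vM'.
  have rN := mroot_lt vN.
  rewrite ec -(corner1 N) -mapInsE in iso.
  apply: (good_corners_iso _ v (map_iso_sym v iso)).
    by rewrite mapInsE corner1; apply: valid_mapInsc.
  by apply: good_corners_I => //; lia.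
have [N [c [vN cl iso]]] := unroot v sr hb.
have e := proj1 iso; rewrite /= in e.
have gN : good_corners N by apply: IH => //; lia.
(* The corner found by [unroot] receives its label from the induction hypothesis for [N]. In the
   bridge case above no such search arises, the corner being the root corner. *)
have [k hk ek] := proj1 gN _ cl.
rewrite -ek -mapRE in iso.
apply: (good_corners_iso _ v (map_iso_sym v iso)).
  by rewrite mapRE; apply: valid_mapRc; rewrite ?ek.
exact: good_corners_R.
Qed.

Lemma valid_mapR k N : valid_map N -> valid_map (mapR k N).
Proof. by move=> v; rewrite mapRE; apply: valid_mapRc => //; apply: corner_lt. Qed.

Lemma valid_mapIns M' k N : valid_map M' -> valid_map N -> valid_map (mapIns M' k N).
Proof. by move=> v' v; rewrite mapInsE; apply: valid_mapInsc => //; apply: corner_lt. Qed.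

Lemma corner_onto N c : valid_map N -> c < mh N -> exists2 k, 0 < k <= mh N & corner N k = c.
Proof. by move=> v; apply: (proj1 (valid_good_corners v)). Qed.

Lemma bridge_mapIns M h : valid_map M -> h < mh M -> fbridge (sig M) (alp M) h ->
  exists N M' k, [/\ valid_map N, valid_map M', 0 < k <= mh N,
    map_iso M (mapIns M' k N) & h = sig M (mroot M) -> k = 1].
Proof.
move=> v hl hb; have [N [M' [c [vN vM' cl iso ec]]]] := uninsert v hl hb.
have [k hk ek] := corner_onto vN cl.
exists N, M', k; split=> //; first by rewrite mapInsE ek.
move/ec => e; apply: (corner_inj (valid_good_corners vN)) => //; first by lia.
by rewrite corner1 ek.
Qed.

Lemma map_decomposition M : valid_map M ->
  [\/ map_iso M one_half_edge_map,
      exists Md Mu, [/\ valid_map Md, valid_map Mu & map_iso M (mapIns Md 1 Mu)]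
    | exists k N, [/\ valid_map N, 0 < k <= mh N & map_iso M (mapR k N)]].
Proof.
move=> v; have [sr|/eqP sr] := eqVneq (sig M (mroot M)) (mroot M).
  have e1 := trivial_root v sr; have := mroot_lt v; rewrite e1 => rl.
  constructor 1; split=> //; exists id; split=> //; rewrite /= ?e1; try lia.
    move=> h hl; have -> : h = mroot M by lia.
    rewrite sr /sig; have -> : mroot M = 0 by lia. by [].
  move=> h hl; have -> : h = mroot M by lia.
  rewrite alp_root // /alp; have -> : mroot M = 0 by lia. by [].
have sl : sig M (mroot M) < mh M by apply/sig_lt/mroot_lt.
have [hb|hb] := classic (fbridge (sig M) (alp M) (sig M (mroot M))).
  have [N [M' [k [vN vM' hk iso /(_ erefl) ek]]]] := bridge_mapIns v sl hb.
  by constructor 2; exists M', N; rewrite -ek.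
have [N [c [vN cl iso]]] := unroot v sr hb.
have [k hk ek] := corner_onto vN cl.
by constructor 3; exists k, N; rewrite mapRE ek.
Qed.

Lemma valid_one_half_edge_map : valid_map one_half_edge_map.
Proof.
split; split=> //.
- by case.
- by case=> // - [].
- by case.
- by case=> // _; apply: mr_root.
Qed.

(** * Commutation of insertions *)

Lemma sig_RcE c N h : h < (mh N).+2 -> sig (mapRc c N) h =
  if h == mroot N then mh N
  else if h == mh N then (if c == mroot N then (mh N).+1 else sig N (mroot N))
  else if h == (mh N).+1 then (if c == mroot N then sig N (mroot N) else sig N c)
  else if h == c then (mh N).+1 else sig N h.
Proof. by move=> hl; rewrite /sig nth_mkseq. Qed.

Lemma alp_RcE c N h : h < (mh N).+2 -> alp (mapRc c N) h =
  if h == mh N then (mh N).+1 else if h == (mh N).+1 then mh N else alp N h.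
Proof. by move=> hl; rewrite /alp nth_mkseq. Qed.

Lemma sig_IcE M' c N h : h < (mh N + mh M').+1 -> sig (mapInsc M' c N) h =
  if h < mh N then (if h == c then mh N + mh M' else sig N h)
  else if h < mh N + mh M' then sig M' (h - mh N) + mh N else sig N c.
Proof. by move=> hl; rewrite /sig nth_mkseq. Qed.

Lemma alp_IcE M' c N h : h < (mh N + mh M').+1 -> alp (mapInsc M' c N) h =
  if h < mh N then alp N h
  else if h < mh N + mh M' then
    (if h - mh N == mroot M' then mh N + mh M' else alp M' (h - mh N) + mh N)
  else mroot M' + mh N.
Proof. by move=> hl; rewrite /alp nth_mkseq. Qed.

Ltac mhsimp := repeat match goal with
  | |- context [mh (mapRc ?c ?N)] => change (mh (mapRc c N)) with (mh N).+2
  | |- context [mh (mapInsc ?M' ?c ?N)] => change (mh (mapInsc M' c N)) with (mh N + mh M').+1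
  | |- context [mroot (mapRc ?c ?N)] => change (mroot (mapRc c N)) with (mroot N)
  | |- context [mroot (mapInsc ?M' ?c ?N)] => change (mroot (mapInsc M' c N)) with (mroot N)
  end.
Ltac expand1 := first
  [ rewrite sig_RcE; last by (mhsimp; lia) | rewrite sig_IcE; last by (mhsimp; lia)
  | rewrite alp_RcE; last by (mhsimp; lia) | rewrite alp_IcE; last by (mhsimp; lia) ].
Ltac expand := repeat (expand1; mhsimp; decide_ifs).

Ltac iso_values f := rewrite ?addnK; try (by rewrite /f; decide_ifs; rewrite ?addnK; lia).
Ltac iso_solve f := expand; subst; iso_values f.

(** In [mapRc d N] the root corner is split, and [M2] takes its second piece, the corner of [mh N].
    If [M2] and the far end of the root edge share a corner of [N], the far end comes after [M2];
    the opposite order is [mapIns_mapR_last_iso]. *)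
Lemma mapIns_mapR_iso M2 c d N : valid_map N -> valid_map M2 -> c < mh N -> d < mh N ->
  map_iso (mapInsc M2 (if c == mroot N then mh N else c) (mapRc d N))
          (mapRc (if c == d then mh N + mh M2 else d) (mapInsc M2 c N)).
Proof.
move=> v v2 cl dl; split; first by mhsimp; lia.
have rl := mroot_lt v; have rl2 := mroot_lt v2.
have slr := sig_lt v rl; have slc := sig_lt v cl; have sld := sig_lt v dl.
(* Both sides have the same half-edges but create them in a different order: on the left the new
   edge precedes [M2], on the right it follows. *)
pose f h := if h < mh N then h else if h < (mh N).+2 then h + mh M2 + 1
  else if h < (mh N).+2 + mh M2 then h - 2 else mh N + mh M2.
have fl h : h < mh N -> f h = h by rewrite /f => ->.
have fa : f (mh N) = (mh N + mh M2).+1 by rewrite /f; decide_ifs; lia.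
have fb : f (mh N).+1 = (mh N + mh M2).+2 by rewrite /f; decide_ifs; lia.
have fx : f ((mh N).+2 + mh M2) = mh N + mh M2 by rewrite /f; decide_ifs.
have fu u : u < mh M2 -> f (u + (mh N).+2) = u + mh N by move=> ul; rewrite /f; decide_ifs; lia.
have cases h : h < ((mh N).+2 + mh M2).+1 -> [\/ h < mh N, h = mh N \/ h = (mh N).+1,
    exists2 u, u < mh M2 & h = u + (mh N).+2 | h = (mh N).+2 + mh M2].
  move=> hl; have [h1|h1] := ltnP h (mh N); first by constructor 1.
  have [h2|h2] := ltnP h (mh N).+2; first by constructor 2; lia.
  have [h3|h3] := ltnP h ((mh N).+2 + mh M2); last by constructor 4; lia.
  by constructor 3; exists (h - (mh N).+2); lia.
exists f; split; mhsimp.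
- by rewrite /f => h hl; ifs; lia.
- by rewrite /f => h1 h2 hl1 hl2; ifs; lia.
- move=> h hl; case: (cases _ hl) => [hm|[->|->]|[u ul ->]|->].
  + have slh := sig_lt v hm; rewrite (fl h) //.
    have [cr|cr] := eqVneq c (mroot N); have [cd|cd] := eqVneq c d; have [dr|dr] := eqVneq d (mroot N);
    have [hr|hr] := eqVneq h (mroot N); have [hc|hc] := eqVneq h c; have [hd|hd] := eqVneq h d;
    try (exfalso; lia); iso_solve f.
  + rewrite fa; have [cr|cr] := eqVneq c (mroot N); have [cd|cd] := eqVneq c d;
    have [dr|dr] := eqVneq d (mroot N); try (exfalso; lia); iso_solve f.
  + rewrite fb; have [cr|cr] := eqVneq c (mroot N); have [cd|cd] := eqVneq c d;
    have [dr|dr] := eqVneq d (mroot N); try (exfalso; lia); iso_solve f.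
  + rewrite fu //; have slu := sig_lt v2 ul.
    have [cr|cr] := eqVneq c (mroot N); have [cd|cd] := eqVneq c d; iso_solve f.
  + rewrite fx; have [cr|cr] := eqVneq c (mroot N); have [cd|cd] := eqVneq c d;
    have [dr|dr] := eqVneq d (mroot N); try (exfalso; lia); iso_solve f.
- move=> h hl; case: (cases _ hl) => [hm|[->|->]|[u ul ->]|->].
  + by have alh := alp_lt v hm; rewrite (fl h) //; iso_solve f.
  + by rewrite fa; iso_solve f.
  + by rewrite fb; iso_solve f.
  + rewrite fu //; have alu := alp_lt v2 ul; have [e|e] := eqVneq u (mroot M2); iso_solve f.
  + by rewrite fx; iso_solve f.
- by rewrite fl.
Qed.

Lemma mapIns_mapR_last_iso M2 d N : valid_map N -> valid_map M2 -> d < mh N ->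
  map_iso (mapInsc M2 (mh N).+1 (mapRc d N)) (mapRc d (mapInsc M2 d N)).
Proof.
move=> v v2 dl; split; first by mhsimp; lia.
have rl := mroot_lt v; have rl2 := mroot_lt v2.
have slr := sig_lt v rl; have sld := sig_lt v dl.
pose f h := if h < mh N then h else if h < (mh N).+2 then h + mh M2 + 1
  else if h < (mh N).+2 + mh M2 then h - 2 else mh N + mh M2.
have fl h : h < mh N -> f h = h by rewrite /f => ->.
have fa : f (mh N) = (mh N + mh M2).+1 by rewrite /f; decide_ifs; lia.
have fb : f (mh N).+1 = (mh N + mh M2).+2 by rewrite /f; decide_ifs; lia.
have fx : f ((mh N).+2 + mh M2) = mh N + mh M2 by rewrite /f; decide_ifs.
have fu u : u < mh M2 -> f (u + (mh N).+2) = u + mh N by move=> ul; rewrite /f; decide_ifs; lia.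
have cases h : h < ((mh N).+2 + mh M2).+1 -> [\/ h < mh N, h = mh N \/ h = (mh N).+1,
    exists2 u, u < mh M2 & h = u + (mh N).+2 | h = (mh N).+2 + mh M2].
  move=> hl; have [h1|h1] := ltnP h (mh N); first by constructor 1.
  have [h2|h2] := ltnP h (mh N).+2; first by constructor 2; lia.
  have [h3|h3] := ltnP h ((mh N).+2 + mh M2); last by constructor 4; lia.
  by constructor 3; exists (h - (mh N).+2); lia.
exists f; split; mhsimp.
- by rewrite /f => h hl; ifs; lia.
- by rewrite /f => h1 h2 hl1 hl2; ifs; lia.
- move=> h hl; case: (cases _ hl) => [hm|[->|->]|[u ul ->]|->].
  + have slh := sig_lt v hm; rewrite (fl h) //.
    have [dr|dr] := eqVneq d (mroot N); have [hr|hr] := eqVneq h (mroot N);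
    have [hd|hd] := eqVneq h d; try (exfalso; lia); iso_solve f.
  + rewrite fa; have [dr|dr] := eqVneq d (mroot N); try (exfalso; lia); iso_solve f.
  + rewrite fb; have [dr|dr] := eqVneq d (mroot N); try (exfalso; lia); iso_solve f.
  + by rewrite fu //; have slu := sig_lt v2 ul; iso_solve f.
  + rewrite fx; have [dr|dr] := eqVneq d (mroot N); try (exfalso; lia); iso_solve f.
- move=> h hl; case: (cases _ hl) => [hm|[->|->]|[u ul ->]|->].
  + by have alh := alp_lt v hm; rewrite (fl h) //; iso_solve f.
  + by rewrite fa; iso_solve f.
  + by rewrite fb; iso_solve f.
  + rewrite fu //; have alu := alp_lt v2 ul; have [e|e] := eqVneq u (mroot M2); iso_solve f.
  + by rewrite fx; iso_solve f.
- by rewrite fl.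
Qed.

Lemma mapIns_assoc_iso M3 M2 c' c N : valid_map N -> valid_map M2 -> valid_map M3 ->
  c < mh N -> c' < mh M2 ->
  map_iso (mapInsc (mapInsc M3 c' M2) c N) (mapInsc M3 (c' + mh N) (mapInsc M2 c N)).
Proof.
move=> v v2 v3 cl cl'; split; first by mhsimp; lia.
have rl := mroot_lt v; have rl2 := mroot_lt v2; have rl3 := mroot_lt v3.
have slc := sig_lt v cl; have slc' := sig_lt v2 cl'.
pose f h := if h < mh N + mh M2 then h else if h < (mh N + mh M2 + mh M3).+1 then h.+1
  else mh N + mh M2.
have cases h : h < (mh N + (mh M2 + mh M3).+1).+1 -> [\/ h < mh N,
    exists2 u, u < mh M2 & h = u + mh N, exists2 u, u < mh M3 & h = u + mh M2 + mh N
    | h = mh M2 + mh M3 + mh N \/ h = (mh N + mh M2 + mh M3).+1].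
  move=> hl; have [h1|h1] := ltnP h (mh N); first by constructor 1.
  have [h2|h2] := ltnP h (mh N + mh M2).
    by constructor 2; exists (h - mh N); lia.
  have [h3|h3] := ltnP h (mh N + mh M2 + mh M3); last by constructor 4; lia.
  by constructor 3; exists (h - mh N - mh M2); lia.
have fl h : h < mh N -> f h = h by move=> hl; rewrite /f; decide_ifs.
have fu u : u < mh M2 -> f (u + mh N) = u + mh N by move=> ul; rewrite /f; decide_ifs.
have fw u : u < mh M3 -> f (u + mh M2 + mh N) = u + (mh N + mh M2).+1.
  by move=> ul; rewrite /f; decide_ifs; lia.
have fx : f (mh M2 + mh M3 + mh N) = (mh N + mh M2).+1 + mh M3 by rewrite /f; decide_ifs; lia.
have fy : f (mh N + mh M2 + mh M3).+1 = mh N + mh M2 by rewrite /f; decide_ifs; lia.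
exists f; split; mhsimp.
- by rewrite /f => h hl; ifs; lia.
- by rewrite /f => h1 h2 hl1 hl2; ifs; lia.
- move=> h hl; case: (cases _ hl) => [hm|[u ul ->]|[u ul ->]|[->|->]].
  + have slh := sig_lt v hm; rewrite (fl h) //.
    have [hc|hc] := eqVneq h c; iso_solve f.
  + have slu := sig_lt v2 ul; rewrite fu //; have [hc|hc] := eqVneq u c'; iso_solve f.
  + by have slu := sig_lt v3 ul; rewrite fw //; iso_solve f.
  + by rewrite fx; iso_solve f.
  + by rewrite fy; iso_solve f.
- move=> h hl; case: (cases _ hl) => [hm|[u ul ->]|[u ul ->]|[->|->]].
  + by have slh := alp_lt v hm; rewrite (fl h) //; iso_solve f.
  + have slu := alp_lt v2 ul; rewrite fu //; have [hc|hc] := eqVneq u (mroot M2); iso_solve f.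
  + have slu := alp_lt v3 ul; rewrite fw //; have [hc|hc] := eqVneq u (mroot M3); iso_solve f.
  + by rewrite fx; iso_solve f.
  + by rewrite fy; iso_solve f.
- by rewrite fl.
Qed.

(** When both maps go into the same corner, [M2] comes after [Md], that is, in the corner of the
    half-edge [mh N + mh Md] that carries [Md]. *)
Lemma mapIns_comm_iso M2 Md c e N : valid_map N -> valid_map M2 -> valid_map Md ->
  c < mh N -> e < mh N ->
  map_iso (mapInsc M2 (if c == e then mh N + mh Md else c) (mapInsc Md e N))
          (mapInsc Md e (mapInsc M2 c N)).
Proof.
move=> v v2 vd cl el; split; first by mhsimp; lia.
have rl := mroot_lt v; have rl2 := mroot_lt v2; have rld := mroot_lt vd.
have slc := sig_lt v cl; have sle := sig_lt v el.
pose f h := if h < mh N then h else if h < mh N + mh Md then h + (mh M2).+1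
  else if h == mh N + mh Md then mh N + (mh M2).+1 + mh Md
  else if h < (mh N + mh Md).+1 + mh M2 then h - (mh Md).+1
  else mh N + mh M2.
have cases h : h < ((mh N + mh Md).+1 + mh M2).+1 -> [\/ h < mh N,
    exists2 u, u < mh Md & h = u + mh N, exists2 u, u < mh M2 & h = u + (mh N + mh Md).+1
    | h = mh N + mh Md \/ h = (mh N + mh Md).+1 + mh M2].
  move=> hl; have [h1|h1] := ltnP h (mh N); first by constructor 1.
  have [h2|h2] := ltnP h (mh N + mh Md).
    by constructor 2; exists (h - mh N); lia.
  have [h4|h4] := eqVneq h (mh N + mh Md); first by constructor 4; left.
  have [h3|h3] := ltnP h ((mh N + mh Md).+1 + mh M2); last by constructor 4; right; lia.
  by constructor 3; exists (h - (mh N + mh Md).+1); lia.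
have fl h : h < mh N -> f h = h by move=> hl; rewrite /f; decide_ifs.
have fu u : u < mh Md -> f (u + mh N) = u + (mh N + mh M2).+1.
  by move=> ul; rewrite /f; decide_ifs; lia.
have fw u : u < mh M2 -> f (u + (mh N + mh Md).+1) = u + mh N.
  by move=> ul; rewrite /f; decide_ifs; lia.
have fx : f (mh N + mh Md) = (mh N + mh M2).+1 + mh Md by rewrite /f; decide_ifs; lia.
have fy : f ((mh N + mh Md).+1 + mh M2) = mh N + mh M2 by rewrite /f; decide_ifs; lia.
exists f; split; mhsimp.
- by rewrite /f => h hl; ifs; lia.
- by rewrite /f => h1 h2 hl1 hl2; ifs; lia.
- move=> h hl; case: (cases _ hl) => [hm|[u ul ->]|[u ul ->]|[->|->]].
  + have slh := sig_lt v hm; rewrite (fl h) //.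
    have [hc|hc] := eqVneq h c; have [he|he] := eqVneq h e; have [ce|ce] := eqVneq c e;
    try (exfalso; lia); iso_solve f.
  + have slu := sig_lt vd ul; rewrite fu //; have [ce|ce] := eqVneq c e; iso_solve f.
  + have slu := sig_lt v2 ul; rewrite fw //; have [ce|ce] := eqVneq c e; iso_solve f.
  + rewrite fx; have [ce|ce] := eqVneq c e; iso_solve f.
  + rewrite fy; have [ce|ce] := eqVneq c e; iso_solve f.
- move=> h hl; case: (cases _ hl) => [hm|[u ul ->]|[u ul ->]|[->|->]].
  + by have slh := alp_lt v hm; rewrite (fl h) //; iso_solve f.
  + have slu := alp_lt vd ul; rewrite fu //; have [hc|hc] := eqVneq u (mroot Md); iso_solve f.
  + have slu := alp_lt v2 ul; rewrite fw //; have [hc|hc] := eqVneq u (mroot M2); iso_solve f.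
  + by rewrite fx; iso_solve f.
  + by rewrite fy; iso_solve f.
- by rewrite fl.
Qed.

(** * Uniqueness of the decompositions, bridges *)

Lemma mapR_congr k N N' : valid_map N -> valid_map N' -> map_iso N N' ->
  map_iso (mapR k N) (mapR k N').
Proof.
move=> v v' [e [f hf]]; have [f1 f2 f3 f4 f5] := hf.
have ec := corner_iso k v v' e hf.
rewrite !mapRE -ec; have cl := corner_lt k v; move: (corner N k) cl => c cl {ec}.
have cl' := f1 _ cl.
split; first by mhsimp; rewrite e.
have rl := mroot_lt v.
pose g h := if h < mh N then f h else h.
have gl h : h < mh N -> g h = f h by rewrite /g => ->.
have ga : g (mh N) = mh N' by rewrite /g ltnn e.
have gb : g (mh N).+1 = (mh N').+1 by rewrite /g e; decide_ifs.
have fr h : h < mh N -> f h = mroot N' -> h = mroot N.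
  by move=> hl eh; apply: f2; rewrite ?f5.
exists g; split; mhsimp.
- by move=> h hl; rewrite /g; case: ifP => hm; [have := f1 _ hm; lia|lia].
- move=> h1 h2 hl1 hl2; rewrite /g; case: ifP => hm1; case: ifP => hm2 //.
  + exact: f2.
  + by have := f1 _ hm1; lia.
  + by have := f1 _ hm2; lia.
- move=> h hl; case: (Rc_cases v cl hl) => [->|->|->|[[-> cr]|[h1 h2 h3]]].
  + by rewrite (sig_Rc_root _ v) ga gl // f5 (sig_Rc_root _ v').
  + rewrite ga (sig_Rc_a _ v) (sig_Rc_a _ v'); have [cr|/eqP cr] := eqVneq c (mroot N).
      by rewrite cr f5 eqxx.
    case: eqP => [/fr e2|_]; first by case: cr; apply: e2.
    by rewrite gl ?sig_lt // f3 // f5.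
  + by rewrite gb (sig_Rc_b v cl) (sig_Rc_b v' cl') gl ?sig_lt // f3.
  + rewrite (sig_Rc_c v cl cr) gb gl // (sig_Rc_c v' cl') // => /fr e2.
    by apply: cr; apply: e2.
  + rewrite (sig_Rc_old v cl h1 h2 h3) !gl ?sig_lt // f3 // (sig_Rc_old v' cl') ?f1 //.
    - by move/fr => e2; apply: h2; apply: e2.
    - by move/f2 => e2; apply: h3; apply: e2.
- move=> h hl; have [hm|hm] := ltnP h (mh N).
    by rewrite (alp_Rc_old v cl) // !gl ?alp_lt // f4 // (alp_Rc_old v' cl') ?f1.
  have [->|h2] := eqVneq h (mh N); first by rewrite ga !alp_Rc_a gb.
  have -> : h = (mh N).+1 by lia.
  by rewrite gb (alp_Rc_b v cl) (alp_Rc_b v' cl').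
- by rewrite gl.
Qed.

Lemma mapIns_congr k M M' N N' : valid_map M -> valid_map M' -> valid_map N -> valid_map N' ->
  map_iso M M' -> map_iso N N' -> map_iso (mapIns M k N) (mapIns M' k N').
Proof.
move=> vM vM' v v' [eM [fM hfM]] [e [f hf]]; have [f1 f2 f3 f4 f5] := hf.
have [g1 g2 g3 g4 g5] := hfM.
have ec := corner_iso k v v' e hf.
rewrite !mapInsE -ec; have cl := corner_lt k v; move: (corner N k) cl => c cl {ec}.
have cl' := f1 _ cl.
split; first by mhsimp; rewrite e eM.
have rl := mroot_lt v; have rlM := mroot_lt vM.
pose g h := if h < mh N then f h else if h < mh N + mh M then fM (h - mh N) + mh N else h.
have gl h : h < mh N -> g h = f h by rewrite /g => ->.
have gu u : u < mh M -> g (u + mh N) = fM u + mh N'.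
  by move=> ul; rewrite /g addnK -e; decide_ifs.
have gx : g (mh N + mh M) = mh N' + mh M' by rewrite /g e eM; decide_ifs.
exists g; split; mhsimp.
- move=> h hl; rewrite /g; case: ifP => hm; first by have := f1 _ hm; lia.
  case: ifP => hx; last by lia.
  have hu : h - mh N < mh M by lia.
  by have := g1 _ hu; lia.
- move=> h1 h2 hl1 hl2.
  case: (Ic_cases v vM cl hl1) => [->|[x1 x2]|->|[u x1 ->]];
  case: (Ic_cases v vM cl hl2) => [->|[y1 y2]|->|[w y1 ->]] //;
  rewrite ?gu ?gx ?gl //.
  + by apply: f2.
  + by lia.
  + by lia.
  + by apply: f2.
  + by apply: f2.
  + by have := f1 _ x1; lia.
  + by have := f1 _ x1; lia.
  + by have := f1 _ cl; lia.
  + by have := f1 _ y1; lia.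
  + by have := g1 _ y1; lia.
  + by have := f1 _ cl; lia.
  + by have := f1 _ y1; lia.
  + by have := g1 _ x1; lia.
  + by move/addIn/g2 => ->.
- move=> h hl; case: (Ic_cases v vM cl hl) => [->|[x1 x2]|->|[u x1 ->]].
  + by rewrite (sig_Ic_c v vM cl) gx gl // (sig_Ic_c v' vM' cl').
  + rewrite (sig_Ic_old v vM cl) // !gl ?sig_lt // f3 // (sig_Ic_old v' vM' cl') ?f1 //.
    by move/f2 => e2; apply: x2; apply: e2.
  + by rewrite (sig_Ic_x v vM cl) gx gl ?sig_lt // f3 // (sig_Ic_x v' vM' cl').
  + by rewrite (sig_Ic_new v vM cl) // !gu ?sig_lt // g3 // (sig_Ic_new v' vM' cl') ?g1.
- move=> h hl; have [hm|hm] := ltnP h (mh N).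
    by rewrite (alp_Ic_old v vM cl) // !gl ?alp_lt // f4 // (alp_Ic_old v' vM' cl') // f1.
  case: (Ic_cases v vM cl hl) => [eh|[x1 x2]|->|[u x1 ->]]; try lia.
  + by rewrite (alp_Ic_x v vM cl) gx gu // g5 (alp_Ic_x v' vM' cl').
  + have [eu|/eqP nu] := eqVneq u (mroot M).
      by rewrite eu (alp_Ic_root v vM cl) gx gu // g5 (alp_Ic_root v' vM' cl').
    rewrite (alp_Ic_new v vM cl) // !gu ?alp_lt // g4 // (alp_Ic_new v' vM' cl') ?g1 //.
    by rewrite -g5 => /g2 e2; apply: nu; apply: e2.
- by rewrite gl.
Qed.

(** An isomorphism fixes the root, hence the root edge with its orientation, hence the corner of its
    far end; so it restricts to [N]. Labels are invariant and distinct, which gives [k = k']. *)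
Lemma mapR_inj k k' N N' : valid_map N -> valid_map N' ->
  0 < k <= mh N -> 0 < k' <= mh N' ->
  map_iso (mapR k N) (mapR k' N') -> k = k' /\ map_iso N N'.
Proof.
move=> v v' hk hk' [/= eM [f [f1 f2 f3 f4 f5]]].
have cl := corner_lt k v; have cl' := corner_lt k' v'.
rewrite !mapRE in f1 f2 f3 f4 f5.
set c := corner N k in cl f1 f2 f3 f4 f5; set c' := corner N' k' in cl' f1 f2 f3 f4 f5.
have e : mh N = mh N' by case: eM.
move: f1 f2 f3 f4 f5; mhsimp => f1 f2 f3 f4 f5.
have rl := mroot_lt v; have rl' := mroot_lt v'.
have fa : f (mh N) = mh N' by rewrite -(sig_Rc_root c v) f3 ?f5 ?(sig_Rc_root _ v') //; lia.
have fb : f (mh N).+1 = (mh N').+1 by rewrite -(alp_Rc_a c N) f4 // fa alp_Rc_a.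
have fl h : h < mh N -> f h < mh N'.
  move=> hl; have := f1 h; have := f2 h (mh N); have := f2 h (mh N).+1; rewrite fa fb; lia.
have slt h : h < mh N -> sig N h < mh N by exact: sig_lt.
have fr h : h < mh N -> f h = mroot N' -> h = mroot N.
  by move=> hl eh; apply: f2; rewrite ?f5 //; lia.
have fc : f c = c'.
  have [cr|/eqP cr] := eqVneq c (mroot N).
    have := f3 (mh N) ltac:(lia); rewrite fa (sig_Rc_a _ v) (sig_Rc_a _ v') cr eqxx fb.
    by case: eqP => [-> _|_]; [|have := sig_lt v' rl'; lia].
  have := f3 c ltac:(lia); rewrite (sig_Rc_c v cl cr) fb.
  have fcl := fl _ cl.
  have fcr : f c <> mroot N' by move=> eh; apply: cr; apply: fr.
  have [//|/eqP fcc] := eqVneq (f c) c'.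
  by rewrite (sig_Rc_old v' cl') //; have := sig_lt v' fcl; lia.
have iso : map_iso_by N N' f.
  split=> //.
  - by move=> h1 h2 hl1 hl2; apply: f2; lia.
  - move=> h hl; have [->|/eqP hr] := eqVneq h (mroot N).
      rewrite f5; have [cr|/eqP cr] := eqVneq c (mroot N).
        by rewrite -{1}cr -(sig_Rc_b v cl) f3 // fb (sig_Rc_b v' cl') -fc cr f5.
      have := f3 (mh N) ltac:(lia); rewrite fa (sig_Rc_a _ v) (sig_Rc_a _ v').
      case: eqP => // _; case: eqP => // c'r; case: cr; apply: fr => //.
      by rewrite fc.
    have [->|/eqP hc] := eqVneq h c.
      by rewrite -(sig_Rc_b v cl) f3 // fb (sig_Rc_b v' cl') fc.
    have := f3 h ltac:(lia); rewrite (sig_Rc_old v cl) // => ->.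
    rewrite (sig_Rc_old v' cl') ?fl //; first by move/fr => e2; apply: hr; apply: e2.
    by rewrite -fc => /f2 e2; apply: hc; apply: e2; lia.
  - move=> h hl; have := f4 h ltac:(lia); rewrite (alp_Rc_old v cl) // => ->.
    by rewrite (alp_Rc_old v' cl') ?fl.
split; last by split=> //; exists f.
have gN' := valid_good_corners v'.
apply: (corner_inj gN') => //; first by rewrite -e.
by rewrite -(corner_iso k v v' e iso).
Qed.

Lemma bounded_inj_leq m n (f : nat -> nat) : (forall h, h < m -> f h < n) ->
  (forall h1 h2, h1 < m -> h2 < m -> f h1 = f h2 -> h1 = h2) -> m <= n.
Proof.
move=> fb fi; rewrite -(size_iota 0 m) -(size_map f) -(size_iota 0 n).
apply: uniq_leq_size.
  by rewrite map_inj_in_uniq ?iota_uniq // => x y; rewrite !mem_iota => hx hy; apply: fi; lia.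
by move=> x /mapP[y]; rewrite !mem_iota => hy ->; have := fb y; lia.
Qed.

(** The isomorphism preserves the root bridge, hence also the component of the root after its
    deletion, which is [Mu] with the half-edge of the bridge added. *)
Lemma mapIns1_part Md Mu Md' Mu' f : valid_map Md -> valid_map Mu -> valid_map Md' -> valid_map Mu' ->
  map_iso_by (mapIns Md 1 Mu) (mapIns Md' 1 Mu') f ->
  f (mh Mu + mh Md) = mh Mu' + mh Md' /\ forall h, h < mh Mu -> f h < mh Mu'.
Proof.
move=> vd vu vd' vu' hf.
have rl := mroot_lt vu; have rl' := mroot_lt vu'.
have vM := valid_mapIns 1 vd vu.
rewrite !mapInsE !corner1 in hf vM; have [f1 f2 f3 f4 f5] := hf.
move: f1 f2 f3 f4 f5; mhsimp => f1 f2 f3 f4 f5.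
have rl2 : mroot Mu < (mh Mu + mh Md).+1 by lia.
have fx : f (mh Mu + mh Md) = mh Mu' + mh Md'.
  by rewrite -(sig_Ic_c vu vd rl) f3 // f5 (sig_Ic_c vu' vd' rl').
split=> // h hl.
have xl : mh Mu + mh Md < mh (mapInsc Md (mroot Mu) Mu) by mhsimp.
have fr : freach (sig (mapInsc Md (mroot Mu) Mu)) (alp (mapInsc Md (mroot Mu) Mu)) (mh Mu + mh Md) (mroot Mu) h.
  have : mreach Mu h by apply: valid_mreach.
  suff H y : mreach Mu y -> y < mh Mu /\ freach (sig (mapInsc Md (mroot Mu) Mu)) (alp (mapInsc Md (mroot Mu) Mu)) (mh Mu + mh Md) (mroot Mu) y by case/H.
  elim=> [|z _ [zl IH]|z _ [zl IH]].
  - by split=> //; apply: fr_refl.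
  - split; first exact: sig_lt.
    by apply: freach_trans IH _; apply: freach_Ic_sig.
  - split; first exact: alp_lt.
    apply: freach_trans IH _; apply: fr_alp'; [by rewrite (alp_Ic_old vu vd rl)|lia|].
    by rewrite (alp_Ic_x vu vd rl); have := mroot_lt vd; lia.
have := map_iso_freach vM hf xl (alp_lt vM) f4 (x := mroot Mu) _ fr.
rewrite fx f5 => /(_ rl2).
move/(freach_inv (P := fun y => (y < mh Mu') || (y == mh Mu' + mh Md'))) => H.
have : (f h < mh Mu') || (f h == mh Mu' + mh Md').
  apply: H; mhsimp; last by rewrite rl'.
  - move=> y /orP[yl|/eqP->]; last by rewrite (sig_Ic_x vu' vd' rl') sig_lt.
    have [->|/eqP yr] := eqVneq y (mroot Mu'); first by rewrite (sig_Ic_c vu' vd' rl') eqxx orbT.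
    by rewrite (sig_Ic_old vu' vd' rl') // sig_lt.
  - by move=> y /orP[yl|/eqP->] // *; rewrite (alp_Ic_old vu' vd' rl') // alp_lt.
case/orP => // /eqP; rewrite -fx => /f2 e.
by have := e ltac:(lia) ltac:(lia); lia.
Qed.

Lemma mapIns1_inj Md Mu Md' Mu' : valid_map Md -> valid_map Mu -> valid_map Md' -> valid_map Mu' ->
  map_iso (mapIns Md 1 Mu) (mapIns Md' 1 Mu') -> map_iso Md Md' /\ map_iso Mu Mu'.
Proof.
move=> vd vu vd' vu' [eM [f hf]].
have vM := valid_mapIns 1 vd vu.
have [g [hg fg]] := map_iso_inv vM eM hf.
have [fx fu] := mapIns1_part vd vu vd' vu' hf.
have [gx gu] := mapIns1_part vd' vu' vd vu hg.
have rl := mroot_lt vu; have rl' := mroot_lt vu'.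
have rld := mroot_lt vd; have rld' := mroot_lt vd'.
rewrite !mapInsE !corner1 in hf hg eM fg.
have [f1 f2 f3 f4 f5] := hf; have [g1 g2 _ _ _] := hg.
move: f1 f2 f3 f4 f5 g1 g2 eM fg; mhsimp => f1 f2 f3 f4 f5 g1 g2 eM fg.
have eu : mh Mu = mh Mu'.
  apply/eqP; rewrite eqn_leq; apply/andP; split.
    by apply: (bounded_inj_leq fu) => h1 h2 hl1 hl2; apply: f2; lia.
  by apply: (bounded_inj_leq gu) => h1 h2 hl1 hl2; apply: g2; lia.
have ed : mh Md = mh Md' by lia.
have fd h : h < mh Md -> mh Mu' <= f (h + mh Mu) < mh Mu' + mh Md'.
  move=> hl; have hl1 : h + mh Mu < (mh Mu + mh Md).+1 by lia.
  have := f1 _ hl1; have := f2 _ (mh Mu + mh Md) hl1 ltac:(lia); rewrite fx => h1 h2.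
  have : ~~ (f (h + mh Mu) < mh Mu').
    apply/negP => /gu; have [|_ ->] := fg (h + mh Mu); lia.
  by lia.
have fr h : h < mh Mu -> f h = mroot Mu' -> h = mroot Mu.
  by move=> hl eh; apply: f2; rewrite ?f5 //; lia.
have frd : f (mroot Md + mh Mu) = mroot Md' + mh Mu'.
  by rewrite -(alp_Ic_x vu vd rl) f4 // fx (alp_Ic_x vu' vd' rl').
split; last first.
  split=> //; exists f; split=> //.
  - by move=> h1 h2 hl1 hl2; apply: f2; lia.
  - move=> h hl; have [->|/eqP hr] := eqVneq h (mroot Mu).
      by rewrite f5 -(sig_Ic_x vu vd rl) f3 // fx (sig_Ic_x vu' vd' rl').
    have := f3 h ltac:(lia); rewrite (sig_Ic_old vu vd rl) // => ->.
    rewrite (sig_Ic_old vu' vd' rl') // ?fu //.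
    by move/fr => e2; apply: hr; apply: e2.
  - move=> h hl; have := f4 h ltac:(lia); rewrite (alp_Ic_old vu vd rl) // => ->.
    by rewrite (alp_Ic_old vu' vd' rl') // fu.
split=> //; pose F h := f (h + mh Mu) - mh Mu'.
have FE h : h < mh Md -> f (h + mh Mu) = F h + mh Mu' by move=> /fd; rewrite /F; lia.
have Fl h : h < mh Md -> F h < mh Md' by move=> /fd; rewrite /F; lia.
exists F; split.
- by [].
- move=> h1 h2 hl1 hl2 eF; have := f2 (h1 + mh Mu) (h2 + mh Mu) ltac:(lia) ltac:(lia).
  by rewrite !FE // eF => /(_ erefl); lia.
- move=> h hl; have := f3 (h + mh Mu) ltac:(lia).
  by rewrite (sig_Ic_new vu vd rl) // !FE ?sig_lt // (sig_Ic_new vu' vd' rl') ?Fl // => /addIn.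
- move=> h hl; have [->|/eqP hr] := eqVneq h (mroot Md).
    rewrite alp_root //; have -> : F (mroot Md) = mroot Md' by rewrite /F frd addnK.
    by rewrite alp_root.
  have Fr : F h <> mroot Md'.
    move=> eF; apply: hr; have := f2 (h + mh Mu) (mroot Md + mh Mu) ltac:(lia) ltac:(lia).
    by rewrite FE // eF frd => /(_ erefl); lia.
  have := f4 (h + mh Mu) ltac:(lia).
  by rewrite (alp_Ic_new vu vd rl) // !FE ?alp_lt // (alp_Ic_new vu' vd' rl') ?Fl // => /addIn.
- by rewrite /F frd addnK.
Qed.

(** The root edge is a bridge on one side only, and being a bridge is invariant. *)
Lemma mapR_not_mapIns1 k N Md Mu : valid_map N -> valid_map Md -> valid_map Mu ->
  ~ map_iso (mapR k N) (mapIns Md 1 Mu).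
Proof.
move=> v vd vu [eM [f hf]].
have cl := corner_lt k v; have rl := mroot_lt vu.
have vR := valid_mapR k v; have vI := valid_mapIns 1 vd vu.
have ml : mh N < mh (mapR k N) by rewrite mapRE; mhsimp.
have := map_iso_fbridge (a2 := alp (mapIns Md 1 Mu)) vR vI eM hf ml (alp_lt vR).
case: hf => _ _ f3 f4 f5 /(_ f4).
have -> : f (mh N) = mh Mu + mh Md.
  rewrite -(sig_Rc_root (corner N k) v) f3; last by rewrite mapRE; mhsimp; have := mroot_lt v; lia.
  by rewrite f5 mapInsE corner1 (sig_Ic_c vu vd rl).
rewrite {f3 f4 f5 eM}.
have -> : fbridgeb (sig (mapIns Md 1 Mu)) (alp (mapIns Md 1 Mu)) (mh Mu + mh Md) = true.
  rewrite mapInsE corner1 -(extI_alp vu vd rl); apply: fbridge_Ic_x => //.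
  by split; [exact: alp_lt|exact: alpK|exact: alp_root].
by move/fbridgeP; apply: not_fbridge_Rc_root.
Qed.

(** * Bridges under a new root edge *)

Lemma fbridge_alp M h : valid_map M -> h < mh M ->
  fbridge (sig M) (alp M) h -> fbridge (sig M) (alp M) (alp M h).
Proof.
move=> v hl [h1 h2]; split; rewrite alpK //; first by move=> e; apply: h1.
move=> hr; apply: h2; apply: freach_sym => //; first exact: alp_lt.
by have := freach_swap v (alp_lt v hl) hr; rewrite alpK.
Qed.

(** Both ends of the root edge lie on the side of [N], to which the corner of the connecting
    half-edge also belongs; so that side stays closed off from [M2]. Contrapositively, in a
    bridgeless map the root edge must end inside the inserted map. *)
Lemma fbridge_R_I_x M2 N c c0 : valid_map M2 -> valid_map N -> c0 < mh N ->
  c < mh N \/ c = mh N + mh M2 ->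
  fbridge (sig (mapRc c (mapInsc M2 c0 N))) (alp (mapRc c (mapInsc M2 c0 N))) (mh N + mh M2).
Proof.
move=> v2 v cl0 hc; have rl := mroot_lt v; have rl2 := mroot_lt v2.
have vI := valid_mapInsc v v2 cl0.
have cI : c < mh (mapInsc M2 c0 N) by mhsimp; lia.
have ax : alp (mapRc c (mapInsc M2 c0 N)) (mh N + mh M2) = mroot M2 + mh N.
  by rewrite (alp_Rc_old vI cI) ?(alp_Ic_x v v2 cl0) //; mhsimp; lia.
split; rewrite ax; first lia.
set x := mh N + mh M2.
pose B h := (h < mh N) || (h == x).
have BI h : B h -> B (sig (mapInsc M2 c0 N) h).
  case/orP => [hl|/eqP->]; last by rewrite (sig_Ic_x v v2 cl0) /B sig_lt.
  have [->|/eqP h1] := eqVneq h c0; first by rewrite (sig_Ic_c v v2 cl0) /B eqxx orbT.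
  by rewrite (sig_Ic_old v v2 cl0) // /B sig_lt.
have Bc : B c by rewrite /B; case: hc => [->//|->]; rewrite eqxx orbT.
have Br : B (mroot N) by rewrite /B rl.
have Bl h : B h -> h < x.+1 by rewrite /B /x; lia.
move/(freach_inv (P := fun y => B y \/ (y == x.+1) || (y == x.+2))) => H.
have : B (mroot M2 + mh N) \/ (mroot M2 + mh N == x.+1) || (mroot M2 + mh N == x.+2).
  apply: H; last by left; rewrite /B eqxx orbT.
  - move=> y hy; have yl : y < (mh (mapInsc M2 c0 N)).+2.
      by mhsimp; case: hy => [/Bl|]; rewrite /x; lia.
    case: (Rc_cases vI cI yl) => [->|->|->|[[-> cr]|[h1 h2 h3]]].
    + by rewrite (sig_Rc_root _ vI); mhsimp; right; rewrite eqxx.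
    + rewrite (sig_Rc_a _ vI); mhsimp; case: ifP => _; first by right; rewrite eqxx orbT.
      by left; apply: BI.
    + by rewrite (sig_Rc_b vI cI); left; apply: BI.
    + by rewrite (sig_Rc_c vI cI cr); mhsimp; right; rewrite eqxx orbT.
    + rewrite (sig_Rc_old vI cI h1 h2 h3); case: hy => [By|]; first by left; apply: BI.
      by move: h1; mhsimp; rewrite /x; lia.
  - move=> y hy y1 y2; have [yl|yl] := ltnP y (mh N).
      left; rewrite (alp_Rc_old vI cI); last by mhsimp; lia.
      by rewrite (alp_Ic_old v v2 cl0) // /B alp_lt.
    case: hy => [|/orP[/eqP->|/eqP->]]; first by rewrite /B; lia.
      by right; rewrite (alp_Rc_a c (mapInsc M2 c0 N)); mhsimp; rewrite eqxx orbT.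
    by right; rewrite (alp_Rc_b vI cI); mhsimp; rewrite eqxx.
by rewrite /B /x; lia.
Qed.

(** Collapsing [M2], its connecting half-edge and the far end of the root edge to one point, the far
    end in [mapRc c N], turns the larger map into [mapRc c N]; paths that avoid [e] go to paths that
    avoid [e]. *)
Lemma fbridge_R_I_old M2 N c u e : valid_map M2 -> valid_map N -> c < mh N -> u < mh M2 ->
  e < mh N -> fbridge (sig (mapRc c N)) (alp (mapRc c N)) e ->
  fbridge (sig (mapRc (u + mh N) (mapInsc M2 c N))) (alp (mapRc (u + mh N) (mapInsc M2 c N))) e.
Proof.
move=> v2 v cl ul el [b1 b2]; have rl := mroot_lt v; have rl2 := mroot_lt v2.
have vI := valid_mapInsc v v2 cl.
set I := mapInsc M2 c N in vI *.
have mI : mh I = (mh N + mh M2).+1 by [].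
have rI : mroot I = mroot N by [].
have cI : u + mh N < mh I by rewrite mI; lia.
have eI : e < mh I by rewrite mI; lia.
have ae := alp_lt v el.
have aeR : alp (mapRc c N) e = alp N e by rewrite (alp_Rc_old v cl).
have aeI : alp (mapRc (u + mh N) I) e = alp N e by rewrite (alp_Rc_old vI cI) // (alp_Ic_old v v2 cl).
rewrite aeR in b1 b2; split; rewrite aeI // => hr; apply: b2.
pose rho h := if h < mh N then h else if h < mh I then (mh N).+1
  else if h == mh I then mh N else (mh N).+1.
have rl' h : h < mh N -> rho h = h by rewrite /rho => ->.
have rM h : mh N <= h < mh I -> rho h = (mh N).+1 by rewrite /rho => ?; decide_ifs.
have ra : rho (mh I) = mh N by rewrite /rho; decide_ifs.
have rb : rho (mh I).+1 = (mh N).+1 by rewrite /rho; decide_ifs.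
suff [_] : alp N e < (mh I).+2 /\ freach (sig (mapRc c N)) (alp (mapRc c N)) e (rho e) (rho (alp N e)).
  by rewrite !rl'.
have vR := valid_mapRc vI cI.
apply: (freach_map (P := fun h => h < (mh I).+2)) hr; last by lia.
- move=> y yl; split; first exact: (sig_lt vR).
  case: (Rc_cases vI cI yl) => [->|->|->|[[-> cr]|[h1 h2 h3]]].
  + rewrite (sig_Rc_root _ vI) ra rI rl' //.
    by apply: fr_sig'; rewrite (sig_Rc_root _ v).
  + rewrite (sig_Rc_a _ vI) ra rI; case: eqP => [er|_]; first lia.
    apply: fr_sig'; rewrite (sig_Rc_a _ v); have [cr|/eqP cr] := eqVneq c (mroot N).
      by rewrite -cr (sig_Ic_c v v2 cl) rM // mI; lia.
    by rewrite (sig_Ic_old v v2 cl) ?rl' ?sig_lt //; apply: nesym.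
  + rewrite rb (sig_Rc_b vI cI) (sig_Ic_new v v2 cl) //.
    by rewrite rM; [apply: fr_refl|rewrite mI; have := sig_lt v2 ul; lia].
  + by rewrite (sig_Rc_c vI cI cr) rb rM; [apply: fr_refl|lia].
  + rewrite (sig_Rc_old vI cI h1 h2 h3); rewrite mI in h1; case: (Ic_cases v v2 cl h1) => [ey|[y1 y2]|->|[w y1 ->]].
    * rewrite ey (sig_Ic_c v v2 cl) rl' // rM; last by rewrite mI; lia.
      by apply: fr_sig'; rewrite (sig_Rc_c v cl) // -ey.
    * rewrite (sig_Ic_old v v2 cl) // !rl' ?sig_lt //.
      by apply: fr_sig'; rewrite (sig_Rc_old v cl).
    * rewrite (sig_Ic_x v v2 cl) rM; last by rewrite mI; lia.
      by rewrite rl' ?sig_lt //; apply: fr_sig'; rewrite (sig_Rc_b v cl).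
    * rewrite (sig_Ic_new v v2 cl) //; have := sig_lt v2 y1 => ?.
      by rewrite !rM; [apply: fr_refl|rewrite mI; lia|rewrite mI; lia].
- move=> y yl y1 y2; split; first exact: (alp_lt vR).
  have [ym|ym] := ltnP y (mh N).
    rewrite (alp_Rc_old vI cI); last by rewrite mI; lia.
    rewrite (alp_Ic_old v v2 cl) // !rl' ?alp_lt //.
    by apply: fr_alp'; rewrite ?aeR -?aeI // (alp_Rc_old v cl).
  have [yI|yI] := ltnP y (mh I).
    rewrite (alp_Rc_old vI cI) // !rM; [exact: fr_refl| |lia].
    rewrite mI in yI *.
    case: (Ic_cases v v2 cl yI) => [ey|[z1 _]|->|[w z1 ->]]; try lia.
      by rewrite (alp_Ic_x v v2 cl); lia.
    have [->|/eqP wr] := eqVneq w (mroot M2); first by rewrite (alp_Ic_root v v2 cl); lia.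
    by rewrite (alp_Ic_new v v2 cl) //; have := alp_lt v2 z1; lia.
  have [->|yI2] := eqVneq y (mh I).
    rewrite alp_Rc_a ra rb; apply: fr_alp'; rewrite ?alp_Rc_a ?aeR //; lia.
  have -> : y = (mh I).+1 by lia.
  rewrite (alp_Rc_b vI cI) ra rb; apply: fr_alp'; rewrite ?(alp_Rc_b v cl) ?aeR //; lia.
Qed.

Lemma mapIns_assoc k l M3 M2 N : valid_map N -> valid_map M2 -> valid_map M3 ->
  0 < k <= mh N -> 0 < l <= mh M2 ->
  map_iso (mapIns (mapIns M3 l M2) k N) (mapIns M3 (k + l) (mapIns M2 k N)).
Proof.
move=> v v2 v3 hk hl.
rewrite [mapIns M3 (k + l) _]mapInsE corner_I_mid //; try exact: valid_good_corners.
by rewrite !mapInsE; apply: mapIns_assoc_iso => //; apply: corner_lt.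
Qed.

(** As long as the inserted map has a bridge it is split again, and [mapIns_assoc] moves the part
    nearer to the root into [N]. *)
Lemma last_bridge M : valid_map M -> ~ bridgeless M ->
  exists N M2 l, [/\ valid_map N, valid_map M2, 0 < l <= mh N,
    map_iso M (mapIns M2 l N) & bridgeless M2].
Proof.
have [n] := ubnP (mh M); elim: n M => // n IH M hn v nb.
have [h hl /is_bridgeE hb] : exists2 h, h < mh M & is_bridge (msig M) (malp M) h.
  apply: NNPP => H; apply: nb => h hl hb; apply: H; by exists h.
have [N [M' [k [vN vM' hk iso _]]]] := bridge_mapIns v hl hb.
have [b|nb'] := classic (bridgeless M'); first by exists N, M', k.
have e : mh M = (mh N + mh M').+1 by case: iso.
have rN := mroot_lt vN.
have hn' : mh M' < n by lia.
have [N' [M2 [l [vN' vM2 hl' iso' b2]]]] := IH _ hn' vM' nb'.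
exists (mapIns N' k N), M2, (k + l); split=> //.
- exact: valid_mapIns.
- by rewrite mapInsE; mhsimp; lia.
- apply: map_iso_trans iso _; apply: map_iso_trans (mapIns_assoc vN vN' vM2 hk hl').
  apply: mapIns_congr => //; [exact: valid_mapIns|exact: map_iso_refl].
Qed.

(** * The bijection *)

Lemma phi_iso M M' D : map_iso M' M -> phi_rel M D -> phi_rel M' D.
Proof.
move=> iso H; case: H iso => {M D} [M i|M Md Mu Dd Du vd vu i hd hu|M N k D v h0 hk i h] iso.
- by apply: phi_single; apply: map_iso_trans i.
- by apply: (phi_bridge vd vu _ hd hu); apply: map_iso_trans i.
- by apply: (phi_root v h0 hk _ h); apply: map_iso_trans i.
Qed.

(** The size equation gives corners and intervals the same range of labels and supplies the bounds
    required by the diagram lemmas. *)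
Lemma phi_diag M D : phi_rel M D -> [/\ valid_diag D, indecomposable D & size D = (mh M).+1].
Proof.
elim=> {M D} [M [e _]|M Md Mu Dd Du vd vu [e _] _ [vd1 id1 sd] _ [vu1 iu1 su]|M N k D v h0 hk [e _] _ [v1 i1 s1]].
- by split; [apply: valid_one_chord|apply: indec_one_chord|rewrite e].
- split.
  + by apply: valid_dIns => //; case: iu1.
  + exact: indec_dIns1.
  + by rewrite size_dIns e mapInsE; mhsimp; lia.
- split.
  + by apply: valid_dR => //; lia.
  + by apply: indec_dR => //; lia.
  + by rewrite size_dR e mapRE; mhsimp; lia.
Qed.

Lemma phi_inv_single M D : map_iso M one_half_edge_map -> phi_rel M D -> D = one_chord.
Proof.
move=> [e _] H; case: H e => {M D} // [M Md Mu Dd Du vd vu [e _] _ _|M N k D v h0 hk [e _] _] e1.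
  by rewrite e mapInsE in e1; move: e1; mhsimp => /=; have := mroot_lt vd; have := mroot_lt vu; lia.
by rewrite e mapRE in e1; move: e1; mhsimp.
Qed.

(** Inversion along a prescribed decomposition of [M]: the one recorded in the derivation agrees
    with it up to isomorphism. *)
Lemma phi_inv_R M N k D : valid_map M -> valid_map N -> 0 < k <= mh N ->
  map_iso M (mapR k N) -> phi_rel M D -> exists2 D', D = dR k D' & phi_rel N D'.
Proof.
move=> v vN hk iso H.
case: H v iso => {M D} [M [e _]|M Md Mu Dd Du vd vu i hd hu|M N' k' D' vN' h0 hk' i h] v iso.
- by have := proj1 iso; rewrite e mapRE; mhsimp.
- by have := mapR_not_mapIns1 vN vd vu (map_iso_trans (map_iso_sym v iso) i).
- have hk2 : 0 < k' <= mh N' by lia.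
  have [ek i2] := mapR_inj vN vN' hk hk2 (map_iso_trans (map_iso_sym v iso) i).
  by exists D'; [rewrite ek|apply: phi_iso h].
Qed.

Lemma phi_inv_I M Md Mu D : valid_map M -> valid_map Md -> valid_map Mu ->
  map_iso M (mapIns Md 1 Mu) -> phi_rel M D ->
  exists Dd Du, [/\ D = dIns Dd 1 Du, phi_rel Md Dd & phi_rel Mu Du].
Proof.
move=> v vd vu iso H.
case: H v iso => {M D} [M [e _]|M Md' Mu' Dd Du vd' vu' i hd hu|M N' k' D' vN' h0 hk' i h] v iso.
- have := proj1 iso; rewrite e mapInsE; mhsimp => /=.
  by have := mroot_lt vd; have := mroot_lt vu; lia.
- have [i1 i2] := mapIns1_inj vd vu vd' vu' (map_iso_trans (map_iso_sym v iso) i).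
  by exists Dd, Du; split=> //; [apply: phi_iso hd|apply: phi_iso hu].
- by have := mapR_not_mapIns1 vN' vd vu (map_iso_trans (map_iso_sym v i) iso).
Qed.

Lemma phi_unique M D D' : valid_map M -> phi_rel M D -> phi_rel M D' -> D = D'.
Proof.
move=> v H; elim: H v D' => {M D} [M i|M Md Mu Dd Du vd vu i _ IHd _ IHu|M N k D vN h0 hk i _ IH] v D'.
- by move/(phi_inv_single i).
- by case/(phi_inv_I v vd vu i) => [Dd' [Du' [-> hd hu]]]; rewrite (IHd vd _ hd) (IHu vu _ hu).
- have hk' : 0 < k <= mh N by rewrite h0.
  by case/(phi_inv_R v vN hk' i) => [D2 -> h2]; rewrite (IH vN _ h2).
Qed.

Lemma phi_exists M : valid_map M -> exists D, phi_rel M D.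
Proof.
have [n] := ubnP (mh M); elim: n M => // n IH M hn v.
case: (map_decomposition v) => [i|[Md [Mu [vd vu i]]]|[k [N [vN /andP[h0 hk] i]]]].
- by exists one_chord; apply: phi_single.
- have e : mh M = (mh Mu + mh Md).+1 by case: i.
  have [Dd hd] := IH Md ltac:(lia) vd; have [Du hu] := IH Mu ltac:(lia) vu.
  by exists (dIns Dd 1 Du); apply: phi_bridge i hd hu.
- have e : mh M = (mh N).+2 by case: i.
  have [D h] := IH N ltac:(lia) vN.
  by exists (dR k D); apply: phi_root i h.
Qed.

Lemma dIns1_neq_dR M N Dd Du k D : phi_rel M Dd -> phi_rel N Du ->
  indecomposable D -> k < size D -> dIns Dd 1 Du <> dR k D.
Proof.
move=> /phi_diag[vd id _] /phi_diag[vu iu _] iD hk e.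
have := closed_block_dIns vd (proj1 id) (valid_size_gt1 vu (proj1 iu)).
by rewrite e no_closed_block_dR.
Qed.

(** The diagram determines the last clause used in both derivations: its size singles out the
    trivial map, a closed block separates the bridge clause from the root clause, and [dIns1_inj]
    and [dR_inj] recover the arguments. *)
Lemma phi_inj M1 M2 D : valid_map M1 -> valid_map M2 ->
  phi_rel M1 D -> phi_rel M2 D -> map_iso M1 M2.
Proof.
move=> v1 v2 H; elim: H v1 M2 v2 => {M1 D} [M i|M Md Mu Dd Du vd vu i hd IHd hu IHu|M N k D vN h0 hk i h IH] v1 M2 v2 H2.
- have [_ _ s2] := phi_diag H2.
  case: (map_decomposition v2) => [i2|[Md [Mu [vd vu [e2 _]]]]|[k [N [vN _ [e2 _]]]]].
  + by apply: map_iso_trans i _; apply: map_iso_sym.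
  + by rewrite e2 mapInsE in s2; move: s2; mhsimp => /=; have := mroot_lt vd; have := mroot_lt vu; lia.
  + by rewrite e2 mapRE in s2; move: s2; mhsimp.
- have [vDd iDd sd] := phi_diag hd; have [vDu iDu su] := phi_diag hu.
  move eD : (dIns Dd 1 Du) H2 => D2 H2.
  case: H2 v2 eD => {M2 D2} [M2 i2|M2 Md2 Mu2 Dd2 Du2 vd2 vu2 i2 hd2 hu2|M2 N2 k2 D2 vN2 h02 hk2 i2 h2] v2 eD.
  + have := congr1 size eD; rewrite size_dIns sd su /=.
    by have := mroot_lt vd; have := mroot_lt vu; lia.
  + have [vDd2 iDd2 _] := phi_diag hd2; have [vDu2 iDu2 _] := phi_diag hu2.
    have [ed eu] := dIns1_inj vDd vDu vDd2 vDu2 iDd iDu iDd2 iDu2 eD.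
    subst Dd2 Du2.
    apply: map_iso_trans i _; apply: map_iso_trans _ (map_iso_sym v2 i2).
    by apply: mapIns_congr => //; [apply: IHd|apply: IHu].
  + exfalso; have [_ iD2 s2] := phi_diag h2.
    by apply: (dIns1_neq_dR hd hu iD2 _ eD); lia.
- have [vD iD s1] := phi_diag h.
  move eD : (dR k D) H2 => D2 H2.
  case: H2 v2 eD => {M2 D2} [M2 i2|M2 Md2 Mu2 Dd2 Du2 vd2 vu2 i2 hd2 hu2|M2 N2 k2 D2 vN2 h02 hk2 i2 h2] v2 eD.
  + by have := congr1 size eD; rewrite size_dR s1 /=; have := mroot_lt vN; lia.
  + by exfalso; apply: (dIns1_neq_dR hd2 hu2 iD _ (esym eD)); lia.
  + have [ek eD2] := dR_inj eD ltac:(lia); subst k2 D2.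
    apply: map_iso_trans i _; apply: map_iso_trans _ (map_iso_sym v2 i2).
    by apply: mapR_congr => //; apply: IH.
Qed.

Lemma phi_surj D : valid_diag D -> indecomposable D -> exists M, valid_map M /\ phi_rel M D.
Proof.
have [n] := ubnP (size D); elim: n D => // n IH D hn v iD.
have s1 := valid_size_gt1 v (proj1 iD).
have [s2|s2] := leqP (size D) 2.
  exists one_half_edge_map; split; first exact: valid_one_half_edge_map.
  suff -> : D = one_chord by apply/phi_single/map_iso_refl.
  have [a1 a2 _] := v 0 ltac:(lia); have [b1 b2 _] := v 1 s1.
  apply: diag_ext => [|i hi]; first by rewrite /=; lia.
  have [->|->] : i = 0 \/ i = 1 by lia.
    by rewrite -[RHS]/1; lia.
  by rewrite -[RHS]/0; lia.
have [/hasP[j0 _ cb0]|/hasPn ncb] := boolP (has (closed_block D) (iota 0 (size D))).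
  have [j cb jmin] := ex_minnP (ex_intro _ j0 cb0).
  have [Dd [Du [vd id vu iu [e sd su]]]] := indec_split v iD cb jmin.
  have [Md [vMd hd]] := IH Dd ltac:(lia) vd id.
  have [Mu [vMu hu]] := IH Du ltac:(lia) vu iu.
  exists (mapIns Md 1 Mu); split; first exact: valid_mapIns.
  by rewrite e; apply: (phi_bridge vMd vMu _ hd hu); apply: map_iso_refl.
have ncb' j : ~~ closed_block D j.
  apply/negP => cb; have /closed_blockP[_ jl _] := cb.
  by have /negP := ncb j ltac:(rewrite mem_iota; lia).
have [k [D' [v' i' hk e s']]] := indec_unroot v iD s2 ncb'.
have [M' [vM' h']] := IH D' ltac:(lia) v' i'.
have [_ _ sM] := phi_diag h'.
exists (mapR k M'); split; first exact: valid_mapR.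
by rewrite e; apply: (phi_root vM' _ _ _ h'); [lia|lia|apply: map_iso_refl].
Qed.

(* Away from corner 1 the inserted map commutes with the outermost operation of
   N, on maps and on diagrams alike; corner 1 is the bridge clause of phi. *)
Lemma phi_mapIns M2 D2 l N D : valid_map N -> valid_map M2 -> 0 < l <= mh N ->
  phi_rel M2 D2 -> phi_rel N D -> phi_rel (mapIns M2 l N) (dIns D2 l D).
Proof.
move=> v v2 hl h2 H; have [vD2 iD2 s2] := phi_diag h2.
elim: H v l hl => {N D} [N i|N Nd Nu Dd Du vd vu i hd IHd hu IHu|N N' k D vN' h0 hk i h IH] v l hl.
- have e1 : mh N = 1 by case: i.
  have -> : l = 1 by lia.
  by apply: (phi_bridge v2 v (map_iso_refl _) h2); apply: phi_single.
- have hN : phi_rel N (dIns Dd 1 Du) by apply: phi_bridge i hd hu.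
  have [->|l1] := eqVneq l 1; first by apply: (phi_bridge v2 v (map_iso_refl _) h2).
  have eN : mh N = (mh Nu + mh Nd).+1 by case: i.
  have [vDd iDd sd] := phi_diag hd; have [vDu iDu su] := phi_diag hu.
  have rlu := mroot_lt vu.
  have vX := valid_mapIns 1 vd vu.
  have isoX : map_iso (mapIns M2 l N) (mapIns M2 l (mapIns Nd 1 Nu)).
    by apply: mapIns_congr => //; apply: map_iso_refl.
  have gu := valid_good_corners vu; have gd := valid_good_corners vd.
  (* Labels [2..(mh Nd).+1] lie in the inserted map [Nd]; larger ones lie in the rest. *)
  have [ld|ld] := leqP l (mh Nd).+1.
    have hl1 : 0 < l.-1 <= mh Nd by lia.
    have := dIns_assoc D2 (l := l.-1) (p := Du) vDd.
    have -> : l.-1.+1 = l by lia.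
    move=> -> //; [|lia|lia].
    apply: (phi_bridge _ vu _ (IHd vd l.-1 hl1) hu); first exact: valid_mapIns.
    apply: map_iso_trans isoX _; apply: map_iso_sym.
      by apply: valid_mapIns => //; apply: valid_mapIns.
    have := @mapIns_assoc 1 l.-1 M2 Nd Nu vu vd v2.
    have -> : 1 + l.-1 = l by lia.
    by apply=> //; lia.
  have hl1 : 0 < l - (mh Nd).+1 <= mh Nu by lia.
  have := dIns_comm D2 (l := l - (mh Nd).+1) (p := Du) vDd.
  have -> : l - (mh Nd).+1 + size Dd = l by lia.
  move=> ->; last by lia.
  apply: (phi_bridge vd _ _ hd (IHu vu _ hl1)); first exact: valid_mapIns.
  apply: map_iso_trans isoX _.
  have := mapIns_comm_iso vu v2 vd (corner_lt (l - (mh Nd).+1) vu) rlu.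
  have -> : mapInsc Nd (mroot Nu) (mapInsc M2 (corner Nu (l - (mh Nd).+1)) Nu) =
     mapIns Nd 1 (mapIns M2 (l - (mh Nd).+1) Nu) by rewrite mapInsE corner1.
  have -> : mapInsc Nd (mroot Nu) Nu = mapIns Nd 1 Nu by rewrite mapInsE corner1.
  have -> : (if corner Nu (l - (mh Nd).+1) == mroot Nu then mh Nu + mh Nd
     else corner Nu (l - (mh Nd).+1)) = corner (mapIns Nd 1 Nu) l; last by rewrite -mapInsE.
  (* Label 1 of [Nu] here means the second piece of its root corner, after the half-edge that
     carries [Nd]. *)
  have [e1|e1] := eqVneq (l - (mh Nd).+1) 1.
    rewrite e1 corner1 eqxx; have -> : l = (1 + mh Nd).+1 by lia.
    by rewrite corner_I_x //; lia.
  case: eqP => [e|_].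
    by have := corner_inj gu (j := l - (mh Nd).+1) (k := 1); rewrite corner1; lia.
  have {2}-> : l = ((l - (mh Nd).+1) + mh Nd).+1 by lia.
  by rewrite corner_I_high //; lia.
- have hN : phi_rel N (dR k D) by apply: (phi_root vN' h0 hk i h).
  have [->|l1] := eqVneq l 1; first by apply: (phi_bridge v2 v (map_iso_refl _) h2).
  have eN : mh N = (mh N').+2 by case: i.
  have [vD iD sD] := phi_diag h.
  have vX := valid_mapR k vN'.
  have isoX : map_iso (mapIns M2 l N) (mapIns M2 l (mapR k N')).
    by apply: mapIns_congr => //; apply: map_iso_refl.
  have g' := valid_good_corners vN'; have g2 := valid_good_corners v2.
  have hk' : 0 < k <= mh N' by lia.
  have c_root j : 1 < j <= mh N' -> corner N' j <> mroot N'.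
    by move=> hj e; have := corner_inj g' (j := j) (k := 1); rewrite corner1; lia.
  (* Up to [k.+1] the insertion comes before the far end of the root edge and raises its label by
     [size D2]; beyond that it comes after and leaves the label alone. *)
  have [lk|lk] := leqP l k.+1.
    have hl1 : 0 < l.-1 <= mh N' by lia.
    rewrite dIns_dR_left //; [|lia|lia].
    apply: (phi_root _ _ _ _ (IH vN' l.-1 hl1)); first exact: valid_mapIns.
    + by lia.
    + by rewrite mapInsE; mhsimp; lia.
    apply: map_iso_trans isoX _.
    have := mapIns_mapR_iso vN' v2 (corner_lt l.-1 vN') (corner_lt k vN').
    rewrite -mapRE -[mapInsc M2 (corner N' l.-1) N']mapInsE.
    have -> : (if corner N' l.-1 == mroot N' then mh N' else corner N' l.-1) = corner (mapR k N') l.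
      have -> : corner (mapR k N') l = corner (mapR k N') l.-1.+1 by congr corner; lia.
      rewrite corner_R_low //; last lia.
      have [e1|e1] := eqVneq l.-1 1; first by rewrite e1 corner1 eqxx.
      by case: eqP => // /c_root; lia.
    rewrite -mapInsE.
    suff -> : (if corner N' l.-1 == corner N' k then mh N' + mh M2 else corner N' k) =
       corner (mapIns M2 l.-1 N') (k + size D2) by rewrite -mapRE.
    (* For [l.-1 = k] the far end lies right after [M2], in the corner of the connecting half-edge,
       whose label is [(k + mh M2).+1]. *)
    rewrite s2; have [e1|e1] := eqVneq l.-1 k.
      by rewrite e1 eqxx addnS corner_I_x.
    case: eqP => [e|_].
      by have := corner_inj g' (j := l.-1) (k := k); lia.
    by rewrite addnS corner_I_high //; lia.
  have hl1 : 0 < l - 2 <= mh N' by lia.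
  rewrite dIns_dR_right //; [|lia|lia].
  apply: (phi_root _ _ _ _ (IH vN' (l - 2) hl1)) => //; first exact: valid_mapIns.
    by rewrite mapInsE; mhsimp; lia.
  apply: map_iso_trans isoX _.
  have cI : corner (mapIns M2 (l - 2) N') k = corner N' k by rewrite corner_I_low //; lia.
  (* The corner of the far end itself: the same corner of [N'], but with [M2] after the root
     edge. *)
  have [e1|e1] := eqVneq (l - 2) k.
    have := mapIns_mapR_last_iso vN' v2 (corner_lt k vN').
    have -> : (mh N').+1 = corner (mapR k N') l.
      by have -> : l = k.+2 by [lia]; rewrite corner_R_b.
    by rewrite -mapRE -mapInsE -mapInsE -{1}cI e1 -mapRE.
  have := mapIns_mapR_iso vN' v2 (corner_lt (l - 2) vN') (corner_lt k vN').
  rewrite -mapRE -[mapInsc M2 (corner N' (l - 2)) N']mapInsE.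
  case: eqP => [e|_]; first by have := c_root (l - 2); lia.
  case: eqP => [e|_].
    by have := corner_inj g' (j := l - 2) (k := k); lia.
  suff -> : corner N' (l - 2) = corner (mapR k N') l by rewrite -mapInsE -cI -mapRE.
  have -> : corner (mapR k N') l = corner (mapR k N') (l - 2).+2 by congr corner; lia.
  by rewrite corner_R_high //; lia.
Qed.

(** * Comparison of phi with theta *)

Lemma theta_phi M D : valid_map M -> theta_rel M D -> phi_rel M D.
Proof.
move=> v H; elim: H v => {M D} [M i|M M1 M2 i D1 D2 D v1 v2 b1 b2 h0 hi st _ IH1 _ IH2 ds] v.
  exact: phi_single.
have {IH1} h1 := IH1 v1; have {IH2} h2 := IH2 v2.
have [vD2 _ s2] := phi_diag h2.
case: st => [[i1 iM]|[l [N [vN l0 hl i1 iM]]]].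
  have e1 := phi_inv_single i1 h1; subst D1.
  case: ds => [[_ ->]|[l [Ch [vh l0 hl e _]]]]; first exact: phi_root iM h2.
  by have := congr1 size e; rewrite size_dR /=; lia.
have hl' : 0 < l <= mh N by lia.
have [DN e hN] := phi_inv_R v1 vN hl' i1 h1; subst D1.
have [vDN _ sN] := phi_diag hN.
case: ds => [[e _]|[l' [Ch [vh l0' hl2 e ->]]]].
  by have := congr1 size e; rewrite size_dR sN /=; have := mroot_lt vN; lia.
(* The decomposition of [D1] recorded in [dstar] is the one that comes from the map, so both
   products use the same [l]. *)
have [el eN] := dR_inj e ltac:(lia); subst l' Ch.
apply: (phi_root _ _ _ iM); first exact: valid_mapIns.
- by lia.
- by rewrite mapInsE; mhsimp; lia.
- exact: phi_mapIns.
Qed.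

Lemma phi_theta M D : valid_map M -> bridgeless M -> phi_rel M D -> theta_rel M D.
Proof.
have [n] := ubnP (mh M); elim: n M D => // n IH M D hn v b h.
case: (map_decomposition v) => [i|[Md [Mu [vd vu i]]]|[k [M' [vM' hk i]]]].
- by rewrite (phi_inv_single i h); apply: th_single.
- exfalso; have [_ [f hf]] := i.
  have bI := bridgeless_iso v (valid_mapIns 1 vd vu) i b.
  have rl := mroot_lt vu.
  apply: (bI (mh Mu + mh Md)); first by rewrite mapInsE; mhsimp.
  apply/is_bridgeE/fbridgeP; rewrite mapInsE corner1.
  rewrite -[nth 0 (malp _)]/(alp _) -(extI_alp vu vd rl); apply: fbridge_Ic_x => //.
  by split; [exact: alp_lt|exact: alpK|exact: alp_root].
have eM : mh M = (mh M').+2 by case: i.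
have [D' eD h'] := phi_inv_R v vM' hk i h; subst D.
have [b'|nb'] := classic (bridgeless M').
  apply: (@th_star _ one_half_edge_map M' k one_chord D').
  - exact: valid_one_half_edge_map.
  - by [].
  - move=> e el /is_bridgeE[]; case; have -> : e = 0 by move: el => /=; lia.
    by [].
  - by [].
  - by lia.
  - by lia.
  - by left; split=> //; apply: map_iso_refl.
  - by apply/th_single/map_iso_refl.
  - by apply: IH => //; lia.
  - by left.
have [N [M2 [l [vN v2 hl i' b2]]]] := last_bridge vM' nb'.
have eM' : mh M' = (mh N + mh M2).+1 by case: i'.
have vI := valid_mapIns l v2 vN.
have iR : map_iso M (mapR k (mapIns M2 l N)).
  by apply: map_iso_trans i _; apply: mapR_congr.
have vR := valid_mapR k vI.
have bR := bridgeless_iso v vR iR b.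
have gN := valid_good_corners vN; have g2 := valid_good_corners v2.
have cl := corner_lt l vN.
(* With any other [k] both ends of the root edge would lie on the side of [N], and the connecting
   edge would remain a bridge of [M]. *)
have kl : l < k <= l + mh M2.
  apply/negPn/negP => nk.
  have hc : corner (mapIns M2 l N) k < mh N \/ corner (mapIns M2 l N) k = mh N + mh M2.
    have [kl|kl] := leqP k l; first by left; rewrite corner_I_low ?corner_lt //; lia.
    have [ek|ek] := eqVneq k (l + mh M2).+1; first by right; rewrite ek corner_I_x.
    have -> : k = ((k - (mh M2).+1) + mh M2).+1 by lia.
    by left; rewrite corner_I_high ?corner_lt //; lia.
  apply: (bR (mh N + mh M2)); first by rewrite mapRE mapInsE; mhsimp; lia.
  by apply/is_bridgeE; rewrite mapRE; apply: fbridge_R_I_x.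
(* [j] is the label, within [M2], of the corner where the root edge of [M] ends. *)
set j := k - l; have kE : k = j + l by rewrite /j; lia.
have ju : corner (mapIns M2 l N) k = corner M2 j + mh N.
  by rewrite kE addnC corner_I_mid //; rewrite /j; lia.
have v1 : valid_map (mapR l N) by apply: valid_mapR.
(* A bridge among the half-edges of [N] would persist in [M], where the root edge is replaced by a
   route through [M2]; the root edge itself is never a bridge. *)
have b1 : bridgeless (mapR l N).
  move=> e; rewrite mapRE; mhsimp => el /is_bridgeE be.
  have nba := not_fbridge_Rc_root vN cl.
  have [em|em] := ltnP e (mh N).
    apply: (bR e); first by rewrite mapRE mapInsE; mhsimp; lia.
    apply/is_bridgeE; rewrite mapRE ju mapInsE.
    exact: (fbridge_R_I_old v2 vN cl (corner_lt j v2) em be).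
  have [ea|ea] := eqVneq e (mh N); first by apply: nba; rewrite -ea.
  have eb : e = (mh N).+1 by lia.
  apply: nba; rewrite -(alp_Rc_b vN cl) -eb.
  by apply: fbridge_alp => //; rewrite eb; mhsimp.
have [D1 h1] := phi_exists v1; have [D2 h2] := phi_exists v2.
have [DN eD1 hN] := phi_inv_R v1 vN hl (map_iso_refl _) h1; subst D1.
have hI := phi_mapIns vN v2 hl h2 hN.
have hI' : phi_rel M' (dIns D2 l DN) by apply: phi_iso hI.
(* [D'] was obtained from [M'] as a whole; uniqueness identifies it with the insertion computed from
   [N] and [M2]. *)
rewrite (phi_unique vM' h' hI').
have [vDN _ sN] := phi_diag hN.
have rl2 := mroot_lt v2; have rlN := mroot_lt vN.
apply: (@th_star _ (mapR l N) M2 j (dR l DN) D2) => //.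
- by rewrite /j; lia.
- by rewrite /j; lia.
- right; exists l, N; split=> //; try lia; first exact: map_iso_refl.
  by rewrite -kE.
- by apply: IH => //; rewrite mapRE; mhsimp; lia.
- by apply: IH => //; lia.
- right; exists l, DN; split=> //; try lia.
  by rewrite -kE.
Qed.

Lemma theta_connected M D : valid_map M -> theta_rel M D -> connected_diag D.
Proof.
move=> v H; elim: H v => {M D} [M i|M M1 M2 i D1 D2 D v1 v2 b1 b2 h0 hi st t1 IH1 t2 IH2 ds] v.
  apply: (@connected_diagP _ 0) => //; first exact: valid_one_chord.
  case=> [|[|j]] // _; first exact: cr_refl.
  by apply: (cr_mate (j := 0)); apply: cr_refl.
(* Validity and size of [D2] are read off through phi, which turns the bound on the corner [i] into
   a bound on the interval [i]. *)
have [vD2 _ s2] := phi_diag (theta_phi v2 t2).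
case: ds => [[_ ->]|[l [Ch [vh l0 hl e ->]]]].
  by apply: connected_dR => //; [apply: IH2|lia].
apply: connected_dstar_step => //; [lia| |exact: IH2|lia].
by rewrite -e; apply: IH1.
Qed.

Theorem theorem4p3 :
  (* phi is a well-defined function on rooted maps ... *)
  (forall M, valid_map M -> exists! D, phi_rel M D) /\
  (* ... constant on isomorphism classes ... *)
  (forall M1 M2 D, valid_map M1 -> valid_map M2 -> map_iso M1 M2 ->
     phi_rel M1 D -> phi_rel M2 D) /\
  (* ... size preserving, with values indecomposable chord diagrams ... *)
  (forall M D, valid_map M -> phi_rel M D ->
     [/\ valid_diag D, indecomposable D & dsize D = msize M]) /\
  (* ... injective on isomorphism classes ... *)
  (forall M1 M2 D, valid_map M1 -> valid_map M2 ->
     phi_rel M1 D -> phi_rel M2 D -> map_iso M1 M2) /\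
  (* ... and onto the indecomposable chord diagrams; *)
  (forall D, valid_diag D -> indecomposable D ->
     exists M, valid_map M /\ phi_rel M D) /\
  (* on bridgeless maps phi coincides with theta; *)
  (forall M D, valid_map M -> bridgeless M -> (phi_rel M D <-> theta_rel M D)) /\
  (* hence phi sends bridgeless maps to connected chord diagrams. *)
  (forall M D, valid_map M -> bridgeless M -> phi_rel M D -> connected_diag D).
Proof.
split=> [M v|].
  have [D h] := phi_exists v; exists D; split=> // D'; exact: phi_unique.
split=> [M1 M2 D v1 _ i|]; first by apply/phi_iso/map_iso_sym.
split=> [M D _ /phi_diag[vD iD s]|]; first by rewrite /dsize /msize s.
split; first exact: phi_inj.
split; first exact: phi_surj.
split=> [M D v b|M D v b h]; first by split; [exact: phi_theta|exact: theta_phi].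
exact: theta_connected v (phi_theta v b h).
Qed.
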